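(* Let $M$ be a complete noncompact $n$-dimensional Alexandrov space with nonnegative curvature satisfying $\widetilde{\mathrm{ob}}_{0,\infty}(M)=\pi/2$. If $M$ has no boundary, then $M$ is isometric to the Euclidean space $\mathbb R^n$.
   Context: Alexandrov spaces are taken in the sense of Burago–Gromov–Perelman and are assumed finite-dimensional; boundary is in the sense of Alexandrov geometry. $|x,y|$ denotes distance. For $\kappa\le 0$ and distinct points $x,p,q$, the comparison angle $\tilde\angle_\kappa xpq$ is the angle at $\tilde p$ of a triangle $\tilde x\tilde p\tilde q$ with side lengths $|x,p|,|p,q|,|q,x|$ in the simply connected complete surface of constant curvature $\kappa$ (the Euclidean plane for $\kappa=0$). For $M$ complete noncompact with curvature $\ge\kappa$ and $p\ne q\in M$ set $$\widetilde{\mathrm{ob}}_{\kappa,\infty}(p,q)=\limsup_{x\to\infty}\max\{\tilde\angle_\kappa xpq,\tilde\angle_\kappa xqp\}-\pi/2$$ (limsup as $x$ leaves every bounded set). The comparison $\kappa$-obtuse constant of $M$ from infinity is $$\widetilde{\mathrm{ob}}_{\kappa,\infty}(M)=\inf_{p\ne q}\widetilde{\mathrm{ob}}_{\kappa,\infty}(p,q),$$ the infimum being over all pairs of distinct points of $M$. *)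

(* Defs.v *)
From HB Require Import structures.
From mathcomp Require Import all_boot all_order all_algebra.
From mathcomp Require Import all_classical all_reals all_analysis.
From mathcomp Require Import ring.

Set Implicit Arguments.
Unset Strict Implicit.
Unset Printing Implicit Defensive.

Import Order.TTheory GRing.Theory Num.Theory.
Import numFieldNormedType.Exports.

Local Open Scope classical_set_scope.
Local Open Scope ring_scope.

Section Euclidean.
Context {R : realType} {n : nat}.
Implicit Types u v : 'rV[R]_n.

(* The library norm on ['rV[R]_n] is the sup norm, hence these definitions. *)
Definition euclidean_dot u v : R := \sum_(i < n) u 0 i * v 0 i.

Definition euclidean_dist u v : R :=
  Num.sqrt (\sum_(i < n) (u 0 i - v 0 i) ^+ 2).

Definition euclidean_angle (x p y : 'rV[R]_n) : R :=
  acos (euclidean_dot (x - p) (y - p)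
        / (euclidean_dist x p * euclidean_dist p y)).

Lemma sqr_euclidean_dist u v :
  euclidean_dist u v ^+ 2 = \sum_(i < n) (u 0 i - v 0 i) ^+ 2.
Proof. by rewrite sqr_sqrtr// sumr_ge0// => i _; rewrite sqr_ge0. Qed.

End Euclidean.

Section MetricGeometry.
Context {R : realType}.
Implicit Types M S : metricType R.

Definition metric_complete M : Prop :=
  forall F : set_system M, ProperFilter F -> cauchy F ->
    exists l : M, F --> l.

Definition metric_bounded M (B : set M) : Prop :=
  exists (p : M) (r : R), forall x, B x -> mdist p x <= r.

(* The filter of "x tends to infinity", i.e. x leaves every bounded set. *)
Definition at_infinity M : set_system M :=
  [set A | exists2 B : set M, metric_bounded B & ~` B `<=` A].
Arguments at_infinity M : clear implicits.

Definition curve_length M (c : R -> M) : \bar R :=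
  ereal_sup [set (\sum_(0 <= i < size s)
                    mdist (c (nth 1 (0 :: s) i)) (c (nth 1 s i)))%:E
            | s in itv_partition 0 1].

Definition intrinsic_metric M : Prop :=
  forall x y : M, (mdist x y)%:E =
    ereal_inf [set curve_length c | c in
      [set c : R -> M | {within `[0, 1], continuous c} /\ c 0 = x /\ c 1 = y]].

(* Empty sets have diameter 0, not the supremum -oo of the empty set. *)
Definition diameter M (A : set M) : \bar R :=
  ereal_sup (0%E |` [set (mdist x y)%:E | x in A & y in A]).

Definition hausdorff_content M (s delta : R) (A : set M) : \bar R :=
  ereal_inf [set (\sum_(0 <= i <oo) (diameter (U i) `^ s))%E | U in
    [set U : (set M)^nat | A `<=` \bigcup_i U i /\
                           forall i, (diameter (U i) <= delta%:E)%E]].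

Definition hausdorff_measure M (s : R) (A : set M) : \bar R :=
  ereal_sup [set hausdorff_content s delta A | delta in [set d : R | 0 < d]].

(* Restricting to s > 0 does not change the infimum and avoids 0 `^ 0 = 1. *)
Definition hausdorff_dim M : \bar R :=
  ereal_inf [set s%:E | s in
    [set s : R | 0 < s /\ hausdorff_measure s [set: M] = 0%E]].

(* The Euclidean comparison angle at p of the triangle x p y, by the law of
   cosines; it is meaningful for p <> x and p <> y. *)
Definition comparison_angle M (x p y : M) : R :=
  acos ((mdist x p ^+ 2 + mdist p y ^+ 2 - mdist x y ^+ 2)
        / (2 * (mdist x p * mdist p y))).

Lemma comparison_angleE M (x p y : M) (x' p' y' : 'rV[R]_2) :
  euclidean_dist x' p' = mdist x p ->
  euclidean_dist p' y' = mdist p y ->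
  euclidean_dist x' y' = mdist x y ->
  comparison_angle x p y = euclidean_angle x' p' y'.
Proof.
rewrite /comparison_angle /euclidean_angle => <- <- <-; congr acos.
rewrite invfM mulrA; congr (_ * _).
rewrite !sqr_euclidean_dist -big_split/= -sumrB /euclidean_dot mulr_suml.
apply: eq_bigr => i _; rewrite !mxE.
apply: (mulIf (x := 2)); first by rewrite pnatr_eq0.
rewrite mulfVK ?pnatr_eq0//; ring.
Qed.

(* Burago-Gromov-Perelman quadruple condition for kappa = 0. *)
Definition nonneg_curvature M : Prop :=
  forall x : M, exists2 U : set M, nbhs x U &
    forall a b c d : M, U a -> U b -> U c -> U d -> uniq [:: a; b; c; d] ->
      comparison_angle b a c + comparison_angle c a d + comparison_angle d a b
        <= 2 * pi.

Record nonneg_alexandrov_space (n : nat) M : Prop := {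
  nonneg_alexandrov_complete : metric_complete M;
  nonneg_alexandrov_intrinsic : intrinsic_metric M;
  nonneg_alexandrov_curvature : nonneg_curvature M;
  nonneg_alexandrov_dim : hausdorff_dim M = (n%:R)%:E }.

(* Shortest paths issuing from p, parametrized by arc length on [0, length];
   the values of the underlying function elsewhere are irrelevant. *)
Record shortest_path M (p : M) := {
  shortest_path_length : R;
  shortest_path_fun :> R -> M;
  shortest_path_length_gt0 : 0 < shortest_path_length;
  shortest_path_start : shortest_path_fun 0 = p;
  shortest_path_dist : forall s t : R,
    0 <= s <= shortest_path_length -> 0 <= t <= shortest_path_length ->
    mdist (shortest_path_fun s) (shortest_path_fun t) = `|s - t| }.

Definition is_angle M (p : M) (c1 c2 : shortest_path p) (theta : R) : Prop :=
  comparison_angle (c1 st.1) p (c2 st.2)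
    @[st --> filter_prod (0 : R)^'+ (0 : R)^'+] --> theta.

(* S is a completion of the set of shortest paths from p with the angle as
   (pseudo)distance; shortest paths making a zero angle are identified because
   S is a metric space. This determines S up to isometry. *)
Definition is_space_of_directions M (p : M) S : Prop :=
  metric_complete S /\
  exists dir : shortest_path p -> S,
    dense (range dir) /\
    forall c1 c2, is_angle c1 c2 (mdist (dir c1) (dir c2)).

(* p is a boundary point of the 1-dimensional manifold M: some neighborhood of
   p is homeomorphic to [0, 1) with p corresponding to 0. *)
Definition manifold_boundary_point1 M (p : M) : Prop :=
  exists (U : set M) (f : M -> R) (g : R -> M),
    [/\ nbhs p U, {within U, continuous f}, {within `[0, 1[, continuous g},
        f @` U `<=` `[0, 1[ & g @` `[0, 1[ `<=` U] /\
    [/\ {in U, cancel f g}, {in `[0, 1[, cancel g f} & f p = 0].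

(* Boundary points of an n-dimensional Alexandrov space, by induction on n: the
   space of directions at a point has dimension n - 1. *)
Fixpoint boundary_point (n : nat) : forall M, M -> Prop :=
  match n with
  | 0 => fun _ _ => False
  | m.+1 => fun M p =>
    if m is 0 then manifold_boundary_point1 p
    else exists2 S : metricType R, is_space_of_directions p S &
           exists xi : S, boundary_point m xi
  end.

Definition without_boundary (n : nat) M : Prop :=
  [set p : M | boundary_point n p] = set0.

Definition comparison_obtuse_pair M (p q : M) : \bar R :=
  (limf_esup (fun x => (Num.max (comparison_angle x p q)
                                (comparison_angle x q p))%:E)
             (at_infinity M)
   - (pi / 2)%:E)%E.

Definition comparison_obtuse_constant M : \bar R :=
  ereal_inf [set comparison_obtuse_pair pq.1 pq.2 | pq in
    [set pq : (M * M)%type | pq.1 <> pq.2]].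

Definition isometric_to_euclidean M (n : nat) : Prop :=
  exists2 f : M -> 'rV[R]_n, bijective f &
    forall x y, euclidean_dist (f x) (f y) = mdist x y.

End MetricGeometry.

(* Main.v *)
(* Nonnegative curvature makes squared distance functions 2-concave along
   geodesics (local comparison plus Toponogov globalization, once local
   compactness is known), and the obtuse constant pi/2 means that every segment pq
   extends to a ray beyond p or beyond q. Extending a chord of a sphere of radius r
   to infinity and coming back along the radius shows that the supremum D of its
   chords satisfies D^2 >= 2 r^2 + r D, so D = 2 r as soon as the sphere has two
   points. If this happens for all spheres around one center, the antipodal pairs
   converge to a line, whose Busemann function splits off a factor R, and the other
   factor has the same properties. Otherwise far away points are unique and the
   space is a point or a half-line. Hence M is R^k or R^k x [0, oo), where Hausdorff
   measure determines the dimension; in a half space, the iterated spaces of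
   directions at a point of the bounding hyperplane are hemispheres, down to a
   half circle, so such a point is a boundary point. *)
From HB Require Import structures.
Require Import Defs.
From mathcomp Require Import all_boot all_order all_algebra.
From mathcomp Require Import all_classical all_reals all_analysis.
From mathcomp Require Import ring lra.

Set Implicit Arguments.
Unset Strict Implicit.
Unset Printing Implicit Defensive.

Import Order.TTheory GRing.Theory Num.Theory.
Import numFieldNormedType.Exports.

Local Open Scope classical_set_scope.
Local Open Scope ring_scope.

(** * Ultralimits of real sequences *)

(** A fixed nonprincipal ultrafilter on [nat] gives every bounded real sequence a limit, so no
    subsequences are extracted and properness becomes the condition [ultracompact] on a bare
    distance function. Distances live on plain types because splitting produces new factors, as
    level sets, to which all properties must pass. The order of the metric part is forced: an
    intrinsic metric has only nearly shortest curves until balls are known to be totally bounded, so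
    the comparison that proves this must be stated for limits of quadruples. Total boundedness comes
    from the dimension: arbitrarily many separated points, contracted towards every nearby point,
    would make every Hausdorff measure nonzero. The same tree argument, with grids in orthants,
    bounds the number of lines split off, so the splitting stops. *)

Section UltraLimits.
Context {R : realType} (U : set_system nat).
Hypothesis UU : UltraFilter U.
Hypothesis Uoo : \oo `<=` U.

Let UP : ProperFilter U. Proof. exact: ultra_proper. Qed.

(** Compactness of [[- C, C]] gives a cluster point; the ultrafilter contains each ball around it or
    its complement, and clustering excludes the complement. *)
Lemma ultra_bounded_cvg (x : nat -> R) (C : R) :
  (forall n, `|x n| <= C) -> exists l : R, x @ U --> l.
Proof.
move=> xC; have Ux : (x @ U) [set` `[- C, C]].
  apply: (@filterS _ U _ setT _ _ filterT) => n _ /=.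
  by rewrite in_itv/= -ler_norml.
have [l [_ cl]] := @segment_compact R (- C) C (x @ U) _ Ux.
exists l => B /= [e /= e0 eB].
have [//|UN] := in_ultra_setVsetC (x @^-1` (ball l e)) UU.
  by apply: filterS => n /= /eB.
have [y [/= ny]] := cl (~` ball l e) (ball l e) UN (nbhsx_ballx _ _ e0).
by move=> /ny.
Qed.

Lemma ultra_le (x y : nat -> R) (a b : R) : x @ U --> a -> y @ U --> b ->
  (forall n, x n <= y n) -> a <= b.
Proof.
move=> xa yb xy; rewrite -(cvg_lim (@Rhausdorff R) xa).
rewrite -(cvg_lim (@Rhausdorff R) yb); apply: ler_lim.
- by apply/cvg_ex; exists a.
- by apply/cvg_ex; exists b.
- by apply: (@filterS _ _ _ setT _ _ filterT) => n _.
Qed.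

Lemma ultra_unique (x : nat -> R) (a b : R) : x @ U --> a -> x @ U --> b -> a = b.
Proof. by move=> xa xb; apply/eqP; rewrite eq_le !(@ultra_le x x). Qed.

Lemma ultra_invn (c : R) : (c / n.+1%:R) @[n --> U] --> (0 : R).
Proof.
have h : (c / n.+1%:R) @[n --> \oo] --> (0 : R).
  rewrite -[X in _ --> X](mulr0 c); apply: cvgM; first exact: cvg_cst.
  exact: cvg_harmonic.
by move=> A /h; apply: Uoo.
Qed.

Lemma ultra_squeeze0 (x : nat -> R) (y : nat -> R) : (forall n, 0 <= x n <= y n) ->
  y @ U --> (0 : R) -> x @ U --> (0 : R).
Proof.
move=> xy y0; apply: (@squeeze_cvgr _ _ _ _ (cst 0) y) => //; last exact: cvg_cst.
by apply: (@filterS _ _ _ setT _ _ filterT) => n _; exact: xy.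
Qed.

End UltraLimits.

(** Reads off a leading coefficient: the inequalities below come from points sent to infinity, with
    [L] an unbounded distance and [C] a bounded remainder. *)
Lemma le0_of_unbounded {R : realType} (X C T0 : R) :
  (forall T, T0 <= T -> exists2 L, T <= L & L * X <= C) -> X <= 0.
Proof.
move=> h; rewrite leNgt; apply/negP => X0.
have [|L] := h (Num.max T0 ((`|C| + 1) / X)); first by rewrite le_max lexx.
rewrite ge_max => /andP[_]; rewrite ler_pdivrMr// => h1 h2.
by have := ler_norm C; lra.
Qed.

(** * Spaces whose segments extend to rays *)

Section Spaces.
Context {R : realType} (U : set_system nat).
Record metric_axioms T (d : T -> T -> R) : Prop := {
  dist_refl : forall x, d x x = 0 ;
  dist_eq0 : forall x y, d x y = 0 -> x = y ;
  dist_sym : forall x y, d x y = d y x ;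
  dist_tri : forall x y z, d x z <= d x y + d y z }.

Definition geodesic T (d : T -> T -> R) := forall x y t, 0 <= t <= 1 ->
  exists2 z, d x z = t * d x y & d z y = (1 - t) * d x y.

(** Stewart's theorem as an inequality: in the Euclidean plane both sides are equal. *)
Definition semiconcave T (d : T -> T -> R) := forall x y z q t, 0 <= t <= 1 ->
  d x z = t * d x y -> d z y = (1 - t) * d x y ->
  (1 - t) * d q x ^+ 2 + t * d q y ^+ 2 - t * (1 - t) * d x y ^+ 2 <= d q z ^+ 2.

(** A weak form of a ray: the points for different [s] need not lie on a common one, so each can be
    obtained by its own limit. *)
Definition extends_beyond T (d : T -> T -> R) p q :=
  forall s, 0 <= s -> exists2 y, d q y = s & d p y = d p q + s.

Definition extendable T (d : T -> T -> R) := forall p q, p <> q ->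
  extends_beyond d p q \/ extends_beyond d q p.

(* Properness, phrased so that it passes to metric factors without a topology. *)
Definition ultracompact T (d : T -> T -> R) := forall (x : nat -> T) o C,
  (forall n, d o (x n) <= C) -> exists l, d (x n) l @[n --> U] --> (0 : R).

Record ob_space T (d : T -> T -> R) : Prop := {
  ob_metric : metric_axioms d ;
  ob_geodesic : geodesic d ;
  ob_semiconcave : semiconcave d ;
  ob_extendable : extendable d ;
  ob_ultracompact : ultracompact d }.

End Spaces.

(** * Antipodal points on spheres *)

Section ObSpaces.
Context {R : realType} (U : set_system nat).
Hypothesis UU : UltraFilter U.
Hypothesis Uoo : \oo `<=` U.
Context (T : Type) (d : T -> T -> R).
Hypothesis md : metric_axioms d.

Let UP : ProperFilter U. Proof. exact: ultra_proper. Qed.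
Let d0 := dist_refl md.
Let dsym := dist_sym md.
Let dtri := dist_tri md.

Lemma dist_ge0 x y : 0 <= d x y.
Proof. by have := dtri x y x; rewrite d0 (dsym y x); lra. Qed.

Lemma dist_dist x y z : `|d x z - d y z| <= d x y.
Proof.
have := dtri x y z; have := dtri y x z; rewrite (dsym y x) ler_norml; lra.
Qed.

Lemma ultra_dist (x : nat -> T) l y : d (x n) l @[n --> U] --> (0 : R) ->
  d (x n) y @[n --> U] --> d l y.
Proof.
move=> xl; apply/cvgrPdist_le => e e0; near=> n.
have := dist_dist l (x n) y; move=> /le_trans; apply.
rewrite dsym -[leLHS]ger0_norm ?dist_ge0//; near: n.
by apply: cvgr0_norm_le.
Unshelve. all: end_near. Qed.

Lemma dist_ultra2 (x y : nat -> T) l m :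
  d (x n) l @[n --> U] --> (0 : R) -> d (y n) m @[n --> U] --> (0 : R) ->
  d (x n) (y n) @[n --> U] --> d l m.
Proof.
move=> xl ym.
have dl : d (x n) l + d (y n) m @[n --> U] --> (0 : R).
  by rewrite -[X in _ --> X]addr0; exact: cvgD.
apply/cvgrPdist_le => e e0; near=> n.
have h : `|d l m - d (x n) (y n)| <= d (x n) l + d (y n) m.
  have := dtri l (x n) m; have := dtri (x n) (y n) m; have := dtri (x n) l (y n).
  have := dtri l m (y n).
  rewrite (dsym l (x n)) (dsym m (y n)) ler_norml; lra.
rewrite (le_trans h)// (le_trans (ler_norm _))//; near: n.
by apply: cvgr0_norm_le.
Unshelve. all: end_near. Qed.

Hypothesis gd : geodesic d.
Hypothesis sc : semiconcave d.

Lemma point_at_dist x y s : 0 <= s <= d x y ->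
  exists2 z, d x z = s & d z y = d x y - s.
Proof.
have := dist_ge0 x y; rewrite le_eqVlt => /orP[/eqP xy0|xy0] sxy.
  by exists x; rewrite ?d0; lra.
have [|z h1 h2] := @gd x y (s / d x y).
  by rewrite divr_ge0 ?ler_pdivrMr ?mul1r//=; lra.
by exists z; rewrite ?h1 ?h2 ?mulrBl ?divfK ?mul1r; lra.
Qed.

Lemma stewart x y z q : d x z + d z y = d x y ->
  d z y * d q x ^+ 2 + d x z * d q y ^+ 2 - d x z * d z y * d x y
    <= d x y * d q z ^+ 2.
Proof.
have := dist_ge0 x y; rewrite le_eqVlt => /orP[/eqP xy0|xy0] e.
  have := dist_ge0 x z; have := dist_ge0 z y => h1 h2.
  have -> : d z y = 0 by lra.
  have -> : d x z = 0 by lra.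
  by rewrite -xy0; lra.
have := @sc x y z q (d x z / d x y).
rewrite divfK ?gt_eqF// mulrBl divfK ?gt_eqF// mul1r => /(_ _ erefl).
rewrite divr_ge0 ?dist_ge0//= ler_pdivrMr// mul1r.
have -> : d x z <= d x y by have := dist_ge0 z y; lra.
move=> /(_ isT); have zy : d z y = d x y - d x z by lra.
move=> /(_ zy) h.
rewrite -(ler_pM2l xy0) in h; apply: le_trans h; rewrite le_eqVlt; apply/orP; left.
by apply/eqP; rewrite zy; field; rewrite gt_eqF.
Qed.

Lemma stewart_sub x y z q (s : R) : 0 <= s -> d x z = s -> d x y = d z y + s ->
  (d x y - s) * d q x ^+ 2 + s * d q y ^+ 2 - s * (d x y - s) * d x y
    <= d x y * d q z ^+ 2.
Proof.
move=> s0 xz xy; have zy : d z y = d x y - s by lra.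
by have := @stewart x y z q; rewrite xz zy; apply; lra.
Qed.

Hypothesis ex : extendable d.
Hypothesis uc : ultracompact U d.

Definition nontrivial_sphere o r := exists x y, [/\ x <> y, d o x = r & d o y = r].

(* Extend xy beyond y to a point z far away and come back to the sphere along zo. *)
Lemma extends_beyond_sphere o (r : R) x y (D : R) : 0 < r -> x <> y -> d o x = r -> d o y = r ->
  (forall z, d o z = r -> d x z <= D) -> extends_beyond d x y ->
  2 * r ^+ 2 + r * d x y <= D ^+ 2.
Proof.
move=> r0 xy ox oy hD hex; set c := d x y.
have c0 : 0 <= c by exact: dist_ge0.
suff : 2 * r ^+ 2 + r * c - D ^+ 2 <= 0 by lra.
apply: (@le0_of_unbounded _ _ (r ^+ 2 * c + 2 * r ^+ 3) (r + r)) => S0 S0r.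
have [z yz xz] := hex (S0 + r) ltac:(lra).
set L := d o z; exists L.
  by have := dtri y o z; rewrite (dsym y o) oy yz -/L; lra.
have L0 : 0 < L by have := dtri y o z; rewrite (dsym y o) oy yz -/L; lra.
have Lub : L <= r + (S0 + r) by have := dtri o y z; rewrite oy yz.
have h1 : S0 + r - r <= L by have := dtri y o z; rewrite (dsym y o) oy yz -/L; lra.
have [w ow wz] := @point_at_dist o z r ltac:(rewrite -/L; lra).
have := hD w ow => xw.
(* Seen from [x], the segment [oz] bounds [d x w] from below ([h2]); seen from [o], the segment [xz]
   bounds [L] from above ([h3]). Together they leave [L] times the wanted quantity, up to a bounded
   error. *)
have := @stewart_sub o z w x r ltac:(lra) ow ltac:(lra).
rewrite (dsym x o) ox xz -/L -/c => h2.
have := @stewart x z y o ltac:(lra).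
rewrite oy ox yz xz -/L -/c => h3.
have xw2 : d x w ^+ 2 <= D ^+ 2 by rewrite ler_pXn2r ?nnegrE ?dist_ge0// (le_trans _ xw)// dist_ge0.
have ct : 0 < c + (S0 + r) by lra.
have h4 : c * L ^+ 2 <= c * (r ^+ 2 + (S0 + r) * (c + (S0 + r))).
  by nra.
have cp : 0 < c.
  by rewrite lt_neqAle c0 andbT; apply/eqP => /esym/(dist_eq0 md).
have {}h4 : L ^+ 2 <= r ^+ 2 + (S0 + r) * (c + (S0 + r)) by rewrite -(ler_pM2l cp).
have h5 : L * (2 * r ^+ 2) + r * (c * (c + (S0 + r)) - 2 * r ^+ 2) <= L * D ^+ 2.
  have : L * d x w ^+ 2 <= L * D ^+ 2 by rewrite ler_pM2l.
  by nra.
have : r * c * L <= r * c * (r + (S0 + r)) by rewrite ler_wpM2l// mulr_ge0//; lra.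
have : 0 <= r * c by rewrite mulr_ge0//; lra.
by nra.
Qed.

Lemma antipodal_points o (r : R) : 0 < r -> nontrivial_sphere o r ->
  exists x y, [/\ d o x = r, d o y = r & d x y = 2 * r].
Proof.
move=> r0 [x0 [y0 [xy0 ox0 oy0]]].
pose E := [set c | exists x y, [/\ d o x = r, d o y = r & d x y = c]].
have Eub : ubound E (2 * r).
  move=> _ [x [y [ox oy <-]]]; have := dtri x o y; rewrite (dsym x o); lra.
have supE : has_sup E by split; [exists (d x0 y0), x0, y0|exists (2 * r)].
pose D := sup E.
have DE c : E c -> c <= D by rewrite /D => Ec; exact: (sup_upper_bound supE).
have c0 : 0 < d x0 y0.
  by rewrite lt_neqAle dist_ge0 andbT; apply/eqP => /esym/(dist_eq0 md).
have D0 : 0 < D by apply: lt_le_trans c0 _; apply: DE; exists x0, y0.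
have key x y : x <> y -> d o x = r -> d o y = r -> 2 * r ^+ 2 + r * d x y <= D ^+ 2.
  move=> xy ox oy; have [h|h] := ex xy.
    by apply: (extends_beyond_sphere r0 xy ox oy) => // z oz; apply: DE; exists x, z.
  rewrite dsym; apply: (extends_beyond_sphere r0 _ oy ox) => //.
    exact: nesym.
  by move=> z oz; apply: DE; exists y, z.
have D2 : 2 * r <= D.
  suff : 2 * r ^+ 2 + r * D <= D ^+ 2.
    move=> h; have : 0 <= (D - 2 * r) * (D + r) by lra.
    by rewrite pmulr_lge0; lra.
  rewrite -lerBrDl mulrC -ler_pdivlMr//; apply: ge_sup; first by case: supE.
  move=> c [x [y [ox oy <-]]]; rewrite ler_pdivlMr//.
  have [->|xy] := pselect (x = y).
    rewrite d0 mul0r; have := key _ _ xy0 ox0 oy0.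
    by have := mulr_ge0 (ltW r0) (ltW c0); lra.
  have := key _ _ xy ox oy; by lra.
have D2r : D = 2 * r by apply/eqP; rewrite eq_le D2 andbT; apply: ge_sup => //; case: supE.
(* The supremum is attained: the endpoints of nearly longest chords converge along the
   ultrafilter. *)
have /choice[xs /choice[ys hxy]] (n : nat) : exists x y,
    [/\ d o x = r, d o y = r & 2 * r - 2 / n.+1%:R <= d x y].
  have n0 : (0 : R) < 2 / n.+1%:R by rewrite divr_gt0.
  have [c [x [y [ox oy <-]]]] := sup_adherent n0 supE; rewrite -/D => h.
  by exists x, y; split => //; rewrite D2r in h; exact: ltW.
have [x xsx] := @uc xs o r ltac:(by move=> n; have [-> _ _] := hxy n).
have [y ysy] := @uc ys o r ltac:(by move=> n; have [_ -> _] := hxy n).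
have sph (z : T) (zs : nat -> T) : (forall n, d o (zs n) = r) ->
    d (zs n) z @[n --> U] --> (0 : R) -> d o z = r.
  move=> h1 h2; rewrite dsym; apply: (@ultra_unique R U UU (fun=> r)).
    have -> : (fun=> r) = (fun n => d (zs n) o).
      by apply/funext => n; rewrite dsym h1.
    exact: ultra_dist.
  exact: cvg_cst.
have ox : d o x = r by apply: (sph _ xs) => // n; have [] := hxy n.
have oy : d o y = r by apply: (sph _ ys) => // n; have [] := hxy n.
exists x, y; split => //.
apply/eqP; rewrite eq_le; apply/andP; split.
  by have := dtri x o y; rewrite (dsym x o) ox oy; lra.
apply: (ultra_le UU _ (dist_ultra2 xsx ysy)); last first.
  by move=> n; have [_ _ h] := hxy n; exact: h.
rewrite -[X in _ --> X]subr0; apply: cvgB; [exact: cvg_cst|].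
exact: ultra_invn.
Qed.

End ObSpaces.

(** * Splitting off a line *)

Section AffineFunctions.
Context {R : realType} (T : Type) (d : T -> T -> R).
Hypothesis md : metric_axioms d.
Hypothesis sc : semiconcave d.

Let d0 := dist_refl md.
Let dsym := dist_sym md.
Let dtri := dist_tri md.

(* The coordinate along a line factor; below it arises as a Busemann function. *)
Record affine_function (f : T -> R) : Prop := {
  affine_lip : forall x y, f x - f y <= d x y ;
  affine_flow : forall x s, exists2 y, d x y = `|s| & f y = f x + s }.

Lemma affine_functionN f : affine_function f -> affine_function (fun x => - f x).
Proof.
move=> [l fl]; split=> [x y|x s]; first by have := l y x; rewrite dsym; lra.
by have [y h1 h2] := fl x (- s); exists y; rewrite ?h1 ?normrN//; lra.
Qed.

(** Flow on from [y] by a large [t] to [v]: since [f] drops by the full length, [x], [y], [v] are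
    aligned. Stewart's inequality seen from [w], with [d w v] at least [f w - f v], gives the claim
    in the terms of highest order in [t]. *)
Lemma affine_sqr_dist_ge f x y w s : affine_function f ->
  0 <= s -> d x y = s -> f y = f x - s ->
  d w x ^+ 2 + 2 * s * (f w - f x) + s ^+ 2 <= d w y ^+ 2.
Proof.
move=> [l fl] s0 xy fy.
suff : d w x ^+ 2 + 2 * s * (f w - f x) + s ^+ 2 - d w y ^+ 2 <= 0 by lra.
apply: (@le0_of_unbounded _ _ (s * d w x ^+ 2) (d w x + 1)) => t tw.
have t0 : 0 < t by have := dist_ge0 md w x; lra.
have [v yv fv] := fl y (- t); rewrite normrN gtr0_norm// in yv.
have xv : d x v = s + t.
  by have := dtri x y v; have := l x v; rewrite xy yv; lra.
exists (s + t); first lra.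
have := stewart md sc w (ltac:(lra) : d x y + d y v = d x v).
rewrite xy yv xv => h.
have wv : f w - f x + (s + t) <= d w v by have := l w v; lra.
have fwx : 0 <= f w - f x + (s + t) by have := l x w; rewrite dsym; lra.
have : (f w - f x + (s + t)) ^+ 2 <= d w v ^+ 2.
  by rewrite ler_pXn2r ?nnegrE// dist_ge0.
have : 0 <= (f w - f x) ^+ 2 by rewrite sqr_ge0.
by nra.
Qed.

(** The reverse inequality is [affine_sqr_dist_ge] for [- f] with [x] and [y] exchanged. So the law
    of cosines is exact along the flow, with [f] in the role of the scalar product with its
    direction. *)
Lemma affine_sqr_dist f x y w s : affine_function f ->
  d x y = `|s| -> f y = f x + s ->
  d w y ^+ 2 = d w x ^+ 2 - 2 * s * (f w - f x) + s ^+ 2.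
Proof.
wlog : f s / s <= 0.
  move=> hw af xy fy; have [s0|/ltW s0] := leP s 0; first exact: hw.
  have := hw (fun x => - f x) (- s); rewrite oppr_le0 normrN => /(_ s0) h.
  by rewrite h//; [ring|exact: affine_functionN|lra].
move=> s0 af; rewrite ler0_norm// => xy fy.
have Ns0 : 0 <= - s by lra.
have := affine_sqr_dist_ge w af Ns0 xy ltac:(lra).
have := @affine_sqr_dist_ge _ y x w (- s) (affine_functionN af) Ns0.
rewrite dsym => /(_ xy) /=; rewrite fy => /(_ ltac:(lra)) h1 h2.
by nra.
Qed.

End AffineFunctions.

Section Factors.
Context {R : realType} (U : set_system nat).
Hypothesis UU : UltraFilter U.
Hypothesis Uoo : \oo `<=` U.

(** [N] is the zero level of [f], and [Phi (s, y)] is a point reached from [y] by flowing for time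
    [s]. Two uses of the exact law of cosines give Pythagoras' theorem, whichever point the choice
    picks. *)
Lemma affine_split (T : Type) (d : T -> T -> R) f :
  metric_axioms d -> semiconcave d -> affine_function d f ->
  exists (N : Type) (dN : N -> N -> R) (Phi : R * N -> T),
  [/\ metric_axioms dN,
      forall a b, d (Phi a) (Phi b) ^+ 2 = (a.1 - b.1) ^+ 2 + dN a.2 b.2 ^+ 2 &
      forall x, exists a, Phi a = x].
Proof.
move=> md sc af; have [l fl] := af.
pose N := {x : T | f x = 0}; pose dN (x y : N) := d (sval x) (sval y).
have /choice[Phi hPhi] (a : R * N) :
    exists x, d (sval a.2) x = `|a.1| /\ f x = a.1.
  have [x h1 h2] := fl (sval a.2) a.1; exists x; split => //.
  by rewrite h2 (svalP a.2) add0r.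
exists N, dN, Phi; split.
- split=> [x|x y|x y|x y z]; rewrite /dN.
  + exact: dist_refl.
  + move/(dist_eq0 md); case: x y => [x fx] [y fy]/= xy; subst y.
    by congr exist; exact: Prop_irrelevance.
  + exact: dist_sym.
  + exact: dist_tri.
- move=> [s y] [s' y']/=.
  have [h1 h2] := hPhi (s, y); have [h1' h2'] := hPhi (s', y'); rewrite /= in h1 h2 h1' h2'.
  have fy := svalP y; have fy' := svalP y'; rewrite /= in fy fy'.
  have g1 : f (Phi (s', y')) = f (sval y') + s' by rewrite h2' fy' add0r.
  have g2 : f (Phi (s, y)) = f (sval y) + s by rewrite h2 fy add0r.
  have e1 := affine_sqr_dist md sc (Phi (s, y)) af h1' g1.
  have e2 := affine_sqr_dist md sc (sval y') af h1 g2.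
  rewrite e1 (dist_sym md _ (sval y')) e2 h2 fy fy' /dN (dist_sym md (sval y')).
  by ring.
- move=> x; have [p xp fp] := fl x (- f x).
  have fp0 : f p = 0 by lra.
  exists (f x, exist _ p fp0); have [/= h1 h2] := hPhi (f x, exist _ p fp0).
  have g : f (Phi (f x, exist _ p fp0)) = f p + f x by rewrite h2 fp0 add0r.
  have := affine_sqr_dist md sc x af h1 g.
  rewrite xp fp0 real_normK ?num_real// => h; apply/esym/(dist_eq0 md)/eqP.
  by rewrite -sqrf_eq0 h; apply/eqP; ring.
Qed.

(** The slice at height 0 is isometric to [N] and the projection to [N] does not increase distances,
    so geodesics, comparison and limits are inherited. *)
Lemma ob_space_factor (T N : Type) (d : T -> T -> R) (dN : N -> N -> R)
    (Phi : R * N -> T) : ob_space U d -> metric_axioms dN ->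
  (forall a b, d (Phi a) (Phi b) ^+ 2 = (a.1 - b.1) ^+ 2 + dN a.2 b.2 ^+ 2) ->
  (forall x, exists a, Phi a = x) ->
  ob_space U dN.
Proof.
move=> [md gd sc ex uc] mN hd surj.
have dge := dist_ge0 md; have dNge := dist_ge0 mN.
pose io y := Phi (0, y).
have iod y y' : d (io y) (io y') = dN y y'.
  apply/eqP; rewrite -(@eqrXn2 _ 2)// hd/= subrr expr0n/= add0r//.
have pr s y y' : dN y y' <= d (io y) (Phi (s, y')).
  rewrite -(@ler_pXn2r _ 2) ?nnegrE// hd/=.
  by have := sqr_ge0 (0 - s); lra.
split=> //.
- move=> x y t t01; have [z] := gd (io x) (io y) t t01.
  have [[s w] <-] := surj z; rewrite iod => h1 h2.
  have p1 := pr s x w; have p2 := pr s y w.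
  rewrite dist_sym// [leRHS](dist_sym md) in p2.
  by exists w; have := dist_tri mN x w y; lra.
- move=> x y z q t t01; rewrite -!iod; exact: sc.
- move=> p q pq.
  (* An extension in the product might leave the slice. Its height [a] vanishes: the two Pythagorean
     formulas and the triangle inequality in [N] give [s <= dN q' w], while [s ^+ 2] is
     [a ^+ 2 + dN q' w ^+ 2]. *)
  have sub (p' q' : N) : p' <> q' -> extends_beyond d (io p') (io q') ->
      extends_beyond dN p' q'.
    move=> pq' h s s0; have [z] := h s s0.
    have [[a w] <-] := surj z => h1 h2.
    have e1 := hd (0, q') (a, w); have e2 := hd (0, p') (a, w).
    rewrite -!/(io _) h1 h2 /= sub0r sqrrN in e1 e2.
    rewrite iod in e2.
    have pq0 : 0 < dN p' q'.
      rewrite lt_neqAle dNge andbT; apply/eqP => /esym/(dist_eq0 mN); exact: pq'.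
    have tr := dist_tri mN p' q' w.
    have sA : s <= dN q' w.
      have : dN p' w ^+ 2 <= (dN p' q' + dN q' w) ^+ 2.
        by rewrite ler_pXn2r ?nnegrE ?addr_ge0.
      by move=> h3; rewrite -(ler_pM2l pq0); nra.
    have As := pr a q' w; rewrite h1 in As.
    have eA : dN q' w = s by lra.
    exists w => //; have a0 : a ^+ 2 = 0 by rewrite eA in e1; lra.
    rewrite a0 add0r in e2; apply/eqP; rewrite -(@eqrXn2 _ 2)// ?e2//.
    by rewrite addr_ge0.
  have iopq : io p <> io q.
    by move=> e; apply: pq; apply: (dist_eq0 mN); rewrite -iod e dist_refl.
  by have [h|h] := ex _ _ iopq; [left|right]; apply: sub => //; apply: nesym.
- move=> x o C xC; have [l hl] := uc (fun n => io (x n)) (io o) C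
    ltac:(by move=> n; rewrite iod).
  have [[s w] lw] := surj l; exists w.
  apply: (ultra_squeeze0 UU _ hl) => n.
  by rewrite dNge/= -lw pr.
Qed.

End Factors.

(** * Lines from pairs of Busemann functions *)

Section Lines.
Context {R : realType} (U : set_system nat).
Hypothesis UU : UltraFilter U.
Hypothesis Uoo : \oo `<=` U.
Context (T : Type) (d : T -> T -> R).
Hypothesis md : metric_axioms d.
Hypothesis gd : geodesic d.
Hypothesis sc : semiconcave d.
Hypothesis uc : ultracompact U d.
Let UP : ProperFilter U. Proof. exact: ultra_proper. Qed.

Let d0 := dist_refl md.
Let dsym := dist_sym md.
Let dtri := dist_tri md.

(** The points [x n] need not lie on one ray, so the differences of distances need not be monotone;
    their limit is taken along the ultrafilter. *)
Lemma busemann_exists (x : nat -> T) o : (forall n, d o (x n) = n.+1%:R) ->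
  exists f : T -> R, forall r, d (x n) r - n.+1%:R @[n --> U] --> f r.
Proof.
move=> ox; have /choice[f hf] (r : T) : exists l : R, d (x n) r - n.+1%:R @[n --> U] --> l;
  last by exists f.
apply: (ultra_bounded_cvg UU) => n; rewrite -(ox n) (dsym o).
by rewrite (dsym _ r) (dsym _ o); exact: dist_dist.
Qed.

Lemma busemann_lip (x : nat -> T) (f : T -> R) :
  (forall r, d (x n) r - n.+1%:R @[n --> U] --> f r) ->
  forall r s, f r - f s <= d r s.
Proof.
move=> hf r s; apply: (ultra_le UU (cvgB (hf r) (hf s)) (cvg_cst (d r s))) => n.
by rewrite !fctE; have := dtri (x n) s r; rewrite (dsym s r); lra.
Qed.

Lemma busemann_descent (x : nat -> T) o (f : T -> R) : (forall n, d o (x n) = n.+1%:R) ->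
  (forall r, d (x n) r - n.+1%:R @[n --> U] --> f r) ->
  forall r (s : R), 0 <= s -> exists2 y, d r y = s & f y = f r - s.
Proof.
(* For small [n] the point [x n] may be closer to [r] than [s]; the minimum keeps the choice of [u]
   total and is eventually [s]. *)
move=> ox hf r s s0; pose sn n := Num.min s (d r (x n)).
have sncvg : sn n @[n --> U] --> s.
  apply/cvgrPdist_le => e e0; apply: Uoo; near=> n.
  have -> : sn n = s.
    apply/min_idPl; have := dtri o r (x n); rewrite ox.
    have : s + d o r <= n%:R by near: n; exact: nbhs_infty_ger.
    by rewrite -natr1; lra.
  by rewrite subrr normr0 ltW.
have /choice[u hu] (n : nat) : exists u, d r u = sn n /\ d u (x n) = d r (x n) - sn n.
  have [|u h1 h2] := @point_at_dist R T d md gd r (x n) (sn n).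
    by rewrite /sn le_min s0 dist_ge0// ge_min lexx orbT.
  by exists u.
have [y uy] := @uc u r s ltac:(by move=> n; have [-> _] := hu n; rewrite ge_min lexx).
have ry : d r y = s.
  have : d (u n) r @[n --> U] --> d y r by exact: ultra_dist.
  rewrite (dsym y).
  have -> : (fun n => d (u n) r) = sn by apply/funext => n; rewrite dsym (hu n).1.
  by move=> h; exact: (ultra_unique UU h sncvg).
exists y => //; apply/eqP; rewrite eq_le; apply/andP; split; last first.
  by have := busemann_lip hf r y; rewrite ry; lra.
have c : (d (x n) r - n.+1%:R) - sn n + d (u n) y @[n --> U] --> f r - s.
  by rewrite -[X in _ --> X]addr0; apply: cvgD => //; apply: cvgB.
apply: (ultra_le UU (hf y) c) => n.
have [h1 h2] := hu n.
by have := dtri (x n) (u n) y; rewrite (dsym (x n) (u n)) h2 (dsym (x n) r); lra.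
Unshelve. all: end_near. Qed.

(** Antipodes [x n] and [y n] around [o] define two Busemann functions [f] and [g]. Stewart's
    inequality at the midpoint [o], seen from [r], bounds the excess of the path through [r] by
    [d r o ^+ 2 / n.+1%:R], so [g = - f]; descending [f] and descending [g] are the two directions
    of the flow. *)
Lemma affine_of_spheres o : extendable d ->
  (forall r, 0 < r -> nontrivial_sphere d o r) -> exists f, affine_function d f.
Proof.
move=> ex ns.
have /choice[x /choice[y xy]] (n : nat) : exists x y,
    [/\ d o x = n.+1%:R, d o y = n.+1%:R & d x y = 2 * n.+1%:R].
  by apply: (antipodal_points UU Uoo md gd sc ex uc) => //; apply: ns; rewrite ltr0n.
have ox n : d o (x n) = n.+1%:R by have [] := xy n.
have oy n : d o (y n) = n.+1%:R by have [] := xy n.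
have [f hf] := busemann_exists ox; have [g hg] := busemann_exists oy.
have fg r : g r = - f r.
  apply/eqP; rewrite -addr_eq0 addrC; apply/eqP.
  apply: (ultra_unique UU (cvgD (hf r) (hg r))).
  apply: (ultra_squeeze0 UU _ (ultra_invn Uoo (d r o ^+ 2))) => n.
  rewrite !fctE; have [_ _ h] := xy n; have := dtri (x n) r (y n).
  have N0 : (0 : R) < n.+1%:R by rewrite ltr0n.
  rewrite ler_pdivlMr// h (dsym r (y n)) => h1; apply/andP; split; first lra.
  have := stewart md sc r (ltac:(rewrite (dsym (x n)) ox oy h; lra)
     : d (x n) o + d o (y n) = d (x n) (y n)).
  rewrite (dsym (x n) o) ox oy h (dsym r (x n)) (dsym r (y n)).
  set N := n.+1%:R in N0 *; set a := d (x n) r; set b := d (y n) r => h2.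
  rewrite -(ler_pM2l N0) -(ler_pM2l (ltac:(lra) : (0 : R) < 2)).
  have := sqr_ge0 (a - N); have := sqr_ge0 (b - N) => h3 h4.
  have h5 : 0 <= N * ((a - N) ^+ 2 + (b - N) ^+ 2) by rewrite mulr_ge0 ?addr_ge0// ltW.
  by nra.
exists f; split; first exact: busemann_lip hf.
move=> r s; have [s0|/ltW s0] := leP s 0.
  have [z h1 h2] := busemann_descent ox hf r (ltac:(lra) : 0 <= - s).
  by exists z; rewrite ?ler0_norm// h2 opprK.
have [z h1 h2] := busemann_descent oy hg r s0.
by exists z; rewrite ?ger0_norm//; rewrite !fg in h2; lra.
Qed.

End Lines.

(** * Half-lines and the classification *)

Section HalfLines.
Context {R : realType} (U : set_system nat).
Hypothesis UU : UltraFilter U.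
Hypothesis Uoo : \oo `<=` U.
Context (T : Type) (d : T -> T -> R).
Hypothesis od : ob_space U d.
Let md := ob_metric od.
Let gd := ob_geodesic od.
Let sc := ob_semiconcave od.
Let ex := ob_extendable od.
Let uc := ob_ultracompact od.
Let UP : ProperFilter U. Proof. exact: ultra_proper. Qed.

Let d0 := dist_refl md.
Let dsym := dist_sym md.
Let dtri := dist_tri md.

(** Two points at radius [s] would yield antipodes; on their segments to [o] the points at radius
    [r] differ, for otherwise the antipodes would be within [2 * (s - r)]. *)
Lemma trivial_sphere_le o r s x y : 0 < r -> ~ nontrivial_sphere d o r ->
  r <= s -> d o x = s -> d o y = s -> x = y.
Proof.
move=> r0 tr rs ox oy; apply: contrapT => xy; apply: tr.
have [|a [b [oa ob ab]]] := antipodal_points UU Uoo md gd sc ex uc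
    (ltac:(lra) : 0 < s) (o := o).
  by exists x, y.
have [a' oa' aa'] := point_at_dist md gd (ltac:(lra) : 0 <= r <= d o a).
have [b' ob' bb'] := point_at_dist md gd (ltac:(lra) : 0 <= r <= d o b).
exists a', b'; split => // e; subst b'.
by have := dtri a a' b; rewrite (dsym a a'); lra.
Qed.

Lemma trivial_spheres_dist o r z z' : 0 < r -> ~ nontrivial_sphere d o r ->
  r <= d o z -> d o z <= d o z' -> d z z' = d o z' - d o z.
Proof.
move=> r0 tr rz zz'.
have [w ow wz'] := point_at_dist md gd (ltac:(lra) : 0 <= d o z <= d o z').
have zw : z = w by exact: (trivial_sphere_le r0 tr rz erefl ow).
by rewrite {1}zw.
Qed.

(** The points at distance at least [r] from [o] form a ray, and [h] inside the proof is minus its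
    Busemann function. A segment that extends beyond one end realises the Lipschitz bound of [h], so
    [h] embeds the space isometrically in the line. *)
Lemma trivial_spheres_halfline (o : T) : (exists p q : T, p <> q) ->
  (forall o, exists2 r, 0 < r & ~ nontrivial_sphere d o r) ->
  exists h : T -> R, [/\ forall x y, d x y = `|h x - h y|,
    forall x, 0 <= h x & forall t, 0 <= t -> exists x, h x = t].
Proof.
move=> [p [q pq]] trs; have [r r0 tr] := trs o.
pose phi x z := d o z - d x z.
pose E x := [set phi x z | z in [set z | r <= d o z]].
have mono x z z' : r <= d o z -> d o z <= d o z' -> phi x z <= phi x z'.
  move=> rz zz'; rewrite /phi.
  by have := trivial_spheres_dist r0 tr rz zz'; have := dtri x z z'; lra.
have beyond x y t : extends_beyond d x y ->
    exists z, [/\ r <= d o z, t <= d o z & d x z = d x y + d y z].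
  move=> xy; have [|z yz xz] := xy (d y o + `|t| + r).
    by rewrite !addr_ge0 ?dist_ge0// ltW.
  have := dtri y o z; have := dist_ge0 md y o; have := ler_norm t => h1 h2 h3.
  by have := normr_ge0 t; exists z; split; lra.
have farE t : exists2 z, r <= d o z & t <= d o z.
  by have [h|h] := @ex p q pq; have [z [? ? _]] := beyond _ _ t h; exists z.
have supE x : has_sup (E x).
  split; first by have [z rz _] := farE 0; exists (phi x z), z.
  by exists (d o x) => _ [z _ <-]; rewrite /phi; have := dtri o x z; lra.
pose h x := sup (E x).
have hE x z : r <= d o z -> phi x z <= h x.
  by move=> rz; apply: (sup_upper_bound (supE x)); exists z.
have lip x y : h y - h x <= d x y.
  rewrite lerBlDr; apply: ge_sup; first by case: (supE y).
  move=> _ [z /= rz <-]; have := hE x z rz; rewrite /phi.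
  by have := dtri x y z; lra.
have beyond_h x y : extends_beyond d x y -> h y - h x = d x y.
  move=> xy; apply/eqP; rewrite eq_le lip/= lerBrDl -lerBrDr.
  apply: ge_sup; first by case: (supE x).
  move=> _ [z /= rz <-]; have [z' [rz' zz' e]] := beyond x y (d o z) xy.
  apply: le_trans (mono x z z' rz zz') _; have := hE y z' rz'; rewrite /phi; lra.
have dh x y : d x y = `|h x - h y|.
  have [->|xy] := pselect (x = y); first by rewrite subrr normr0 d0.
  have [b|b] := @ex x y xy.
    by rewrite distrC (beyond_h _ _ b) ger0_norm// dist_ge0.
  by rewrite (beyond_h _ _ b) ger0_norm ?dist_ge0// dsym.
have ivt x y t : h x <= t <= h y -> exists z, h z = t.
  move=> t_xy; have xy : d x y = h y - h x by rewrite dh distrC ger0_norm; lra.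
  have [z xz zy] := point_at_dist md gd (ltac:(lra) : 0 <= t - h x <= d x y).
  by exists z; have := lip x z; have := lip z y; lra.
have up t x : h x <= t -> exists z, h z = t.
  move=> xt; have [z rz tz] := farE t.
  by apply: (ivt x z); have := hE z z rz; rewrite /phi d0; lra.
(* A value below this level would give points at the levels [h o - r] and [h o + r], two points on
   the trivial sphere. *)
have lb x : h o - r <= h x.
  rewrite leNgt; apply/negP => xr; apply: tr.
  have [y hy] := up (h o - r) x (ltW xr).
  have [y' hy'] := up (h o + r) x ltac:(lra).
  exists y, y'; rewrite !dh hy hy'; split.
  - move=> e; move: hy'; rewrite -e hy => hr.
    by move: r0; rewrite ltNge => /negP; apply; lra.
  - by rewrite ger0_norm; lra.
  - by rewrite ler0_norm; lra.
(* Ultracompactness makes the infimum a minimum, so the half-line is closed. *)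
pose m := inf (range h).
have infh : has_inf (range h).
  by split; [exists (h o), o | exists (h o - r) => _ [x _ <-]].
have mh x : m <= h x by apply: (ge_inf (proj2 infh)); exists x.
have /choice[x hx] (n : nat) : exists x, h x <= m + 1 / n.+1%:R.
  have n0 : (0 : R) < 1 / n.+1%:R by rewrite divr_gt0.
  have [_ [y _ <-] hy] := inf_adherent n0 infh.
  by exists y; exact: ltW.
have [|l hl] := @uc x o (1 + (h o - m)).
  move=> n; rewrite dh ler_norml; have := mh (x n); have := hx n; have := mh o.
  have : 1 / n.+1%:R <= (1 : R) by rewrite ler_pdivrMr ?ltr0n// mul1r ler1n.
  by move: (1 / _) => e h1 h2 h3 h4; apply/andP; split; lra.
have lm : h l = m.
  apply/eqP; rewrite eq_le mh andbT.
  have c : m + 1 / n.+1%:R + d (x n) l @[n --> U] --> m + 0 + 0.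
    apply: cvgD => //; apply: cvgD; [exact: cvg_cst | exact: ultra_invn].
  rewrite !addr0 in c; apply: (ultra_le UU (cvg_cst (h l)) c) => n.
  by have := lip (x n) l; have := hx n; move: (1 / _) => e; lra.
exists (fun x => h x - m); split.
- by move=> a b; rewrite dh; congr (`|_|); ring.
- by move=> a; rewrite subr_ge0.
- move=> t t0; have [z hz] := up (t + m) l ltac:(lra).
  by exists z; rewrite hz; ring.
Qed.

End HalfLines.

Section InsertCoordinate.
Context {R : realType} (k : nat) (i0 : 'I_k.+1).

Definition insert_coord (s : R) (v : 'rV[R]_k) : 'rV[R]_k.+1 :=
  \row_j oapp (v 0) s (unlift i0 j).

Definition remove_coord (v : 'rV[R]_k.+1) : 'rV[R]_k := \row_j v 0 (lift i0 j).

Lemma insert_coord_pivot s v : insert_coord s v 0 i0 = s.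
Proof. by rewrite mxE unlift_none. Qed.

Lemma insert_coord_lift s v j : insert_coord s v 0 (lift i0 j) = v 0 j.
Proof. by rewrite mxE liftK. Qed.

Lemma insert_coordK s v : remove_coord (insert_coord s v) = v.
Proof. by apply/rowP => j; rewrite mxE insert_coord_lift. Qed.

Lemma remove_coordK (v : 'rV[R]_k.+1) : insert_coord (v 0 i0) (remove_coord v) = v.
Proof.
apply/rowP => j; rewrite mxE; case: unliftP => [j' ->|->]//=.
by rewrite mxE.
Qed.

Lemma euclidean_dot_pivot (u v : 'rV[R]_k.+1) :
  euclidean_dot u v
    = u 0 i0 * v 0 i0 + euclidean_dot (remove_coord u) (remove_coord v).
Proof.
rewrite /euclidean_dot (bigD1_ord i0)//=; congr (_ + _).
by apply: eq_bigr => j _; rewrite !mxE.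
Qed.

Lemma sqr_euclidean_dist_pivot (u v : 'rV[R]_k.+1) :
  euclidean_dist u v ^+ 2 = (u 0 i0 - v 0 i0) ^+ 2
    + euclidean_dist (remove_coord u) (remove_coord v) ^+ 2.
Proof.
rewrite !sqr_euclidean_dist (bigD1_ord i0)//=; congr (_ + _).
by apply: eq_bigr => j _; rewrite !mxE.
Qed.

End InsertCoordinate.

Section Classification.
Context {R : realType} (U : set_system nat).
Hypothesis UU : UltraFilter U.
Hypothesis Uoo : \oo `<=` U.
Context (T : Type) (d : T -> T -> R).

Definition euclidean_factor k (N : Type) (dN : N -> N -> R)
    (Phi : 'rV[R]_k * N -> T) :=
  (forall a b, d (Phi a) (Phi b) ^+ 2 =
     euclidean_dist a.1 b.1 ^+ 2 + dN a.2 b.2 ^+ 2) /\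
  forall x, exists a, Phi a = x.

Hypothesis od : ob_space U d.

Lemma euclidean_factor0 : euclidean_factor d (fun a : 'rV[R]_0 * T => a.2).
Proof.
split=> [a b|x]; last by exists (0, x).
by rewrite sqr_euclidean_dist big_ord0 add0r.
Qed.

Lemma euclidean_factorS k N (dN : N -> N -> R) (Phi : 'rV[R]_k * N -> T) o :
  euclidean_factor dN Phi -> ob_space U dN ->
  (forall r, 0 < r -> nontrivial_sphere dN o r) ->
  exists N' (dN' : N' -> N' -> R) (Phi' : 'rV[R]_k.+1 * N' -> T),
    euclidean_factor dN' Phi' /\ ob_space U dN'.
Proof.
move=> [hd surj] oN ns.
have [mN gN sN eN uN] := oN.
have [f af] := affine_of_spheres UU Uoo mN gN sN uN eN ns.
have [N' [dN' [Psi [mN' hPsi sPsi]]]] := affine_split mN sN af.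
exists N', dN', (fun a => Phi (remove_coord ord0 a.1, Psi (a.1 0 ord0, a.2))).
split; last exact: (ob_space_factor UU oN mN' hPsi sPsi).
split=> [a b|x].
  by rewrite hd/= hPsi/= (sqr_euclidean_dist_pivot ord0 a.1 b.1); ring.
have [[v y] <-] := surj x; have [[s z] <-] := sPsi y.
by exists (insert_coord ord0 s v, z); rewrite /= insert_coordK insert_coord_pivot.
Qed.

(** Splitting goes on while some centre has only nontrivial spheres, and stops because at most [n]
    lines fit. The remaining factor has a trivial sphere around every centre, hence is a point or a
    half-line; the half-line becomes coordinate [ord0]. *)
Lemma ob_space_classification n :
  (forall k N (dN : N -> N -> R) (Phi : 'rV[R]_k * N -> T), ob_space U dN ->
    euclidean_factor dN Phi -> (k <= n)%N) -> inhabited T ->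
  exists k, (exists2 f : T -> 'rV[R]_k, bijective f &
               forall x y, euclidean_dist (f x) (f y) = d x y) \/
    exists f : T -> 'rV[R]_k.+1, [/\ forall x y, euclidean_dist (f x) (f y) = d x y,
      forall x, 0 <= f x 0 ord0 & forall v : 'rV[R]_k.+1, 0 <= v 0 ord0 ->
        exists x, f x = v].
Proof.
move=> hn [x0].
have [k [N [dN [Phi [fN oN tN]]]]] :
    exists k N (dN : N -> N -> R) (Phi : 'rV[R]_k * N -> T),
    [/\ euclidean_factor dN Phi, ob_space U dN &
      forall o, exists2 r, 0 < r & ~ nontrivial_sphere dN o r].
  apply: contrapT => no.
  suff all : forall k, exists N (dN : N -> N -> R) (Phi : 'rV[R]_k * N -> T),
      euclidean_factor dN Phi /\ ob_space U dN.
    have [Y [dY [Phi [h1 h2]]]] := all n.+1.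
    by have := hn _ _ _ _ h2 h1; rewrite ltnn.
  elim=> [|k [N [dN [Phi [fN oN]]]]].
    by exists T, d, (fun a => a.2); split; first exact: euclidean_factor0.
  have [p hp] : exists o, forall r, 0 < r -> nontrivial_sphere dN o r.
    apply: contrapT => no'; apply: no; exists k, N, dN, Phi; split => // o.
    apply: contrapT => no2; apply: no'; exists o => r r0.
    by apply: contrapT => no3; apply: no2; exists r.
  exact: euclidean_factorS fN oN hp.
have [hd surj] := fN; exists k.
have /choice[g hg] := surj.
have [md mN] := (ob_metric od, ob_metric oN).
have gK : cancel g Phi by [].
have dist0 (v w : 'rV[R]_k) : euclidean_dist v w ^+ 2 = 0 -> v = w.
  rewrite sqr_euclidean_dist => /eqP; rewrite psumr_eq0 => [/allP h|i _]; last exact: sqr_ge0.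
  apply/rowP => i; apply/eqP; rewrite -subr_eq0 -sqrf_eq0.
  exact: h (mem_index_enum i).
have PhiK : cancel Phi g.
  move=> a; have := hd (g (Phi a)) a; rewrite gK dist_refl// expr0n/= => /esym/eqP.
  rewrite paddr_eq0 ?sqr_ge0// => /andP[/eqP h1]; rewrite sqrf_eq0 => /eqP h2.
  move: (g _) h1 h2; case: a => v y [w z] /=.
  by move=> /dist0 -> /(dist_eq0 mN) ->.
have sqrt_dist m (v w : 'rV[R]_m) x y : euclidean_dist v w ^+ 2 = d x y ^+ 2 ->
    euclidean_dist v w = d x y.
  by move=> e; apply/eqP; rewrite -(@eqrXn2 _ 2)// ?sqrtr_ge0 ?dist_ge0// e.
have [triv|] := pselect (forall p q : N, p = q).
  left; exists (fun x => (g x).1).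
    apply: (Bijective (g := fun v => Phi (v, (g x0).2))) => [x|v]; last by rewrite PhiK.
    by rewrite (triv (g x0).2 (g x).2) -surjective_pairing gK.
  move=> x y; apply: sqrt_dist.
  by rewrite -{2}(gK x) -{2}(gK y) hd (triv (g x).2 (g y).2) dist_refl// expr0n addr0.
move=> /existsNP[p /existsNP[q pq]]; right.
have [h [dh h0 sh]] := trivial_spheres_halfline UU Uoo oN p
    (ex_intro _ p (ex_intro _ q pq)) tN.
exists (fun x => insert_coord ord0 (h (g x).2) (g x).1); split=> [x y|x|v v0].
- apply: sqrt_dist; rewrite (sqr_euclidean_dist_pivot ord0) !insert_coordK.
  rewrite !insert_coord_pivot -{3}(gK x) -{3}(gK y) hd addrC; congr (_ + _).
  by rewrite dh real_normK ?num_real.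
- by rewrite insert_coord_pivot.
- have [z hz] := sh _ v0; exists (Phi (remove_coord ord0 v, z)).
  by rewrite PhiK/= hz remove_coordK.
Qed.

End Classification.

(** * Hausdorff measure: lower and upper bounds *)

Section Diameter.
Context {R : realType} (M : metricType R).
Implicit Types (A : set M) (x y : M) (s r : R).

Lemma diameter_ge0 A : (0 <= diameter A)%E.
Proof. by apply: ereal_sup_ubound; left. Qed.

Lemma mdist_le_diameter A x y : A x -> A y -> ((mdist x y)%:E <= diameter A)%E.
Proof. by move=> Ax Ay; apply: ereal_sup_ubound; right; exists x => //; exists y. Qed.

Lemma diameter_le A r : 0 <= r -> (forall x y, A x -> A y -> mdist x y <= r) ->
  (diameter A <= r%:E)%E.
Proof.
move=> r0 h; apply: ge_ereal_sup => _ [->|[x Ax [y Ay <-]]]; rewrite lee_fin//.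
exact: h.
Qed.

Lemma diameter_lt_powR A s r : 0 < s -> 0 <= r ->
  (diameter A `^ s < (r `^ s)%:E)%E -> (diameter A < r%:E)%E.
Proof.
move=> s0 r0; apply: contraTT; rewrite -!leNgt => h; rewrite -poweR_EFin.
apply: gt0_ler_poweR => //; first exact: ltW.
- by rewrite in_itv/= lee_fin r0 leey.
- by rewrite in_itv/= diameter_ge0 leey.
Qed.

Lemma hausdorff_measure0_cover (s e : R) : hausdorff_measure s [set: M] = 0%E -> 0 < e ->
  exists2 V : (set M)^nat, forall x, exists i, V i x &
    ((\sum_(0 <= i <oo) (diameter (V i) `^ s))%E < e%:E)%E.
Proof.
move=> h0 e0; have : (hausdorff_content s 1 [set: M] < e%:E)%E.
  apply: (@le_lt_trans _ _ 0%E); last by rewrite lte_fin.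
  by rewrite -h0; apply: ereal_sup_ubound; exists 1 => //=; exact: ltr01.
move=> /ereal_inf_lt[_ [V [cov _] <-] hV]; exists V => // x.
by have [i _ Vx] := cov x I; exists i.
Qed.

End Diameter.

(** * Lower bounds from trees of separated points *)

Section SeparatedTree.
Context {R : realType} (M : metricType R).
Hypothesis complete : metric_complete M.

(* Follows, from level to level, the child whose neighborhood meets the part of
   the cover of least weight; the limit point is then covered by no set. *)
Variables (V : (set M)^nat) (w : nat -> \bar R) (s b a t tau0 : R) (K : nat) (p0 : M).
Hypothesis cover : forall x, exists i, V i x.
Hypothesis w_gt0 : forall i, (0 < w i)%E.
Hypothesis w_ge : forall i, (diameter (V i) `^ s <= w i)%E.
Hypotheses (s0 : 0 < s) (a0 : 0 < a) (b0 : 0 < b) (t0 : 0 < t) (t2 : t <= 1 / 2).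
Hypotheses (tau00 : 0 < tau0) (tau01 : tau0 <= 1) (ab : 8 * a * t <= b).
Hypothesis Kt : 1 <= K%:R * t `^ s.
Hypothesis children : forall p, mdist p0 p <= 2 * a * tau0 ->
  forall tau : R, 0 < tau <= 1 -> exists c : 'I_K -> M,
    (forall i, mdist p (c i) <= a * tau) /\
    forall i j, i != j -> b * tau <= mdist (c i) (c j).

Let meets p r i := exists2 x, V i x & mdist p x <= r.
Let weight p r : \bar R := (\sum_(0 <= i <oo) (if `[< meets p r i >] then w i else 0))%E.
Let bound tau := (b / 2 * tau) `^ s.

Let if_ge0 (P : bool) i : (0 <= if P then w i else 0)%E.
Proof. by case: P => //; exact: ltW. Qed.

Let weight_ge p r i : meets p r i -> (w i <= weight p r)%E.
Proof.
move=> m; rewrite /weight (@nneseriesD1 _ _ i)//.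
by rewrite asboolT// leeDl// nneseries_ge0// => * /=; exact: if_ge0.
Qed.

Let boundM u tau : 0 <= u -> 0 <= tau -> bound (u * tau) = u `^ s * bound tau.
Proof.
move=> u0 tau_ge0; have h : 0 <= b / 2 * tau by rewrite !mulr_ge0 ?invr_ge0// ltW.
by rewrite /bound -powRM// mulrCA.
Qed.

(** A cover set meeting the neighbourhood of [p] weighs less than [bound tau], so its diameter is
    below [b / 2 * tau]. As [8 * a * t <= b], the neighbourhoods of two children are at least that
    far apart. So the children share the weight of [p] without overlap, and by [Kt] they cannot all
    be heavy. *)
Lemma light_child p (tau : R) : mdist p0 p <= 2 * a * tau0 -> 0 < tau <= 1 ->
  (weight p (2 * a * tau)%R < (bound tau)%:E)%E ->
  exists2 c, mdist p c <= a * tau &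
    (weight c (2 * a * (t * tau))%R < (bound (t * tau)%R)%:E)%E.
Proof.
move=> pr /andP[tau_gt0 tau1] pw.
have [c [pc cc]] := children pr (introT andP (conj tau_gt0 tau1)).
apply: contrapT => no.
have cw i : ((bound (t * tau)%R)%:E <= weight (c i) (2 * a * (t * tau))%R)%E.
  by rewrite leNgt; apply/negP => h; apply: no; exists (c i).
have sub i x : mdist (c i) x <= 2 * a * (t * tau) -> mdist p x <= 2 * a * tau.
  move=> h; have := metric_triangle p (c i) x; have := pc i.
  have : a * tau * t <= a * tau * (1 / 2) by rewrite ler_pM2l// mulr_gt0.
  by lra.
have small i : meets p (2 * a * tau) i -> (diameter (V i) < (b / 2 * tau)%:E)%E.
  move=> m; apply: (@diameter_lt_powR _ _ _ s) => //.
    by rewrite !mulr_ge0 ?invr_ge0// ltW.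
  by rewrite (le_lt_trans (w_ge i))// (le_lt_trans (weight_ge m)).
have tot : (\sum_(k < K) weight (c k) (2 * a * (t * tau))%R
    <= weight p (2 * a * tau)%R)%E.
  rewrite -nneseries_sum//.
  apply: lee_nneseries => [i _ _|i _]; first by apply: sume_ge0 => k _; exact: if_ge0.
  have [[k mk]|nok] := pselect (exists k, meets (c k) (2 * a * (t * tau)) i).
    have mp : meets p (2 * a * tau) i by have [x Vx xc] := mk; exists x => //; exact: sub xc.
    rewrite (bigD1 k)//= (asboolT mk) (asboolT mp) big1 ?adde0// => l lk.
    rewrite asboolF// => -[y Vy yc]; have [x Vx xc] := mk.
    have := small i mp; rewrite ltNge => /negP; apply.
    apply: le_trans (mdist_le_diameter Vx Vy); rewrite lee_fin.
    have := cc _ _ lk; have := metric_triangle (c l) y (c k).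
    have := metric_triangle y x (c k); rewrite (metric_sym y x) (metric_sym x (c k)).
    have : 8 * a * t * tau <= b * tau by rewrite ler_pM2r.
    by lra.
  rewrite big1 ?if_ge0// => k _; rewrite asboolF// => mk; apply: nok; exists k.
  exact: mk.
have : (\sum_(k < K) (bound (t * tau)%R)%:E <= \sum_(k < K) weight (c k) (2 * a * (t * tau))%R)%E.
  by apply: lee_sum => k _; exact: cw.
move=> /le_trans/(_ tot)/le_lt_trans/(_ pw).
rewrite sumEFin lte_fin sumr_const card_ord boundM ?ltW//.
rewrite -mulr_natl mulrA ltNge => /negP; apply.
by rewrite ler_peMl// powR_ge0.
Qed.

Lemma heavy_root : ((bound tau0)%:E <= weight p0 (2 * a * tau0)%R)%E.
Proof.
rewrite leNgt; apply/negP => h0.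
pose tau j := t ^+ j * tau0.
have tau_gt0 j : 0 < tau j by rewrite mulr_gt0 ?exprn_gt0.
have t1 : t <= 1 by apply: le_trans t2 _; rewrite ler_pdivrMr// mul1r ler1n.
have tau_le j : tau j <= tau0 by rewrite ger_pMl// exprn_ile1// ltW.
have tauS j : tau j.+1 = t * tau j by rewrite /tau exprS mulrA.
(* A branch moves by at most [a * tau j] at level [j]; since [t <= 1 / 2], this is at most
   [2 * a * (tau j - tau j.+1)] and the steps telescope. *)
pose inv p j := mdist p0 p <= 2 * a * (tau0 - tau j) /\
  (weight p (2 * a * tau j)%R < (bound (tau j))%:E)%E.
have inv_near p j : inv p j -> mdist p0 p <= 2 * a * tau0.
  move=> [h _]; apply: le_trans h _; rewrite ler_pM2l ?mulr_gt0//.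
  by have := tau_gt0 j; lra.
have step p j : exists c, inv p j -> mdist p c <= a * tau j /\ inv c j.+1.
  have [ip|] := pselect (inv p j); last by exists p.
  have [|c pc cw] := @light_child p (tau j) (inv_near _ _ ip) _ (proj2 ip).
    by rewrite tau_gt0 (le_trans (tau_le j)).
  exists c => _; split => //; split; last by rewrite tauS.
  apply: le_trans (metric_triangle p0 p c) _; rewrite tauS.
  have : a * tau j * t <= a * tau j * (1 / 2) by rewrite ler_pM2l// mulr_gt0.
  by have [h _] := ip; lra.
have /choice[F hF] (pj : M * nat) : exists c, inv pj.1 pj.2 ->
    mdist pj.1 c <= a * tau pj.2 /\ inv c pj.2.+1 by exact: step.
pose p := fix p j := if j is j'.+1 then F (p j', j') else p0.
have invp j : inv (p j) j.
  elim: j => [|j ih /=]; last by have /= [//|] := hF (p j, j).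
  by split; rewrite ?mdistxx /tau ?expr0 ?mul1r ?subrr ?mulr0.
have stepp j : mdist (p j) (p j.+1) <= a * tau j by have /= [//|] := hF (p j, j).
have far j m : mdist (p j) (p (j + m)%N) <= 2 * a * (tau j - tau (j + m)%N).
  elim: m => [|m ih]; first by rewrite addn0 mdistxx subrr mulr0.
  apply: le_trans (metric_triangle _ (p (j + m)%N) _) _; rewrite addnS tauS.
  have := stepp (j + m)%N; set u := tau (j + m)%N in ih *.
  have : a * u * t <= a * u * (1 / 2) by rewrite ler_pM2l// mulr_gt0//; exact: tau_gt0.
  by lra.
have close j m : (j <= m)%N -> mdist (p j) (p m) <= 2 * a * tau j.
  move=> jm; have := far j (m - j)%N; rewrite subnKC// => h.
  apply: le_trans h _; rewrite ler_pM2l ?mulr_gt0//.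
  by have := tau_gt0 m; lra.
have geo (u : R) : 0 <= u < 1 -> forall e C : R, 0 < e -> exists j, C * u ^+ j < e.
  move=> /andP[u0 u1] e C e0.
  have u1n : `|u| < 1 by rewrite ger0_norm.
  have /cvgr_lt/(_ e e0) [N _ hN] := cvg_geometric C u1n.
  by exists N; have := hN N (leqnn N).
have t1' : t < 1 by move: t2; lra.
have tauz e : 0 < e -> exists j, 2 * a * tau j < e.
  move=> e0; have t01 : 0 <= t < 1 by rewrite (ltW t0).
  have [j hj] := geo t t01 e (2 * a * tau0) e0.
  by exists j; rewrite /tau mulrCA mulrC.
have [x hx] : exists x : M, p @ \oo --> x.
  apply: complete; apply/cauchy_ballP => e e0.
  have [j hj] := tauz (e / 2) ltac:(by rewrite divr_gt0).
  have tail : \forall n \near \oo, mdist (p j) (p n) < e / 2.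
    by exists j => // n /= jn; apply: le_lt_trans (close _ _ jn) hj.
  exists ([set y | mdist (p j) y < e / 2], [set y | mdist (p j) y < e / 2]) => //.
  move=> [y z] [/= hy hz]; rewrite ballEmdist/=.
  by have := metric_triangle y (p j) z; rewrite (metric_sym y (p j)); move: hy hz; lra.
have px j : mdist (p j) x <= 2 * a * tau j.
  apply/ler_addgt0Pr => e e0.
  have [N _ hN] := metricType_numDomainType.cvgr_dist_lt hx e0.
  have := hN (maxn N j) (leq_maxl _ _); have := close j (maxn N j) (leq_maxr _ _).
  have := metric_triangle (p j) (p (maxn N j)) x.
  by rewrite /= (metric_sym x); lra.
(* A set containing [x] meets every neighbourhood on the branch, so its positive weight lies below
   every [bound (tau j)], and these tend to 0. *)
have [i Vix] := cover x.
have wi j : (w i < (bound (tau j))%:E)%E.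
  by apply: le_lt_trans (proj2 (invp j)); apply: weight_ge; exists x.
have wfin : w i \is a fin_num.
  by rewrite ge0_fin_numE ?ltW//; apply: lt_trans (wi 0%N) _; rewrite ltry.
have fw0 : 0 < fine (w i) by rewrite fine_gt0// w_gt0/= (lt_trans (wi 0%N)) ?ltry.
have ts1 : 0 <= t `^ s < 1.
  rewrite powR_ge0/=; have := @gt0_ltr_powR R s s0 t 1.
  by rewrite powR1 !nnegrE (ltW t0) ler01; apply.
have [j hj] := geo (t `^ s) ts1 _ (bound tau0) fw0.
have e : bound (tau j) = bound tau0 * (t `^ s) ^+ j.
  rewrite /tau boundM ?exprn_ge0 ?ltW// mulrC; congr (_ * _).
  by rewrite -powR_mulrn ?ltW// -powRrM mulrC powRrM powR_mulrn ?powR_ge0.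
by have := wi j; rewrite -(fineK wfin) lte_fin e => /(lt_trans hj); rewrite ltxx.
Qed.

End SeparatedTree.

Section HausdorffLowerBounds.
Context {R : realType} (M : metricType R).
Hypothesis complete : metric_complete M.

Lemma hausdorff_measure_tree (s b a t tau0 : R) (K : nat) (p0 : M) :
  0 < s -> 0 < a -> 0 < b -> 0 < t -> t <= 1 / 2 -> 0 < tau0 -> tau0 <= 1 ->
  8 * a * t <= b -> 1 <= K%:R * t `^ s ->
  (forall p, mdist p0 p <= 2 * a * tau0 ->
    forall tau : R, 0 < tau <= 1 -> exists c : 'I_K -> M,
    (forall i, mdist p (c i) <= a * tau) /\
    forall i j, i != j -> b * tau <= mdist (c i) (c j)) ->
  hausdorff_measure s [set: M] <> 0%E.
Proof.
move=> s0 a0 b0 t0 t2 tau00 tau01 ab Kt ch H0.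
pose X := (b / 2 * tau0) `^ s.
have X0 : 0 < X by rewrite powR_gt0 ?mulr_gt0 ?invr_gt0.
have X2 : 0 < X / 2 by rewrite divr_gt0.
have [V cov hV] := hausdorff_measure0_cover H0 X2.
(* The geometric slack makes every weight positive, even at diameter 0, and costs at most [X / 2] in
   total. *)
pose w i : \bar R := (diameter (V i) `^ s + ((X / 2) / (2 ^ i.+1)%:R)%:E)%E.
have d0 i : (0 <= diameter (V i) `^ s)%E by exact: poweR_ge0.
have e0 i : 0 < X / 2 / (2 ^ i.+1)%:R by rewrite divr_gt0// ltr0n expn_gt0.
have w0 i : (0 < w i)%E.
  by apply: (@lt_le_trans _ _ (X / 2 / (2 ^ i.+1)%:R)%:E); rewrite ?lte_fin// leeDr.
have wge i : (diameter (V i) `^ s <= w i)%E by rewrite leeDl// lee_fin ltW.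
have := heavy_root complete cov w0 wge s0 a0 b0 t0 t2 tau00 tau01 ab Kt ch.
rewrite leNgt => /negP; apply.
have le1 : (\sum_(0 <= i <oo) w i <= \sum_(0 <= i <oo) diameter (V i) `^ s + (X / 2)%:E)%E.
  by apply: epsilon_trick => //; exact: ltW.
apply: (@le_lt_trans _ _ (\sum_(0 <= i <oo) w i)%E).
  by apply: lee_nneseries => [i _ _|i _]; case: ifP => // _; exact: ltW.
apply: le_lt_trans le1 _.
have -> : ((b / 2 * tau0) `^ s)%:E = ((X / 2)%:E + (X / 2)%:E)%E by rewrite -EFinD -splitr.
by rewrite lteD2rE.
Qed.

(** With arbitrarily many children at fixed relative separation, [t] is fixed first and the number
    of children is taken above [t] to the power [- s] afterwards, so no exponent is large enough for
    measure 0. *)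
Lemma hausdorff_measure_crowded (s b a r : R) (p0 : M) :
  0 < s -> 0 < a -> 0 < b -> 0 < r ->
  (forall K p, mdist p0 p <= r -> forall tau : R, 0 < tau <= 1 ->
    exists c : 'I_K -> M, (forall i, mdist p (c i) <= a * tau) /\
    forall i j, i != j -> b * tau <= mdist (c i) (c j)) ->
  hausdorff_measure s [set: M] <> 0%E.
Proof.
move=> s0 a0 b0 r0 ch.
pose t := Num.min (1 / 2) (b / (8 * a)); pose tau0 := Num.min 1 (r / (2 * a)).
have t0 : 0 < t by rewrite lt_min !divr_gt0 ?mulr_gt0.
have tau00 : 0 < tau0 by rewrite lt_min ltr01 divr_gt0 ?mulr_gt0.
have ts0 : 0 < t `^ s by rewrite powR_gt0.
apply: (@hausdorff_measure_tree s b a t tau0 (Num.bound (t `^ s)^-1) p0) => //.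
- by rewrite ge_min lexx.
- by rewrite ge_min lexx.
- by rewrite mulrC -ler_pdivlMr ?mulr_gt0// ge_min lexx orbT.
- rewrite -ler_pdivrMr// div1r ltW//; have := @archi_boundP R (t `^ s)^-1.
  by rewrite invr_ge0 powR_ge0; exact.
- move=> p pr; apply: ch; apply: le_trans pr _.
  by rewrite mulrC -ler_pdivlMr ?mulr_gt0// ge_min lexx orbT.
Qed.

(** The children of [p] are a grid of mesh [tau] with [m] points along each axis. Orthants are used
    instead of balls because a half space contains no full ball around a boundary point. *)
Lemma hausdorff_measure_orthants (k : nat) (s : R) (p0 : M) : 0 < s < k%:R ->
  (forall p : M, exists phi : 'rV[R]_k -> M, phi 0 = p /\
    forall v w : 'rV[R]_k, (forall i, 0 <= v 0 i) -> (forall i, 0 <= w 0 i) ->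
      mdist (phi v) (phi w) = euclidean_dist v w) ->
  hausdorff_measure s [set: M] <> 0%E.
Proof.
move=> /andP[s0 sk] hphi.
have k0 : 0 < k%:R :> R by exact: lt_trans sk.
have k1 : 1 <= k%:R :> R by rewrite ler1n -(ltr0n R).
have ks : 0 < k%:R - s by rewrite subr_gt0.
(* With [a = k * m], [b = 1] and [t = 1 / (8 * a)], the [m ^ k] children suffice once [m] to the
   power [k - s] is at least [8 * k] to the power [s]. *)
pose m := Num.bound (((8 * k%:R) `^ s) `^ (k%:R - s)^-1).
have mB : ((8 * k%:R) `^ s) `^ (k%:R - s)^-1 < m%:R.
  by have := @archi_boundP R (((8 * k%:R) `^ s) `^ (k%:R - s)^-1); apply; rewrite powR_ge0.
have m0 : 0 < m%:R :> R by apply: le_lt_trans mB; rewrite powR_ge0.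
have m1 : 1 <= m%:R :> R by rewrite ler1n -(ltr0n R).
pose a : R := k%:R * m%:R.
have a1 : 1 <= a by rewrite /a -[leLHS]mulr1 ler_pM.
have a0 : 0 < a by lra.
pose t : R := (8 * a)^-1.
have t0 : 0 < t by rewrite invr_gt0 mulr_gt0.
apply: (@hausdorff_measure_tree s 1 a t 1 #|{ffun 'I_k -> 'I_m}| p0) => //.
- by rewrite /t div1r lef_pV2 ?posrE ?mulr_gt0//; lra.
- by rewrite /t divff ?lexx// gt_eqF// mulr_gt0.
- rewrite card_ffun !card_ord natrX -powR_mulrn; last exact: ltW.
  have tV : t `^ s * (8 * a) `^ s = 1.
    by rewrite -powRM ?ltW ?mulr_gt0// /t mulVf ?powR1// gt_eqF// mulr_gt0.
  have a8 : 0 < (8 * a) `^ s by rewrite powR_gt0// mulr_gt0.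
  rewrite -(ler_pM2r a8) mul1r -mulrA tV mulr1.
  rewrite /a mulrA powRM ?mulr_ge0//.
  have -> : m%:R `^ k%:R = m%:R `^ (k%:R - s) * m%:R `^ s.
    by rewrite -powRD ?subrK// gt_eqF ?implybT.
  rewrite ler_pM2r ?powR_gt0//.
  have -> : (8 * k%:R) `^ s = (((8 * k%:R) `^ s) `^ (k%:R - s)^-1) `^ (k%:R - s).
    by rewrite -[RHS]powRrM mulVf ?powRr1 ?powR_ge0// gt_eqF.
  apply: ge0_ler_powR; rewrite ?nnegrE ?powR_ge0//; exact: ltW.
- move=> p _ tau /andP[tau0 _]; have [phi [<- hd]] := hphi p.
  have sq_le (x y : R) : 0 <= x -> 0 <= y -> x ^+ 2 <= y ^+ 2 -> x <= y.
    by move=> x0 y0; rewrite ler_pXn2r.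
  pose v (f : {ffun 'I_k -> 'I_m}) : 'rV[R]_k := \row_i (tau * (f i)%:R).
  have v0 f i : 0 <= v f 0 i by rewrite mxE mulr_ge0// ltW.
  exists (fun i => phi (v (enum_val i))); split=> [i|i j ij].
    rewrite hd// => [|j]; last by rewrite mxE.
    apply: sq_le; [exact: sqrtr_ge0|by rewrite mulr_ge0// ltW|].
    rewrite sqr_euclidean_dist.
    apply: (@le_trans _ _ (\sum_(j < k) (m%:R * tau) ^+ 2)).
      apply: ler_sum => j _; rewrite !mxE sub0r sqrrN ler_pXn2r ?nnegrE ?mulr_ge0 ?(ltW tau0)//.
      by rewrite mulrC ler_pM2r// ler_nat ltnW.
    rewrite sumr_const card_ord -[leLHS]mulr_natl /a -mulrA [in leRHS]exprMn.
    by rewrite ler_pM2r ?exprn_gt0 ?mulr_gt0// expr2 ler_pMr.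
  rewrite hd// mul1r; apply: sq_le; [exact: ltW|exact: sqrtr_ge0|].
  rewrite sqr_euclidean_dist.
  have [l hl] : exists l, enum_val i l != enum_val j l.
    apply/existsP; rewrite -negb_forall; apply: contra ij => /forallP h.
    by apply/eqP/enum_val_inj/ffunP => l; apply/eqP.
  rewrite (bigD1 l)//= !mxE -mulrBr exprMn -[leLHS]addr0 lerD//; last first.
    by apply: sumr_ge0 => ? _; rewrite sqr_ge0.
  rewrite ler_peMr ?sqr_ge0// -[leRHS]real_normK ?num_real// exprn_ege1//.
  apply: norm_intr_ge1; first by rewrite rpredB ?rpred_nat.
  by rewrite subr_eq0 eqr_nat.
Qed.

End HausdorffLowerBounds.

(** * Upper bound from covers by cubes *)

Section HausdorffUpperBound.
Context {R : realType}.

Lemma nneseries_pair (g : nat * nat -> \bar R) (f : nat -> nat * nat) :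
  (forall p, (0 <= g p)%E) -> set_bij setT setT f ->
  (\sum_(0 <= n <oo) g (f n) = \sum_(0 <= i <oo) \sum_(0 <= j <oo) g (i, j))%E.
Proof.
move=> g0 bf; rewrite nneseries_esumT// -(reindex_esum setT setT f g bf).
rewrite nneseries_esumT; last by move=> i; exact: nneseries_ge0.
transitivity (\esum_(i in [set: nat]) \esum_(j in [set: nat]) g (i, j))%E.
  rewrite esum_esum//; congr esum; first by apply/seteqP; split.
  by apply/funext => -[].
by apply: eq_esum => i _; rewrite nneseries_esumT.
Qed.

Lemma powR_small (C k s e : R) : 0 <= C -> k < s -> 0 < e ->
  exists2 m : nat, (0 < m)%N & forall m' : nat, (m <= m')%N ->
    m'%:R `^ k * (C / m'%:R) `^ s <= e.
Proof.
move=> C0 ks e0; have sk : 0 < s - k by rewrite subr_gt0.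
pose B := (C `^ s / e) `^ (s - k)^-1.
have B0 : 0 <= B by exact: powR_ge0.
exists (Num.bound B) => [|m hm].
  by rewrite -(ltr0n R); apply: (le_lt_trans B0); exact: archi_boundP.
have mB : B <= m%:R by apply: le_trans (ltW (archi_boundP B0)) _; rewrite ler_nat.
have m0 : 0 < m%:R :> R.
  apply: (@lt_le_trans _ _ (Num.bound B)%:R); last by rewrite ler_nat.
  by apply: (le_lt_trans B0); exact: archi_boundP.
have ms0 : 0 < m%:R `^ (s - k) by rewrite powR_gt0.
have Cm : (C / m%:R) `^ s * m%:R `^ s = C `^ s.
  by rewrite -powRM ?divr_ge0 ?divfK ?gt_eqF// ltW.
have mm : m%:R `^ (s - k) * m%:R `^ k = m%:R `^ s.
  by rewrite -powRD ?subrK// (gt_eqF m0) implybT.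
rewrite -(ler_pM2r ms0).
have -> : m%:R `^ k * (C / m%:R) `^ s * m%:R `^ (s - k) = C `^ s.
  by rewrite -Cm -mm; ring.
rewrite mulrC -ler_pdivrMr//.
have -> : C `^ s / e = B `^ (s - k).
  by rewrite -[RHS]powRrM mulVf ?gt_eqF// powRr1// divr_ge0 ?powR_ge0 ?ltW.
by apply: ge0_ler_powR; rewrite ?nnegrE// ltW.
Qed.

(** The cubes with edges [[- L j, L j]] exhaust the space; cutting each edge into [m j] pieces, with
    [m j] large, makes the contribution of level [j] at most the [j]-th term of a geometric series
    of sum [e]. *)
Lemma hausdorff_measure_euclidean (M : metricType R) (k : nat) (F : M -> 'rV[R]_k) (s : R) :
  (forall x y, euclidean_dist (F x) (F y) = mdist x y) -> 0 < s -> k%:R < s ->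
  hausdorff_measure s [set: M] = 0%E.
Proof.
move=> hF s0 ks; apply/eqP; rewrite eq_le; apply/andP; split; last first.
  apply: (@le_trans _ _ (hausdorff_content s 1 [set: M])); last first.
    by apply: ereal_sup_ubound; exists 1 => //=; exact: ltr01.
  apply: le_ereal_inf_tmp => _ [V _ <-]; apply: nneseries_ge0 => i _ _; exact: poweR_ge0.
apply: ge_ereal_sup => _ [dl /= dl0 <-].
apply/lee_addgt0Pr => e e0; rewrite add0e.
pose L (j : nat) : R := j.+1%:R.
have L0 j : 0 < L j by rewrite ltr0n.
(* [C j / m j] bounds the diameter of a small cube, with the crude factor [k] in place of its square
   root. *)
pose C j : R := k%:R * (2 * L j).
have C0 j : 0 <= C j by rewrite !mulr_ge0// ltW.
have e0j j : 0 < e / (2 ^ j.+1)%:R by rewrite divr_gt0// ltr0n expn_gt0.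
have /choice[m hm] (j : nat) : exists m : nat, [/\ (0 < m)%N, C j / m%:R <= dl &
    m%:R ^+ k * (C j / m%:R) `^ s <= e / (2 ^ j.+1)%:R].
  have [m1 m10 hm1] := powR_small (C0 j) ks (e0j j).
  have hb : 0 <= C j / dl by rewrite divr_ge0// ltW.
  pose m2 := maxn m1 (Num.bound (C j / dl)).
  have m20 : (0 < m2)%N by rewrite (leq_trans m10)// leq_maxl.
  exists m2; split => //; last by rewrite -powR_mulrn// hm1// leq_maxl.
  rewrite ler_pdivrMr ?ltr0n// mulrC -ler_pdivrMr//.
  by apply: le_trans (ltW (archi_boundP hb)) _; rewrite ler_nat leq_maxr.
have m0 j : 0 < (m j)%:R :> R by rewrite ltr0n; have [] := hm j.
pose cube j (f : {ffun 'I_k -> 'I_(m j)}) : set M := [set x | forall c,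
  (f c)%:R <= (F x 0 c + L j) * (m j)%:R / (2 * L j) <= (f c)%:R + 1].
have cube_diam j f : (diameter (cube j f) <= (C j / (m j)%:R)%:E)%E.
  apply: diameter_le; first by rewrite divr_ge0// ltW.
  move=> x y hx hy; rewrite -hF.
  have q0 : 0 <= 2 * L j / (m j)%:R by rewrite divr_ge0 ?mulr_ge0// ltW.
  have k0 : 0 <= k%:R * (2 * L j / (m j)%:R) by rewrite mulr_ge0.
  rewrite /C -mulrA -(@ler_pXn2r _ 2) ?nnegrE ?sqrtr_ge0//.
  rewrite sqr_euclidean_dist.
  apply: (@le_trans _ _ (\sum_(c < k) (2 * L j / (m j)%:R) ^+ 2)).
    apply: ler_sum => c _; rewrite -[leLHS]real_normK ?num_real//.
    rewrite ler_pXn2r ?nnegrE//.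
    have := hx c; have := hy c; set r := (m j)%:R / (2 * L j).
    have r0 : 0 < r by rewrite divr_gt0// mulr_gt0.
    have -> : 2 * L j / (m j)%:R = r^-1 by rewrite /r invf_div.
    rewrite -!mulrA -/r => hyc hxc; rewrite -[leRHS]mul1r ler_pdivlMr//.
    rewrite -[X in _ * X](gtr0_norm r0) -normrM ler_norml; lra.
  rewrite sumr_const card_ord -[leLHS]mulr_natl [in leRHS]exprMn ler_wpM2r ?sqr_ge0//.
  case: (k) => [|k']; first by rewrite expr0n.
  by rewrite expr2 ler_peMr// ler1n.
have card_f j : #|{ffun 'I_k -> 'I_(m j)}| = (m j ^ k)%N by rewrite card_ffun !card_ord.
(* Level [j] has [m j ^ k] cubes; later indices get the empty set, of diameter 0, whose term
   vanishes because [s] is positive. *)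
pose V (p : nat * nat) : set M :=
  if insub p.2 is Some i then cube p.1 (enum_val (i : 'I_#|{ffun 'I_k -> 'I_(m p.1)}|))
  else set0.
have set0_diam : diameter (set0 : set M) = 0%E.
  apply/eqP; rewrite eq_le diameter_ge0 andbT.
  by apply: diameter_le => // x y.
have V_diam p : (diameter (V p) <= (C p.1 / (m p.1)%:R)%:E)%E.
  rewrite /V; case: insub => [i|]; first exact: cube_diam.
  by rewrite set0_diam lee_fin divr_ge0// ltW.
have V_sum j : (\sum_(0 <= i <oo) diameter (V (j, i)) `^ s <= (e / (2 ^ j.+1)%:R)%:E)%E.
  have [_ _ hmj] := hm j.
  rewrite (@nneseries_split _ _ 0 (m j ^ k)%N); last by move=> *; exact: poweR_ge0.
  rewrite add0n eseries0 ?adde0; last first.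
    move=> i ni _; rewrite /V insubF ?set0_diam ?poweR0e ?gt_eqF//=.
    by rewrite powR0 ?gt_eqF.
    by rewrite card_f ltnNge ni.
  apply: (@le_trans _ _ (\sum_(0 <= i < (m j ^ k)%N) ((C j / (m j)%:R) `^ s)%:E)%E).
    apply: lee_sum => i _; rewrite -poweR_EFin; apply: gt0_ler_poweR; rewrite ?V_diam//.
    - exact: ltW.
    - by rewrite in_itv/= diameter_ge0 leey.
    - by rewrite in_itv/= lee_fin divr_ge0 ?leey// ltW.
  rewrite big_mkord sumEFin lee_fin sumr_const card_ord -[leLHS]mulr_natl natrX.
  exact: hmj.
have /card_esym/ppcard_eqP[f] := card_nat2.
have bf : set_bij setT setT f by exact: bij.
have gV0 p : (0 <= diameter (V p) `^ s)%E by exact: poweR_ge0.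
apply: (@le_trans _ _ (\sum_(0 <= i <oo) diameter (V (f i)) `^ s)%E).
  apply: ereal_inf_lbound; exists (fun i => V (f i)) => //; split; last first.
    move=> i; apply: le_trans (V_diam _) _; rewrite lee_fin.
    by have [] := hm (f i).1.
  move=> x _.
  pose j := Num.bound (\sum_(c < k) `|F x 0 c|).
  have Fx c : `|F x 0 c| < L j.
    apply: (@le_lt_trans _ _ (\sum_(c < k) `|F x 0 c|)).
      by rewrite (bigD1 c)//= lerDl sumr_ge0.
    apply: lt_le_trans (archi_boundP _) _; first exact: sumr_ge0.
    by rewrite ler_nat.
  have yc c : 0 <= (F x 0 c + L j) * (m j)%:R / (2 * L j) < (m j)%:R.
    have := Fx c; rewrite ltr_norml => /andP[h1 h2].
    rewrite divr_ge0 ?mulr_ge0 ?(ltW (m0 j)) ?(ltW (L0 j))//=; last lra.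
    by rewrite ltr_pdivrMr ?mulr_gt0// mulrC ltr_pM2l//; lra.
  have tr (c : 'I_k) : (Num.trunc ((F x ord0 c + L j)%R * (m j)%:R / (2 * L j))%R < m j)%N.
    have /andP[h1 h2] := yc c; rewrite -(ltr_nat R).
    by apply: le_lt_trans h2; have /andP[] := truncn_itv h1.
  pose fx : {ffun 'I_k -> 'I_(m j)} := [ffun c => Ordinal (tr c)].
  have cx : cube j fx x.
    move=> c; rewrite ffunE/=; have /andP[h1 _] := yc c.
    by have /andP[h3 h4] := truncn_itv h1; rewrite h3/= natr1 ltW.
  have [_ _ bs] := bf; have [i _ hi] := bs (j, val (enum_rank fx)) I.
  exists i => //; rewrite hi /V/= valK enum_rankK; exact: cx.
rewrite (nneseries_pair gV0 bf).
apply: le_trans (lee_nneseries _ (fun j _ => V_sum j)) _.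
  by move=> i _ _; exact: nneseries_ge0.
by apply: epsilon_trick0; exact: ltW.
Qed.

End HausdorffUpperBound.

(** * Local comparison and local compactness *)

Section AngleSums.
Context {R : realType}.

Lemma le_cos (x y : R) : 0 <= x <= pi -> 0 <= y <= pi -> (cos x <= cos y) = (y <= x).
Proof. by move=> x0 y0; rewrite leNgt ltr_cos ?in_itv// -leNgt. Qed.

Lemma cos_piB (x : R) : cos (pi - x) = - cos x.
Proof. by rewrite cosB cospi sinpi mul0r addr0 mulN1r. Qed.

Lemma sin_piB (x : R) : sin (pi - x) = sin x.
Proof. by rewrite sinB cospi sinpi mul0r sub0r mulN1r opprK. Qed.

(** For [a] near -1 the first angle is nearly [pi], so the other two sum to little more than [pi].
    What matters is that the explicit error on the left tends to 0 with [1 + a]. *)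
Lemma cos_sum_ge (a b c : R) : -1 <= a <= 1 -> -1 <= b <= 1 -> -1 <= c <= 1 ->
  acos a + acos b + acos c <= 2 * pi ->
  - (1 + a) - Num.sqrt (1 - a ^+ 2) <= b + c.
Proof.
move=> a1 b1 c1 h; set e := pi - acos a.
have ce : cos e = - a by rewrite /e cos_piB acosK// in_itv.
have se : sin e = Num.sqrt (1 - a ^+ 2) by rewrite /e sin_piB sin_acos.
have e0 : 0 <= e by rewrite subr_ge0 acos_lepi.
have s0 : 0 <= sin e by rewrite se sqrtr_ge0.
have [be|eb] := leP (acos b) e.
  have : cos e <= b.
    rewrite -[leRHS](@acosK R) ?in_itv//.
    by rewrite le_cos ?acos_ge0 ?acos_lepi// e0 /e lerBlDr lerDl acos_ge0.
  by rewrite -se; move: c1 ce s0 => /andP[]; lra.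
have cb : - cos (acos b - e) <= c.
  rewrite -cos_piB -[leRHS](@acosK R) ?in_itv//.
  have h1 : acos c <= pi - (acos b - e) by rewrite /e; lra.
  rewrite le_cos ?acos_ge0 ?acos_lepi//.
  by have := acos_lepi b1; have := acos_ge0 b1; rewrite (le_trans _ h1) ?acos_ge0//=; lra.
move: cb; rewrite cosB acosK ?in_itv// ce se.
have : sin (acos b) <= 1 by exact: sin_le1.
move=> sb cb.
have h2 : sin (acos b) * Num.sqrt (1 - a ^+ 2) <= Num.sqrt (1 - a ^+ 2).
  by rewrite ler_piMl// sqrtr_ge0.
have : 0 <= (b + 1) * (1 + a) by rewrite mulr_ge0//; move: b1 a1 => /andP[? _] /andP[]; lra.
by lra.
Qed.

End AngleSums.

Section Quadruples.
Context {R : realType} (M : metricType R).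

Definition triangle_cos (p x q : M) : R :=
  (mdist x p ^+ 2 + mdist p q ^+ 2 - mdist x q ^+ 2) / (2 * (mdist x p * mdist p q)).

Lemma triangle_cos_bound p x q : p != x -> p != q -> -1 <= triangle_cos p x q <= 1.
Proof.
rewrite -!mdist_gt0 (metric_sym p x) => px pq; rewrite /triangle_cos.
have P0 : 0 < 2 * (mdist x p * mdist p q) by rewrite !mulr_gt0.
rewrite ler_pdivlMr// ler_pdivrMr//.
have := metric_triangle x p q; have := metric_triangle p x q.
have := metric_triangle x q p; rewrite (metric_sym p x) (metric_sym q p).
have := mdist_ge0 x q; move: (mdist x p) (mdist p q) (mdist x q) px pq.
move=> a b c a0 b0 c0 h1 h2 h3; apply/andP; split.
  have : c * c <= (a + b) * (a + b) by rewrite ler_pM.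
  by lra.
have : (a - b) * (a - b) <= c * c.
  rewrite -!expr2 -(real_normK (num_real (a - b))) ler_pXn2r ?nnegrE//.
  by rewrite ler_norml; lra.
by lra.
Qed.

Definition quadruple_condition (A : set M) :=
  forall a b c d : M, A a -> A b -> A c -> A d -> uniq [:: a; b; c; d] ->
    comparison_angle b a c + comparison_angle c a d + comparison_angle d a b
      <= 2 * pi.

(* The triangle x y of side al + be is allowed to be only asymptotically degenerate
   at z, since exact geodesics are not available before local compactness is. *)
Lemma quadruple_limit (F : set_system nat) (FF : ProperFilter F)
    (A : set M) (x y z q : nat -> M) (al be ga xi et : R) :
  quadruple_condition A ->
  (forall i, [/\ A (x i), A (y i), A (z i) & A (q i)]) ->
  mdist (x i) (z i) @[i --> F] --> al -> mdist (z i) (y i) @[i --> F] --> be ->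
  mdist (q i) (z i) @[i --> F] --> ga -> mdist (x i) (y i) @[i --> F] --> al + be ->
  mdist (q i) (x i) @[i --> F] --> xi -> mdist (q i) (y i) @[i --> F] --> et ->
  be * xi ^+ 2 + al * et ^+ 2 - al * be * (al + be) <= (al + be) * ga ^+ 2.
Proof.
move=> hA mA xz zy qz xy qx qy.
have lim_le (f g : nat -> R) (a b : R) : f @ F --> a -> g @ F --> b ->
    (forall i, f i <= g i) -> a <= b.
  move=> fa gb fg; rewrite -(cvg_lim (@Rhausdorff R) fa) -(cvg_lim (@Rhausdorff R) gb).
  by apply: ler_lim; [exact: cvgP fa|exact: cvgP gb|exact: nearW].
have ge0 (f : nat -> R) (a : R) : f @ F --> a -> (forall i, 0 <= f i) -> 0 <= a.
  by move=> fa f0; exact: (lim_le (cst 0) f 0 a (cvg_cst 0) fa f0).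
have tri (f g h : nat -> R) (a b c : R) : f @ F --> a -> g @ F --> b -> h @ F --> c ->
    (forall i, f i <= g i + h i) -> a <= b + c.
  by move=> fa gb hc le; exact: (lim_le _ _ _ _ fa (cvgD gb hc) le).
have al0 : 0 <= al by apply: (ge0 _ _ xz) => i; exact: mdist_ge0.
have be0 : 0 <= be by apply: (ge0 _ _ zy) => i; exact: mdist_ge0.
have ga0 : 0 <= ga by apply: (ge0 _ _ qz) => i; exact: mdist_ge0.
have xi0 : 0 <= xi by apply: (ge0 _ _ qx) => i; exact: mdist_ge0.
have et0 : 0 <= et by apply: (ge0 _ _ qy) => i; exact: mdist_ge0.
have T1 : xi <= ga + al.
  by apply: (tri _ _ _ _ _ _ qx qz xz) => i; rewrite (metric_sym (x i)); exact: metric_triangle.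
have T2 : et <= ga + be by apply: (tri _ _ _ _ _ _ qy qz zy) => i; exact: metric_triangle.
have T3 : ga <= xi + al by apply: (tri _ _ _ _ _ _ qz qx xz) => i; exact: metric_triangle.
have T4 : ga <= et + be.
  by apply: (tri _ _ _ _ _ _ qz qy zy) => i; rewrite (metric_sym (z i)); exact: metric_triangle.
have T5 : al <= xi + ga.
  by apply: (tri _ _ _ _ _ _ xz qx qz) => i; rewrite (metric_sym (q i) (x i)); exact: metric_triangle.
have T6 : be <= ga + et.
  by apply: (tri _ _ _ _ _ _ zy qz qy) => i; rewrite (metric_sym (q i) (z i)); exact: metric_triangle.
have T7 : al + be <= xi + et.
  by apply: (tri _ _ _ _ _ _ xy qx qy) => i; rewrite (metric_sym (q i) (x i)); exact: metric_triangle.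
(* If one of these distances vanishes in the limit, the angles give no control; the triangle
   inequalities then fix enough of the others to make both sides equal. *)
move: al0; rewrite le_eqVlt => /orP[/eqP al0|al0].
  have -> : xi = ga by lra.
  by rewrite -al0; lra.
move: be0; rewrite le_eqVlt => /orP[/eqP be0|be0].
  have -> : et = ga by lra.
  by rewrite -be0; lra.
move: ga0; rewrite le_eqVlt => /orP[/eqP ga0|ga0].
  have -> : et = be by lra.
  have -> : xi = al by lra.
  by rewrite -ga0; lra.
move: xi0; rewrite le_eqVlt => /orP[/eqP xi0|xi0].
  have -> : ga = al by lra.
  have -> : et = al + be by lra.
  by rewrite -xi0; lra.
move: et0; rewrite le_eqVlt => /orP[/eqP et0|et0].
  have -> : ga = be by lra.
  have -> : xi = al + be by lra.
  by rewrite -et0; lra.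
pose c1 i := triangle_cos (z i) (x i) (y i).
pose c2 i := triangle_cos (z i) (y i) (q i).
pose c3 i := triangle_cos (z i) (q i) (x i).
have cvg_cos (f g h : nat -> R) (a b c : R) : 0 < a -> 0 < b ->
    f @ F --> a -> g @ F --> b -> h @ F --> c ->
    (f i ^+ 2 + g i ^+ 2 - h i ^+ 2) / (2 * (f i * g i)) @[i --> F] -->
    (a ^+ 2 + b ^+ 2 - c ^+ 2) / (2 * (a * b)).
  move=> a0 b0 fa gb hc.
  have sq (u : nat -> R) (v : R) : u @ F --> v -> u i ^+ 2 @[i --> F] --> v ^+ 2.
    by move=> uv; rewrite expr2; under eq_fun do rewrite expr2; exact: cvgM.
  apply: cvgM; first by apply: cvgB; [apply: cvgD; exact: sq|exact: sq].
  apply: cvgV; first by rewrite gt_eqF// !mulr_gt0.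
  by apply: cvgM; [exact: cvg_cst|exact: cvgM].
have C1 : c1 @ F --> (-1 : R).
  have -> : -1 = (al ^+ 2 + be ^+ 2 - (al + be) ^+ 2) / (2 * (al * be)).
    by field; rewrite !gt_eqF.
  exact: cvg_cos.
have C2 : c2 @ F --> (be ^+ 2 + ga ^+ 2 - et ^+ 2) / (2 * (be * ga)).
  apply: cvg_cos => //.
  - by under eq_fun do rewrite metric_sym.
  - by under eq_fun do rewrite metric_sym.
  - by under eq_fun do rewrite metric_sym.
have C3 : c3 @ F --> (ga ^+ 2 + al ^+ 2 - xi ^+ 2) / (2 * (ga * al)).
  apply: cvg_cos => //.
  by under eq_fun do rewrite metric_sym.
have pos (f : nat -> R) (a : R) : 0 < a -> f @ F --> a -> \forall i \near F, 0 < f i.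
  by move=> a0 fa; exact: (cvgr_gt _ fa).
have low : \forall i \near F, - (1 + c1 i) - Num.sqrt (1 - c1 i ^+ 2) <= c2 i + c3 i.
  have p1 := pos _ _ al0 xz; have p2 := pos _ _ be0 zy; have p3 := pos _ _ ga0 qz.
  have p4 := pos _ _ (ltr_wpDl (ltW al0) be0) xy.
  have p5 := pos _ _ xi0 qx; have p6 := pos _ _ et0 qy.
  near=> i.
  have h1 : 0 < mdist (x i) (z i) by near: i.
  have h2 : 0 < mdist (z i) (y i) by near: i.
  have h3 : 0 < mdist (q i) (z i) by near: i.
  have h4 : 0 < mdist (x i) (y i) by near: i.
  have h5 : 0 < mdist (q i) (x i) by near: i.
  have h6 : 0 < mdist (q i) (y i) by near: i.
  rewrite mdist_gt0 in h1; rewrite mdist_gt0 in h2; rewrite mdist_gt0 in h3.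
  rewrite mdist_gt0 in h4; rewrite mdist_gt0 in h5; rewrite mdist_gt0 in h6.
  have [Ax Ay Az Aq] := mA i.
  apply: cos_sum_ge; rewrite ?triangle_cos_bound// 1?eq_sym//.
  apply: (hA (z i) (x i) (y i) (q i)) => //=.
  by rewrite !inE !negb_or h2 h4 (eq_sym (z i)) h1 (eq_sym (z i)) h3 (eq_sym (x i)) h5
    (eq_sym (y i)) h6.
have L : - (1 + c1 i) - Num.sqrt (1 - c1 i ^+ 2) @[i --> F] --> (0 : R).
  have -> : (0 : R) = - (1 + -1) - Num.sqrt (1 - (-1) ^+ 2).
    by rewrite sqrrN expr1n !subrr sqrtr0 subr0 oppr0.
  apply: cvgB; first by apply: cvgN; apply: cvgD => //; exact: cvg_cst.
  apply: continuous_cvg; first exact: sqrt_continuous.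
  apply: cvgB; first exact: cvg_cst.
  by rewrite [X in _ --> X]expr2; under eq_fun do rewrite expr2; exact: cvgM.
have : 0 <= (be ^+ 2 + ga ^+ 2 - et ^+ 2) / (2 * (be * ga)) +
     (ga ^+ 2 + al ^+ 2 - xi ^+ 2) / (2 * (ga * al)).
  rewrite -(cvg_lim (@Rhausdorff R) L) -(cvg_lim (@Rhausdorff R) (cvgD C2 C3)).
  by apply: ler_lim; [exact: cvgP L|exact: cvgP (cvgD C2 C3)|exact: low].
have abg : 0 < 2 * (al * be * ga) by rewrite !mulr_gt0.
rewrite -(pmulr_rge0 _ abg) => h; rewrite -subr_ge0; apply: le_trans h _.
rewrite le_eqVlt; apply/orP; left; apply/eqP; field.
by rewrite !gt_eqF.
Unshelve. all: end_near. Qed.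

End Quadruples.

Section LocalTotalBoundedness.
Context {R : realType} (M : metricType R).

Lemma continuous_mdist (p : M) : continuous (mdist p : M -> R).
Proof.
move=> x; apply/cvgrPdist_le => e e0.
near=> y.
have xy : mdist x y <= e.
  near: y; apply/metricType_numDomainType.nbhs_mdistP; exists e => // z /=; exact: ltW.
rewrite ler_norml; have := metric_triangle p x y; have := metric_triangle p y x.
by rewrite (metric_sym y x); lra.
Unshelve. all: end_near. Qed.

(** On a nearly shortest curve the intermediate value theorem gives a point at the exact distance
    from [x]; cutting the curve there bounds the other distance. *)
Lemma intrinsic_approx_between (x y : M) (t e : R) : intrinsic_metric M ->
  0 <= t <= 1 -> 0 < e ->
  exists2 z, mdist x z = t * mdist x y & mdist z y <= (1 - t) * mdist x y + e.
Proof.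
move=> hi t01 e0; have d0 := mdist_ge0 x y.
have : ((mdist x y)%:E < (mdist x y + e)%:E)%E by rewrite lte_fin ltrDl.
rewrite {1}hi => /ereal_inf_lt[_ [c [cc [c0 c1]] <-] cl].
have [||s] := @IVT R (fun s => mdist x (c s)) 0 1 (t * mdist x y) ler01.
- move=> u; apply: continuous_comp; [exact: cc|exact: continuous_mdist].
- rewrite c0 c1 mdistxx min_l// max_r//; apply/andP; split.
    by rewrite mulr_ge0//; move: t01 => /andP[].
  by rewrite ler_piMl//; move: t01 => /andP[].
rewrite in_itv/= => /andP[s0 s1] hs; exists (c s) => //.
(* A partition point must lie strictly inside, so the ends of the interval are treated apart. *)
move: s0; rewrite le_eqVlt => /orP[/eqP s0|s0].
  by move: hs; rewrite -s0 c0 mdistxx; lra.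
move: s1; rewrite le_eqVlt => /orP[/eqP s1|s1].
  move: hs; rewrite s1 c1 mdistxx => hs.
  have : 0 <= (1 - t) * mdist x y by rewrite mulr_ge0//; move: t01 => /andP[]; lra.
  by lra.
have : ((mdist x (c s) + mdist (c s) y)%:E <= curve_length c)%E.
  apply: ereal_sup_ubound; exists [:: s; 1].
    by split => //=; rewrite s0 s1.
  by rewrite big_mkord !big_ord_recl big_ord0 /= addr0 c0 c1.
move=> /le_lt_trans/(_ cl); rewrite lte_fin hs; lra.
Qed.

Definition totally_bounded (A : set M) := forall e : R, 0 < e ->
  exists s : seq M, forall x, A x -> exists2 y, y \in s & mdist x y < e.

Lemma not_totally_bounded_separated (A : set M) : A !=set0 -> ~ totally_bounded A ->
  exists2 e : R, 0 < e & forall K : nat, exists c : nat -> M,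
    (forall i, (i < K)%N -> A (c i)) /\
    forall i j, (i < j < K)%N -> e <= mdist (c i) (c j).
Proof.
move=> [x0 Ax0] /existsNP[e /not_implyP[e0 hs]]; exists e => //.
elim=> [|K [c [cA cs]]]; first by exists (fun=> x0); split=> // i j; rewrite ltn0 andbF.
have [x Ax xs] : exists2 x, A x & forall i, (i < K)%N -> e <= mdist x (c i).
  apply: contrapT => no; apply: hs; exists [seq c i | i <- iota 0 K] => x Ax.
  apply: contrapT => no2; apply: no; exists x => // i iK.
  rewrite leNgt; apply/negP => h; apply: no2; exists (c i) => //.
  by apply/mapP; exists i => //; rewrite mem_iota.
exists (fun i => if (i < K)%N then c i else x); split=> [i _|i j].
  by case: ifP => // /cA.
move=> /andP[ij]; rewrite ltnS leq_eqVlt => /orP[/eqP jK|jK].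
  by rewrite jK in ij *; rewrite ij ltnn metric_sym; exact: xs.
by rewrite jK (ltn_trans ij jK) cs// ij.
Qed.

Section Ultrafilter.
Variable U : set_system nat.
Hypothesis UU : UltraFilter U.
Hypothesis Uoo : \oo `<=` U.
Let UP : ProperFilter U. Proof. exact: ultra_proper. Qed.

Lemma between_limit (A : set M) (p x : M) (z q : nat -> M) (tau ga xi et : R) :
  quadruple_condition A -> 0 <= tau <= 1 -> A p -> A x ->
  (forall n, A (z n)) -> (forall n, A (q n)) ->
  mdist p (z n) @[n --> U] --> tau * mdist p x ->
  mdist (z n) x @[n --> U] --> (1 - tau) * mdist p x ->
  mdist (q n) (z n) @[n --> U] --> ga -> mdist (q n) p @[n --> U] --> xi ->
  mdist (q n) x @[n --> U] --> et ->
  (1 - tau) * xi ^+ 2 + tau * et ^+ 2 - tau * (1 - tau) * mdist p x ^+ 2 <= ga ^+ 2.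
Proof.
move=> hA tau01 Ap Ax Az Aq pz zx qz qp qx.
have := mdist_ge0 p x; rewrite le_eqVlt => /orP[/eqP L0|L0].
  have px : p = x by apply: mdist_positivity.
  subst x; have e1 : et = xi by exact: (ultra_unique UU qx qp).
  have h : xi <= ga.
    have zc : mdist (q n) (z n) + mdist (z n) p @[n --> U] --> ga + (1 - tau) * mdist p p.
      exact: cvgD.
    rewrite -L0 mulr0 addr0 in zc.
    by apply: (ultra_le UU qp zc) => n; exact: metric_triangle.
  have xi0 : 0 <= xi.
    by apply: (ultra_le UU (cvg_cst 0) qp) => n; exact: mdist_ge0.
  have : xi ^+ 2 <= ga ^+ 2 by rewrite ler_pXn2r ?nnegrE// (le_trans xi0).
  by rewrite e1 -L0; lra.
have pxc : mdist p x @[_ --> U] --> tau * mdist p x + (1 - tau) * mdist p x.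
  have -> : tau * mdist p x + (1 - tau) * mdist p x = mdist p x by ring.
  exact: cvg_cst.
have := quadruple_limit UP hA (fun n => And4 Ap Ax (Az n) (Aq n)) pz zx qz pxc qp qx.
have -> : tau * mdist p x + (1 - tau) * mdist p x = mdist p x by ring.
move=> h; rewrite -(ler_pM2l L0); apply: le_trans h.
by rewrite le_eqVlt; apply/orP; left; apply/eqP; ring.
Qed.

(* Otherwise infinitely many separated points exist, and contracting them towards any
   nearby point contradicts the vanishing of the Hausdorff measure. *)
Lemma ball_totally_bounded (x0 : M) (r s : R) :
  metric_complete M -> intrinsic_metric M -> 0 < s ->
  hausdorff_measure s [set: M] = 0%E -> 0 < r ->
  quadruple_condition [set x | mdist x0 x < r] ->
  totally_bounded [set x | mdist x0 x <= r / 4].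
Proof.
move=> cM iM s0 H0 r0 hA; apply: contrapT => ntb.
have ne : [set x | mdist x0 x <= r / 4] !=set0.
  by exists x0; rewrite /= mdistxx divr_ge0// ltW.
have [e e0 sep] := not_totally_bounded_separated ne ntb.
have r2 : 0 < r / 2 by rewrite divr_gt0.
have r4 : 0 < r / 4 by rewrite divr_gt0.
have e2 : 0 < e / 2 by rewrite divr_gt0.
(* The children of [p] are the separated points contracted towards [p] by the factor [tau]; halving
   the separation [e] absorbs the passage from limits to actual points. *)
apply: (@hausdorff_measure_crowded R M cM s (e / 2) (r / 2) (r / 4) x0) => // K p px0.
move=> tau /andP[tau0 tau1].
have tau01 : 0 <= tau <= 1 by rewrite ltW.
have [c [cA cs]] := sep K.
have cA' (i : 'I_K) : mdist x0 (c i) <= r / 4 by exact: cA.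
have cp (i : 'I_K) : mdist p (c i) <= r / 2.
  have := metric_triangle p x0 (c i); have := cA' i; rewrite (metric_sym p x0); lra.
have inv0 (n : nat) : (0 : R) < 1 / n.+1%:R by rewrite divr_gt0.
have /choice[y hy] (ni : nat * 'I_K) : exists z,
    mdist p z = tau * mdist p (c ni.2) /\
    mdist z (c ni.2) <= (1 - tau) * mdist p (c ni.2) + 1 / ni.1.+1%:R.
  have [z h1 h2] := intrinsic_approx_between p (c ni.2) iM tau01 (inv0 ni.1).
  by exists z.
have Ay n i : mdist x0 (y (n, i)) < r.
  have [/= h1 _] := hy (n, i); have := metric_triangle x0 p (y (n, i)).
  have : tau * mdist p (c i) <= 1 * (r / 2) by rewrite ler_pM ?mdist_ge0 ?(ltW tau0).
  by rewrite h1; lra.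
have Ac (i : 'I_K) : mdist x0 (c i) < r by have := cA' i; lra.
have Ap : mdist x0 p < r by lra.
have py i : mdist p (y (n, i)) @[n --> U] --> tau * mdist p (c i).
  have -> : (fun n => mdist p (y (n, i))) = cst (tau * mdist p (c i)).
    by apply/funext => n; have [] := hy (n, i).
  exact: cvg_cst.
have yc i : mdist (y (n, i)) (c i) @[n --> U] --> (1 - tau) * mdist p (c i).
  apply: (@squeeze_cvgr _ _ _ _ (cst ((1 - tau) * mdist p (c i)))
    (fun n => (1 - tau) * mdist p (c i) + 1 / n.+1%:R)).
  - apply: nearW => n; have [/= h1 h2] := hy (n, i); rewrite h2 andbT {h2}.
    have := metric_triangle p (y (n, i)) (c i); rewrite h1 /=.
    by rewrite mulrBl mul1r lerBlDl.
  - exact: cvg_cst.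
  - rewrite -[X in _ --> X]addr0; apply: cvgD; first exact: cvg_cst.
    exact: ultra_invn.
have bdd (u v : nat -> M) : (forall n, mdist x0 (u n) < r) -> (forall n, mdist x0 (v n) < r) ->
    exists l : R, mdist (u n) (v n) @[n --> U] --> l.
  move=> ur vr; apply: (@ultra_bounded_cvg R U UU _ (r + r)) => n.
  rewrite ger0_norm ?mdist_ge0//; have := metric_triangle (u n) x0 (v n).
  by rewrite (metric_sym (u n) x0); have := ur n; have := vr n; lra.
(* Comparison is applied twice, to the pair [p], [c i] seen from [c j] and to the pair [p], [c j]
   seen from [y (n, i)]; the distances from [p] cancel and at least [tau * e] is left. *)
have D i j : i != j -> \forall n \near U, e / 2 * tau <= mdist (y (n, i)) (y (n, j)).
  move=> ij.
  have eX : e <= mdist (c i) (c j).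
    have [lij|lji|/val_inj eij] := ltngtP i j.
    - by rewrite cs// lij/=.
    - by rewrite metric_sym cs// lji/=.
    - by rewrite eij eqxx in ij.
  have [g hg] := bdd (fun=> c j) (fun n => y (n, i)) (fun=> Ac j) (fun n => Ay n i).
  have [D hD] := bdd (fun n => y (n, i)) (fun n => y (n, j)) (fun n => Ay n i) (fun n => Ay n j).
  have cc (v : R) : v @[_ --> U] --> v by exact: cvg_cst.
  have h1 := between_limit hA tau01 Ap (Ac i) (fun n => Ay n i) (fun=> Ac j)
    (py i) (yc i) hg (cc _) (cc _).
  have yp : mdist (y (n, i)) p @[n --> U] --> tau * mdist p (c i).
    by under eq_fun do rewrite metric_sym; exact: py.
  have yx : mdist (y (n, i)) (c j) @[n --> U] --> g.
    by under eq_fun do rewrite metric_sym.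
  have h2 := between_limit hA tau01 Ap (Ac j) (fun n => Ay n j) (fun n => Ay n i)
    (py j) (yc j) hD yp yx.
  have D0 : 0 <= D.
    by apply: (ultra_le UU (cvg_cst 0) hD) => n; exact: mdist_ge0.
  have hDX : tau * e <= D.
    rewrite -(@ler_pXn2r _ 2) ?nnegrE// ?mulr_ge0 ?(ltW tau0) ?(ltW e0)//.
    have : e ^+ 2 <= mdist (c i) (c j) ^+ 2 by rewrite ler_pXn2r ?nnegrE ?mdist_ge0 ?(ltW e0).
    rewrite (metric_sym (c j) p) in h1; rewrite (metric_sym (c j) (c i)) in h1.
    move: h1 h2; move: (mdist p (c i)) (mdist p (c j)) (mdist (c i) (c j)) => a b X h1 h2 h3.
    have h4 := ler_wpM2l (ltW tau0) h1.
    have h5 := ler_wpM2l (sqr_ge0 tau) h3.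
    by nra.
  have te0 : 0 < tau * e by rewrite mulr_gt0.
  have lt : e / 2 * tau < D by move: te0 hDX; lra.
  by apply: (cvgr_ge D hD); exact: lt.
have : \forall n \near U, forall ij : 'I_K * 'I_K, ij.1 != ij.2 ->
    e / 2 * tau <= mdist (y (n, ij.1)) (y (n, ij.2)).
  apply: filter_forall => -[i j] /=; have [->|ij] := eqVneq i j.
    by apply: nearW.
  by have := D i j ij; apply: filterS.
move=> /filter_ex[n hn]; exists (fun i => y (n, i)); split=> [i|i j ij].
  by have [/= -> _] := hy (n, i); rewrite mulrC ler_pM2r//; exact: cp.
exact: (hn (i, j)).
Qed.

End Ultrafilter.
End LocalTotalBoundedness.

Lemma mdist_axioms {R : realType} (M : metricType R) : metric_axioms (@mdist R M).
Proof.
split; [exact: mdistxx|exact: mdist_positivity|exact: metric_sym|exact: metric_triangle].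
Qed.

(** * The Hopf-Rinow theorem *)

Section HopfRinow.
Context {R : realType} (M : metricType R) (U : set_system nat).
Hypothesis UU : UltraFilter U.
Hypothesis Uoo : \oo `<=` U.
Hypothesis cM : metric_complete M.
Let UP : ProperFilter U. Proof. exact: ultra_proper. Qed.

Lemma ultra_seq_exists (T : eqType) (s : seq T) (P : T -> set nat) :
  U [set n | exists2 y, y \in s & P y n] -> exists2 y, y \in s & U (P y).
Proof.
elim: s => [|a s ih] h.
  have [n [y]] : exists n, exists2 y : T, y \in [::] & P y n by exact: (filter_ex h).
  by rewrite in_nil.
have [Ua|Ua] := in_ultra_setVsetC (P a) UU; first by exists a; rewrite ?mem_head.
have [|y ys Uy] := ih; last by exists y; rewrite // in_cons ys orbT.
apply: filterS (filterI h Ua) => n [[y]]; rewrite in_cons => /orP[/eqP->//|ys Py _].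
by exists y.
Qed.

Lemma totally_bounded_ultra (A : set M) (u : nat -> M) : totally_bounded A ->
  (forall n, A (u n)) -> exists l, mdist (u n) l @[n --> U] --> (0 : R).
Proof.
move=> tA Au; have [l hl] : exists l : M, u @ U --> l.
  apply: cM; apply/cauchy_ballP => e e0.
  have [s hs] := tA (e / 2) ltac:(by rewrite divr_gt0).
  have [|y _ Uy] := @ultra_seq_exists M s (fun y => [set n | mdist (u n) y < e / 2]).
    apply: (@filterS _ _ _ setT _ _ filterT) => n _.
    by have [y ys uy] := hs (u n) (Au n); exists y.
  exists ([set x | mdist x y < e / 2], [set x | mdist x y < e / 2]) => //.
  move=> [a b] [/= ha hb]; rewrite ballEmdist/=.
  by have := metric_triangle a y b; rewrite (metric_sym y b); lra.
exists l; apply/cvgrPdist_lt => e e0.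
near=> n; rewrite sub0r normrN ger0_norm ?mdist_ge0// metric_sym; near: n.
exact: (metricType_numDomainType.cvgr_dist_lt hl e0).
Unshelve. all: end_near. Qed.

Lemma totally_bounded_subset (A B : set M) :
  A `<=` B -> totally_bounded B -> totally_bounded A.
Proof. by move=> AB tB e /tB[s hs]; exists s => x /AB/hs. Qed.

Lemma totally_bounded_seq_cover (s : seq M) (B : M -> set M) :
  (forall y, y \in s -> totally_bounded (B y)) ->
  totally_bounded [set x | exists2 y, y \in s & B y x].
Proof.
elim: s => [|a s ih] h e e0; first by exists [::] => x [y]; rewrite in_nil.
have [s1 h1] := h a (mem_head _ _) e e0.
have [|s2 h2] := ih _ e e0; first by move=> y ys; apply: h; rewrite in_cons ys orbT.
exists (s1 ++ s2) => x [y]; rewrite in_cons => /orP[/eqP->|ys] Bx.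
  by have [z zs xz] := h1 x Bx; exists z; rewrite ?mem_cat ?zs.
have [|z zs xz] := h2 x; first by exists y.
by exists z; rewrite ?mem_cat ?zs ?orbT.
Qed.

Lemma totally_bounded_net (A : set M) (e : R) : totally_bounded A -> 0 < e ->
  exists s : seq M, (forall y, y \in s -> A y) /\
    forall x, A x -> exists2 y, y \in s & mdist x y < e.
Proof.
move=> tA e0; have [s hs] := tA (e / 2) ltac:(by rewrite divr_gt0).
have [->|/set0P[a Aa]] := eqVneq A set0; first by exists [::].
have /choice[g hg] (y : M) : exists z, A z /\
    ((exists2 x, A x & mdist x y < e / 2) -> mdist z y < e / 2).
  have [[x Ax xy]|no] := pselect (exists2 x, A x & mdist x y < e / 2); first by exists x.
  by exists a.
exists (map g s); split=> [_ /mapP[y _ ->]|x Ax]; first by have [] := hg y.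
have [y ys xy] := hs x Ax; exists (g y); first exact: map_f.
have [_ /(_ _) gy] := hg y; have {}gy : mdist (g y) y < e / 2 by apply: gy; exists x.
by have := metric_triangle x y (g y); rewrite (metric_sym y (g y)); lra.
Qed.

(** A Lebesgue number: centres with ever smaller bad radii would converge to some [l], and a good
    ball at [l] contains one of the bad balls. *)
Lemma uniform_radius (P : set M -> Prop) (K : set M) :
  (forall A B : set M, A `<=` B -> P B -> P A) ->
  (forall x, exists2 r : R, 0 < r & P [set y | mdist x y < r]) -> totally_bounded K ->
  exists2 r : R, 0 < r & forall x, K x -> P [set y | mdist x y <= r].
Proof.
move=> mono loc tK; apply: contrapT => no.
have /choice[x hx] (n : nat) : exists x, K x /\ ~ P [set y | mdist x y <= 1 / n.+1%:R].
  apply: contrapT => no2; apply: no; exists (1 / n.+1%:R); first by rewrite divr_gt0.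
  by move=> x Kx; apply: contrapT => nP; apply: no2; exists x.
have [l hl] := totally_bounded_ultra tK (fun n => proj1 (hx n)).
have [r r0 Pr] := loc l.
have : (mdist (x n) l + 1 / n.+1%:R) @[n --> U] --> (0 + 0 : R).
  by apply: cvgD => //; exact: ultra_invn.
rewrite addr0 => /cvgr_lt/(_ r r0)/filter_ex[n hn].
have [_ nP] := hx n; apply: nP; apply: mono Pr => y /= xy.
by have := metric_triangle l (x n) y; rewrite (metric_sym l (x n)); move: (1 / _) xy hn => a; lra.
Qed.

Hypothesis iM : intrinsic_metric M.

Lemma intrinsic_ball_neighbor (o x : M) (r e : R) : 0 <= r -> 0 < e -> mdist o x <= r + e ->
  exists2 z, mdist o z <= r & mdist z x <= e + e.
Proof.
move=> r0 e0 ox; have [oxr|rox] := leP (mdist o x) r.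
  by exists x; rewrite ?mdistxx// addr_ge0// ltW.
have ox0 : 0 < mdist o x by exact: le_lt_trans rox.
have t01 : 0 <= r / mdist o x <= 1 by rewrite divr_ge0// ?ler_pdivrMr// ?mul1r ?ltW.
have [z oz zx] := intrinsic_approx_between o x iM t01 e0.
rewrite divfK ?gt_eqF// in oz.
rewrite mulrBl mul1r divfK ?gt_eqF// in zx.
by exists z; lra.
Qed.

(** Let [rho] be the supremum of the radii of totally bounded balls. The ball of radius [rho] is one
    of them, its points being close to slightly smaller balls, and finitely many balls of a uniform
    radius then cover a larger one. *)
Lemma hopf_rinow (o : M) (r : R) :
  (forall x : M, exists2 r : R, 0 < r & totally_bounded [set y | mdist x y < r]) ->
  totally_bounded [set x | mdist o x <= r].
Proof.
move=> loc; apply: contrapT => ntb.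
pose E := [set t : R | 0 <= t /\ totally_bounded [set x | mdist o x <= t]].
have [r1 r10 tb1] := loc o.
have Er1 : E (r1 / 2).
  split; first by rewrite divr_ge0// ltW.
  by apply: totally_bounded_subset tb1 => x /=; lra.
have supE : has_sup E.
  split; first by exists (r1 / 2).
  exists r => t [t0 tbt]; rewrite leNgt; apply/negP => rt; apply: ntb.
  by apply: totally_bounded_subset tbt => x /=; lra.
pose rho := sup E.
have rho0 : 0 < rho.
  by apply: (@lt_le_trans _ _ (r1 / 2)); [rewrite divr_gt0|exact: (sup_upper_bound supE)].
have tbrho : totally_bounded [set x | mdist o x <= rho].
  move=> e e0; have e4 : 0 < e / 4 by rewrite divr_gt0.
  have [t [t0 tbt] ht] := sup_adherent e4 supE; rewrite -/rho in ht.
  have [s hs] := tbt (e / 4) e4; exists s => x /= ox.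
  have [|z oz zx] := intrinsic_ball_neighbor (r := t) (x := x) (o := o) t0 e4; first lra.
  have [y ys zy] := hs z oz; exists y => //.
  by have := metric_triangle x z y; rewrite (metric_sym x z); lra.
have [eta eta0 heta] := uniform_radius (@totally_bounded_subset) loc tbrho.
have e8 : 0 < eta / 8 by rewrite divr_gt0.
have [s [sA hs]] := totally_bounded_net tbrho e8.
have : E (rho + eta / 8).
  split; first by rewrite addr_ge0 ?ltW.
  apply: totally_bounded_subset (totally_bounded_seq_cover (s := s)
    (B := fun y => [set x | mdist y x <= eta]) _); last by move=> y /sA/heta.
  move=> x /= ox.
  have [z oz zx] := intrinsic_ball_neighbor (ltW rho0) e8 ox.
  have [y ys zy] := hs z oz; exists y => //.
  by have := metric_triangle y z x; rewrite (metric_sym y z); lra.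
by move=> /(sup_upper_bound supE); rewrite -/rho; lra.
Qed.

Lemma intrinsic_geodesic : ultracompact U (@mdist R M) -> geodesic (@mdist R M).
Proof.
move=> uc x y t t01.
have /choice[z hz] (n : nat) : exists z, mdist x z = t * mdist x y /\
    mdist z y <= (1 - t) * mdist x y + 1 / n.+1%:R.
  have n0 : (0 : R) < 1 / n.+1%:R by rewrite divr_gt0.
  by have [z h1 h2] := intrinsic_approx_between x y iM t01 n0; exists z.
have [l hl] := uc z x (t * mdist x y) ltac:(by move=> n; have [-> _] := hz n).
have md := mdist_axioms M.
have xl : mdist x l = t * mdist x y.
  have : mdist (z n) x @[n --> U] --> mdist l x by exact: (ultra_dist UU md).
  have -> : (fun n => mdist (z n) x) = cst (t * mdist x y).
    by apply/funext => n; rewrite metric_sym; have [] := hz n.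
  by move=> h; rewrite metric_sym; exact: (ultra_unique UU h (cvg_cst _)).
exists l => //; apply/eqP; rewrite eq_le; apply/andP; split.
  have h1 : mdist (z n) y @[n --> U] --> mdist l y by exact: (ultra_dist UU md).
  have h2 : (1 - t) * mdist x y + 1 / n.+1%:R @[n --> U] --> (1 - t) * mdist x y + 0.
    by apply: cvgD; [exact: cvg_cst|exact: ultra_invn].
  rewrite addr0 in h2; apply: (ultra_le UU h1 h2) => n.
  by have [] := hz n.
by have := metric_triangle x l y; rewrite xl mulrBl mul1r lerBlDl.
Qed.

End HopfRinow.

Section LocalComparison.
Context {R : realType} (M : metricType R) (U : set_system nat).
Hypothesis UU : UltraFilter U.

Definition semiconcave_on (A : set M) := forall x y z q, A x -> A y -> A z -> A q ->
  mdist x z + mdist z y = mdist x y ->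
  mdist z y * mdist q x ^+ 2 + mdist x z * mdist q y ^+ 2
    - mdist x z * mdist z y * mdist x y <= mdist x y * mdist q z ^+ 2.

Lemma quadruple_semiconcave (A : set M) : quadruple_condition A -> semiconcave_on A.
Proof.
move=> hA x y z q Ax Ay Az Aq e.
have UP := @ultra_proper _ _ UU.
have cc (v : R) : v @[_ --> U] --> v by exact: cvg_cst.
have h := quadruple_limit UP hA (fun _ => And4 Ax Ay Az Aq) (cc _) (cc _) (cc _) _ (cc _) (cc _).
by rewrite -e; apply: h; rewrite e; exact: cc.
Qed.

End LocalComparison.

(** * Toponogov globalization *)

Section Globalization.
Context {R : realType} (T : Type) (d : T -> T -> R).
Hypothesis md : metric_axioms d.
Hypothesis gd : geodesic d.

Let d0 := dist_refl md.
Let dsym := dist_sym md.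
Let dtri := dist_tri md.
Let dge := dist_ge0 md.

Definition between x z y := d x z + d z y = d x y.

Definition stewart_at x y z q :=
  d z y * d q x ^+ 2 + d x z * d q y ^+ 2 - d x z * d z y * d x y <= d x y * d q z ^+ 2.

(** The cosine of the comparison angle at [x], so a larger value means a smaller angle. *)
Definition cmp_cos x p q := (d x p ^+ 2 + d x q ^+ 2 - d p q ^+ 2) / (2 * (d x p * d x q)).

Lemma cmp_cosC x p q : cmp_cos x p q = cmp_cos x q p.
Proof. by rewrite /cmp_cos (dsym p q) (mulrC (d x p)) (addrC (d x p ^+ 2)). Qed.

Lemma cmp_cosE x p q : 0 < d x p -> 0 < d x q ->
  d p q ^+ 2 = d x p ^+ 2 + d x q ^+ 2 - 2 * (d x p * d x q) * cmp_cos x p q.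
Proof. by move=> p0 q0; rewrite /cmp_cos; field; rewrite !gt_eqF. Qed.

Lemma cmp_cos_ge x p q c : 0 < d x p -> 0 < d x q ->
  (c <= cmp_cos x p q) =
    (d p q ^+ 2 <= d x p ^+ 2 + d x q ^+ 2 - 2 * (d x p * d x q) * c).
Proof.
move=> p0 q0; have P : 0 < 2 * (d x p * d x q) by rewrite !mulr_gt0.
rewrite (cmp_cosE p0 q0) lerD2l lerN2 ler_pM2l//.
Qed.

(** The two inequalities differ by a positive factor. In angles: the comparison angles on both sides
    of an inner point of a segment sum to at most [pi]. *)
Lemma stewart_cmp_cos x y z q : between x z y -> 0 < d z x -> 0 < d z y -> 0 < d z q ->
  stewart_at x y z q <-> 0 <= cmp_cos z x q + cmp_cos z y q.
Proof.
move=> bt x0 y0 q0; rewrite /stewart_at -bt (dsym x z) !(dsym q).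
have P : 0 < 2 * (d z x * d z y * d z q) by rewrite !mulr_gt0.
have e : 2 * (d z x * d z y * d z q) * (cmp_cos z x q + cmp_cos z y q) =
    (d z x + d z y) * d z q ^+ 2 -
    (d z y * d x q ^+ 2 + d z x * d y q ^+ 2 - d z x * d z y * (d z x + d z y)).
  by rewrite /cmp_cos; field; rewrite !gt_eqF.
by split=> h; [rewrite -(pmulr_rge0 _ P) e subr_ge0|rewrite -subr_ge0 -e pmulr_rge0].
Qed.

(** Alexandrov's monotonicity of comparison angles, in cosine form. *)
Lemma stewart_cmp_cos_le x p a q : between x a p -> 0 < d x a -> 0 < d x q ->
  stewart_at x p a q -> cmp_cos x a q <= cmp_cos x p q.
Proof.
move=> bt a0 q0; rewrite /stewart_at.
have p0 : 0 < d x p by rewrite -bt; apply: ltr_wpDr.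
have ap : d a p = d x p - d x a by rewrite -bt; ring.
rewrite (cmp_cos_ge _ p0 q0) ap (dsym q x) (dsym q p) (dsym q a) (cmp_cosE a0 q0).
move: (cmp_cos x a q) => c h; rewrite -(ler_pM2l a0).
by lra.
Qed.

Lemma between_sym x z y : between x z y -> between y z x.
Proof. by rewrite /between => h; rewrite (dsym y x) -h (dsym y) (dsym z x) addrC. Qed.

Lemma between_mid x a z p : between x a z -> between x z p -> between a z p.
Proof.
by rewrite /between => h1 h2; have := dtri a z p; have := dtri x a p; lra.
Qed.

Lemma between_le x a p : between x a p -> d x a <= d x p.
Proof. by rewrite /between => <-; rewrite lerDl. Qed.

Lemma tiny_between x p t : 0 < d x p -> 0 < t ->
  exists a, [/\ between x a p, 0 < d x a & d x a <= t].
Proof.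
move=> p0 t0; have mt : 0 <= Num.min t (d x p) <= d x p.
  by rewrite le_min ge_min lexx (ltW t0) dge orbT.
have [a h1 h2] := point_at_dist md gd mt.
exists a; split; [by rewrite /between h1 h2; ring|by rewrite h1 lt_min t0|].
by rewrite h1 ge_min lexx.
Qed.

Section Step.
Variables (o : T) (e Rb : R).
Hypothesis e0 : 0 < e.
Hypothesis local : forall c x y z q, d o c <= Rb -> d c x <= e -> d c y <= e ->
  d c z <= e -> d c q <= e -> between x z y -> stewart_at x y z q.

(* The angle is read off at points a, b close to x. The margin 6 * l bounds the total
   displacement 2 * l * (1 + 2/3 + (2/3)^2 + ...) of x over all smaller scales. *)
Definition hinge_comparison l := forall x p q a b, d o x <= Rb - 6 * l ->
  d x p + d x q < l -> between x a p -> between x b q ->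
  0 < d x a <= e / 20 -> 0 < d x b <= e / 20 -> cmp_cos x a b <= cmp_cos x p q.

Lemma hinge_comparison_local l : 0 < l <= e -> hinge_comparison l.
Proof.
move=> /andP[l0 le] x p q a b ox s ap bq /andP[a0 _] /andP[b0 _].
have oxR : d o x <= Rb by lra.
have pe : d x p <= e by have := dge x q; lra.
have qe : d x q <= e by have := dge x p; lra.
have xe : d x x <= e by rewrite d0 ltW.
have ae : d x a <= e := le_trans (between_le ap) pe.
have be : d x b <= e := le_trans (between_le bq) qe.
have q0 : 0 < d x q := lt_le_trans b0 (between_le bq).
apply: (@le_trans _ _ (cmp_cos x a q)).
  rewrite (cmp_cosC x a b) (cmp_cosC x a q); apply: stewart_cmp_cos_le => //.
  exact: (local oxR).
by apply: stewart_cmp_cos_le => //; exact: (local oxR).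
Qed.

(* Moves x by l / 13 along the longer side: hinges of size 2 * l / 3 at the old and the new
   vertex show that the third side S of the model hinge does not increase, and S is close
   to the sum of the sides whenever that sum hardly decreases. *)
Lemma hinge_step l x p q a b : e < l -> hinge_comparison (2 * l / 3) ->
  d o p <= Rb - 5 * l -> d o x <= Rb - 4 * l ->
  d x p + d x q < l -> 2 * l / 3 <= d x p + d x q -> d x q <= d x p ->
  between x a p -> between x b q -> 0 < d x a <= e / 20 -> 0 < d x b <= e / 20 ->
  cmp_cos x p q < cmp_cos x a b ->
  exists x' a' b', [/\ between x' a' p /\ between x' b' q, 0 < d x' a' <= e / 20,
    0 < d x' b' <= e / 20, d x' p + d x' q <= d x p + d x q &
    d x' p ^+ 2 + d x' q ^+ 2 - 2 * (d x' p * d x' q) * cmp_cos x' a' b'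
      <= d x p ^+ 2 + d x q ^+ 2 - 2 * (d x p * d x q) * cmp_cos x a b /\
    (d x p + d x q) ^+ 2 - 15 * l * (d x p + d x q - (d x' p + d x' q))
      <= d x p ^+ 2 + d x q ^+ 2 - 2 * (d x p * d x q) * cmp_cos x a b].
Proof.
move=> el H op ox sl ls vu ap bq ae be ctr.
have [a0 a20] := andP ae; have [b0 b20] := andP be.
set u := d x p in sl ls vu *; set v := d x q in sl ls vu *.
(* The hinge at the new vertex has sides of sum at most [2 * h + v] with [v < l / 2], which is below
   [2 * l / 3] as soon as [h < l / 12]. *)
have [h hE] : exists h, h = l / 13 by exists (l / 13).
have h0 : 0 < h by lra.
have l3u : l / 3 <= u by lra.
have v0 : 0 < v := lt_le_trans b0 (between_le bq).
have u0 : 0 < u by lra.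
have [x' ax' x'p] := point_at_dist md gd
  (ltac:(have : d x a + d a p = u := ap; lra) : 0 <= h - d x a <= d a p).
have apu : d x a + d a p = u := ap.
have x'pu : d x' p = u - h by lra.
have xx' : d x x' = h.
  by have := dtri x a x'; have := dtri x x' p; rewrite -/u; lra.
have bxa : between x a x' by rewrite /between ax' xx'; ring.
have bx' : between x x' p by rewrite /between xx' x'pu /u; ring.
have x'p0 : 0 < d x' p by rewrite x'pu; lra.
have vl : v < l / 2 by lra.
have wv : d x' q <= h + v by have := dtri x' x q; rewrite (dsym x' x) xx'.
have c1 : cmp_cos x a b <= cmp_cos x x' q.
  by apply: H => //; [lra|rewrite xx' -/v; lra].
(* If [x'] is [q], then [q] lies on the longer side and the comparison cosine is already 1, against
   [ctr]. *)
move: (dge x' q); rewrite le_eqVlt => /orP[/eqP w0|w0].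
  have x'q : x' = q by apply: (dist_eq0 md).
  have hv : h = v by rewrite -xx' x'q.
  have c11 : cmp_cos x x' q <= 1.
    rewrite /cmp_cos -w0 -/v xx' hv ler_pdivrMr ?mulr_gt0//; lra.
  have : cmp_cos x p q = 1.
    rewrite /cmp_cos -/u -/v -x'q (dsym p) x'pu hv; field; rewrite !gt_eqF//.
  by move=> e1; rewrite e1 in ctr; lra.
have ox' : d o x' <= Rb - 4 * l.
  by have := dtri o p x'; rewrite (dsym p x') x'pu; lra.
have e200 : 0 < e / 20 by lra.
have [a' [ba' a'0 a'e]] := tiny_between (ltac:(by rewrite dsym xx') : 0 < d x' x) e200.
have [b' [bb' b'0 b'e]] := tiny_between w0 e200.
have [a2 [ba2 a20' a2e]] := tiny_between x'p0 e200.
have c2 : cmp_cos x' a' b' <= cmp_cos x' x q.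
  apply: H => //; [lra|rewrite (dsym x' x) xx'; lra|by rewrite a'0|by rewrite b'0].
(* [x'] lies inside the short segment from [a'] to [a2], so by the local comparison the two angles
   with [b'] sum to at most [pi]. *)
have c3 : 0 <= cmp_cos x' a' b' + cmp_cos x' a2 b'.
  have bt1 : between a' x' p.
    apply: (between_mid (x := x)) bx'; exact: between_sym ba'.
  have bt : between a' x' a2.
    apply: between_sym; apply: (between_mid (x := p)); apply: between_sym => //.
  apply/stewart_cmp_cos => //; apply: (local (c := x')) => //; rewrite ?d0; lra.
exists x', a2, b'; split=> //; [by rewrite a20'|by rewrite b'0|by rewrite x'pu; lra|].
have t2 : 2 * (h * d x' q) * cmp_cos x' x q = h ^+ 2 + d x' q ^+ 2 - v ^+ 2.
  by rewrite /cmp_cos (dsym x' x) xx' -/v; field; rewrite !gt_eqF.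
have t1 : 2 * (h * v) * cmp_cos x x' q = h ^+ 2 + v ^+ 2 - d x' q ^+ 2.
  by rewrite /cmp_cos xx' -/v; field; rewrite !gt_eqF.
rewrite x'pu; set w := d x' q in wv w0 t1 t2 *.
move: c1 c2 c3 t1 t2.
move: (cmp_cos x a b) (cmp_cos x x' q) (cmp_cos x' a' b') (cmp_cos x' x q) (cmp_cos x' a2 b').
move=> C1 C2 C3 C4 C5 c12 c34 c35 t1 t2.
have h5 : - C4 <= C5 by lra.
have uv0 : 0 < 2 * (u * v) by rewrite !mulr_gt0.
have uh0 : 0 < u - h by rewrite -x'pu.
have k1 : 2 * (u * v) * C1 <= 2 * (u * v) * C2 by rewrite ler_pM2l.
have k2 : 2 * ((u - h) * w) * (- C4) <= 2 * ((u - h) * w) * C5.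
  by rewrite ler_pM2l// !mulr_gt0.
have k3 : h * (2 * (u * v) * C2) = u * (h ^+ 2 + v ^+ 2 - w ^+ 2) by rewrite -t1; ring.
have k4 : h * (2 * ((u - h) * w) * C4) = (u - h) * (h ^+ 2 + w ^+ 2 - v ^+ 2).
  by rewrite -t2; ring.
have k1' : h * (2 * (u * v) * C1) <= u * (h ^+ 2 + v ^+ 2 - w ^+ 2).
  by rewrite -k3 ler_pM2l.
split.
  have k2' : - ((u - h) * (h ^+ 2 + w ^+ 2 - v ^+ 2)) <= h * (2 * ((u - h) * w) * C5).
    by rewrite -k4 -mulrN -mulrN ler_pM2l.
  by rewrite -(ler_pM2l h0); lra.
pose dl := h + v - w.
have dl0 : 0 <= dl by rewrite /dl; lra.
have wE : w = h + v - dl by rewrite /dl; ring.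
have -> : u + v - (u - h + w) = dl by rewrite /dl; ring.
rewrite -(ler_pM2l h0).
(* As [v < l / 2] and [h = l / 13], the sum [h + v] is below [15 / 2 * h]; doubled, this gives the
   constant 15 of the statement. *)
have h1 : u * (h + v) <= l * (15 / 2 * h).
  by apply: ler_pM; rewrite ?addr_ge0 ?(ltW u0) ?(ltW h0) ?(ltW v0)//; lra.
have h2 : dl * (u * (h + v)) <= dl * (l * (15 / 2 * h)) by rewrite ler_wpM2l.
have h3 : 0 <= u * dl ^+ 2 by rewrite mulr_ge0 ?sqr_ge0// ltW.
rewrite wE in k1'.
have -> : h * (u ^+ 2 + v ^+ 2 - 2 * (u * v) * C1) =
  h * (u ^+ 2 + v ^+ 2) - h * (2 * (u * v) * C1) by ring.
apply: (@le_trans _ _ (h * (u ^+ 2 + v ^+ 2) - u * (h ^+ 2 + v ^+ 2 - (h + v - dl) ^+ 2))).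
  by lra.
by lra.
Qed.

(** A counterexample is moved by [hinge_step] repeatedly. The deficit of the squared model side
    against [d p q ^+ 2] never shrinks, and as [d p q] is at most the sum of the sides, each step
    shortens that sum by at least [eta]. Finitely many steps bring it below [2 * l / 3], where
    comparison holds. *)
Lemma hinge_comparisonS l : e < l -> hinge_comparison (2 * l / 3) -> hinge_comparison l.
Proof.
move=> el H x p q a b ox sl ap bq ae be; rewrite leNgt; apply/negP => ctr.
pose S2 x p q a b := d x p ^+ 2 + d x q ^+ 2 - 2 * (d x p * d x q) * cmp_cos x a b.
have l0 : 0 < l by lra.
have [a0 _] := andP ae; have [b0 _] := andP be.
have p0 : 0 < d x p := lt_le_trans a0 (between_le ap).
have q0 : 0 < d x q := lt_le_trans b0 (between_le bq).
have gap : 0 < d p q ^+ 2 - S2 x p q a b.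
  rewrite subr_gt0 /S2 ltNge -cmp_cos_ge// -ltNge//.
pose eta := (d p q ^+ 2 - S2 x p q a b) / (15 * l).
have eta0 : 0 < eta by rewrite divr_gt0// mulr_gt0.
have op : d o p <= Rb - 5 * l by have := dtri o x p; lra.
have oq : d o q <= Rb - 5 * l by have := dtri o x q; lra.
suff key N : forall p q x a b, d o p <= Rb - 5 * l -> d o q <= Rb - 5 * l ->
    d x p + d x q < l -> between x a p -> between x b q ->
    0 < d x a <= e / 20 -> 0 < d x b <= e / 20 ->
    15 * l * eta <= d p q ^+ 2 - S2 x p q a b ->
    d x p + d x q < 2 * l / 3 + N%:R * eta -> False.
  have N0 : 0 <= l / eta by rewrite divr_ge0// ltW.
  apply: (key (Num.bound (l / eta)) p q x a b) => //.
    by rewrite /eta mulrC divfK// gt_eqF// mulr_gt0.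
  have := archi_boundP N0; rewrite ltr_pdivrMr//; lra.
move: {x p q a b ox sl ap bq ae be ctr a0 b0 p0 q0 gap op oq} eta eta0 => eta eta0.
elim: N => [|N ih] p q x a b op oq sl ap bq ae be gap hs.
  have [a0 _] := andP ae; have [b0 _] := andP be.
  have p0 : 0 < d x p := lt_le_trans a0 (between_le ap).
  have q0 : 0 < d x q := lt_le_trans b0 (between_le bq).
  have : cmp_cos x a b <= cmp_cos x p q.
    apply: H => //; last by rewrite mul0r addr0 in hs.
    by have := dtri o p x; rewrite (dsym p x); lra.
  rewrite cmp_cos_ge// -/(S2 x p q a b) => h.
  have leta : 0 < 15 * l * eta by rewrite !mulr_gt0.
  by move: leta gap h; lra.
have [s3|s3] := ltP (d x p + d x q) (2 * l / 3 + N%:R * eta); first exact: (ih p q x a b).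
wlog vu : p q a b op oq sl ap bq ae be gap hs s3 / d x q <= d x p.
  move=> hw; have [vu|/ltW uv] := leP (d x q) (d x p).
    exact: (hw p q a b op oq sl ap bq ae be gap hs s3 vu).
  have sw : d x q + d x p = d x p + d x q by rewrite addrC.
  apply: (hw q p b a) => //; rewrite ?sw//.
  rewrite (dsym q p) /S2 (cmp_cosC x b a) (mulrC (d x q)) (addrC (d x q ^+ 2)).
  exact: gap.
have [a0 _] := andP ae; have [b0 _] := andP be.
have p0 : 0 < d x p := lt_le_trans a0 (between_le ap).
have q0 : 0 < d x q := lt_le_trans b0 (between_le bq).
have leta : 0 < 15 * l * eta by rewrite !mulr_gt0.
have ctr : cmp_cos x p q < cmp_cos x a b.
  by rewrite ltNge cmp_cos_ge// -/(S2 x p q a b) -ltNge; lra.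
have ox : d o x <= Rb - 4 * l by have := dtri o p x; rewrite (dsym p x); lra.
have s23 : 2 * l / 3 <= d x p + d x q.
  by apply: le_trans s3; rewrite lerDl mulr_ge0// ltW.
have [x' [a' [b' [[ap' bq'] ae' be' ss [SS Ss]]]]] :=
  hinge_step el H op ox sl s23 vu ap bq ae be ctr.
rewrite -/(S2 x p q a b) in SS Ss; rewrite -/(S2 x' p q a' b') in SS.
apply: (ih p q x' a' b') => //; [lra|lra|].
have tr : d p q ^+ 2 <= (d x p + d x q) ^+ 2.
  by rewrite ler_pXn2r ?nnegrE ?addr_ge0 ?dge// (dsym x p) dtri.
have : 15 * l * eta <= 15 * l * (d x p + d x q - (d x' p + d x' q)) by lra.
rewrite ler_pM2l ?mulr_gt0// => h.
by rewrite -natr1 in hs; lra.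
Qed.

Lemma hinge_comparison_all l : 0 < l -> hinge_comparison l.
Proof.
(* A bound affine in [N] is enough: [l <= e * (1 + (N + 1) / 2)] implies
   [2 * l / 3 <= e * (1 + N / 2)]. *)
move=> l0; have [N lN] : exists N : nat, l <= e * (1 + N%:R / 2).
  have N0 : 0 <= 2 * l / e by rewrite divr_ge0 ?mulr_ge0// ltW.
  exists (Num.bound (2 * l / e)); have := archi_boundP N0.
  by rewrite ltr_pdivrMr//; move: e0 (Num.bound _) => ? b; lra.
elim: N l l0 lN => [|N ih] l l0 lN.
  by apply: hinge_comparison_local; rewrite l0/=; lra.
have [le|el] := leP l e; first by apply: hinge_comparison_local; rewrite l0.
apply: hinge_comparisonS => //; apply: ih; first lra.
rewrite -natr1 in lN.
have N0 : 0 <= N%:R :> R by exact: ler0n.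
have : 0 <= e * N%:R by rewrite mulr_ge0// ltW.
by lra.
Qed.

End Step.

(** Short initial pieces at [z] of both halves of the segment and of a path to [q] satisfy the local
    comparison, so their adjacent angles sum to at most [pi]; hinge comparison carries this to the
    full sides. *)
Lemma local_semiconcave_global :
  (forall o r, exists2 e, 0 < e & forall c x y z q, d o c <= r -> d c x <= e ->
    d c y <= e -> d c z <= e -> d c q <= e -> between x z y -> stewart_at x y z q) ->
  semiconcave d.
Proof.
move=> loc.
suff st x y z q : between x z y -> stewart_at x y z q.
  move=> x y z q t t01 xz zy; have := dge x y.
  rewrite le_eqVlt => /orP[/eqP xy0|xy0].
    have xz0 : x = z by apply: (dist_eq0 md); rewrite xz -xy0 mulr0.
    have xy1 : x = y by apply: (dist_eq0 md).
    by rewrite -xy1 -xz0 d0; lra.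
  have /st : between x z y by rewrite /between xz zy; ring.
  move=> /(_ q); rewrite /stewart_at xz zy => h.
  by rewrite -(ler_pM2l xy0); lra.
move=> bt; have := dge z x; rewrite le_eqVlt => /orP[/eqP x0|x0].
  have zx : z = x by apply: (dist_eq0 md).
  by rewrite /stewart_at zx d0; lra.
have := dge z y; rewrite le_eqVlt => /orP[/eqP y0|y0].
  have zy : z = y by apply: (dist_eq0 md).
  by rewrite /stewart_at zy d0; lra.
have := dge z q; rewrite le_eqVlt => /orP[/eqP q0|q0].
  have zq : z = q by apply: (dist_eq0 md).
  rewrite /stewart_at -zq d0 -bt (dsym x z); lra.
pose l := d z x + d z y + d z q + 1.
have l0 : 0 < l by rewrite /l !addr_gt0.
(* The radius [6 * l] is the margin that [hinge_comparison] demands of a hinge at the centre. *)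
have [e e0 he] := loc z (6 * l).
have e200 : 0 < e / 20 by lra.
have [a [ba a0 ae]] := tiny_between x0 e200.
have [b [bb b0 be]] := tiny_between y0 e200.
have [c [bc c0 ce]] := tiny_between q0 e200.
have H := hinge_comparison_all e0 he l0.
have h1 : cmp_cos z a c <= cmp_cos z x q.
  by apply: H => //; rewrite ?d0 ?a0 ?c0 /l; lra.
have h2 : cmp_cos z b c <= cmp_cos z y q.
  by apply: H => //; rewrite ?d0 ?b0 ?c0 /l; lra.
apply/stewart_cmp_cos => //.
apply: (@le_trans _ _ (cmp_cos z a c + cmp_cos z b c)); last exact: lerD.
have bt1 : between a z y by apply: (between_mid (x := x)) bt; exact: between_sym.
have bt2 : between a z b.
  by apply: between_sym; apply: (between_mid (x := y)); apply: between_sym.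
apply/stewart_cmp_cos => //; apply: (he z) => //; rewrite ?d0 ?mulr_ge0//; lra.
Qed.

End Globalization.

(** * Spaces with maximal obtuse constant *)

Section ObtuseAlexandrov.
Context {R : realType} (M : metricType R) (U : set_system nat).
Hypothesis UU : UltraFilter U.
Hypothesis Uoo : \oo `<=` U.
Let UP : ProperFilter U. Proof. exact: ultra_proper. Qed.

Lemma alexandrov_quadruple (x : M) : nonneg_curvature M ->
  exists2 r : R, 0 < r & quadruple_condition [set y | mdist x y < r].
Proof.
move=> /(_ x)[V]; rewrite -metricType_numDomainType.filter_from_mdist_nbhs.
by move=> [r /= r0 rV] hV; exists r => // a b c e /= /rV ? /rV ? /rV ? /rV ?; exact: hV.
Qed.

Lemma hausdorff_dim_measure0 (n : nat) (t : R) : hausdorff_dim M = (n%:R)%:E -> n%:R < t ->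
  exists s : R, 0 < s < t /\ hausdorff_measure s [set: M] = 0%E.
Proof.
move=> hn nt; have : (hausdorff_dim M < t%:E)%E by rewrite hn lte_fin.
by move=> /ereal_inf_lt[_ [s /= [s0 Hs] <-]]; rewrite lte_fin => st; exists s; rewrite s0.
Qed.

Lemma alexandrov_geometry (n : nat) : nonneg_alexandrov_space n M ->
  [/\ geodesic (@mdist R M), semiconcave (@mdist R M) & ultracompact U (@mdist R M)].
Proof.
move=> [cM iM curv hd].
have [|s [/andP[s0 _] Hs]] := @hausdorff_dim_measure0 n (n%:R + 1) hd; first by rewrite ltrDl.
have tb x : exists2 r : R, 0 < r & totally_bounded [set y : M | mdist x y < r].
  have [r r0 hr] := alexandrov_quadruple x curv.
  exists (r / 4); first by rewrite divr_gt0.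
  apply: totally_bounded_subset (ball_totally_bounded UU Uoo cM iM s0 Hs r0 hr).
  by move=> y /= /ltW.
have tbb o r : totally_bounded [set x : M | mdist o x <= r].
  exact: (hopf_rinow UU Uoo cM iM).
have uc : ultracompact U (@mdist R M).
  move=> x o C xC; exact: (totally_bounded_ultra UU cM (tbb o C) xC).
have gd := intrinsic_geodesic UU Uoo iM uc; split=> //.
apply: (local_semiconcave_global (mdist_axioms M) gd) => o r.
have [||e e0 he] := @uniform_radius R M U UU Uoo cM (@quadruple_condition R M)
    [set x | mdist o x <= r] _ _ (tbb o r).
- by move=> A B AB hB a b c f /AB ? /AB ? /AB ? /AB ?; exact: hB.
- by move=> x; exact: alexandrov_quadruple.
exists e => // c x y z q oc cx cy cz cq bt.
exact: (quadruple_semiconcave UU (he c oc)).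
Qed.

(** Walk from [p] a distance [s] towards the far point [x n]: the triangle inequality keeps the new
    point at distance almost [mdist q p + s] from [q], and the limit point gives equality. *)
Lemma extends_beyond_limit (p q : M) : geodesic (@mdist R M) ->
  ultracompact U (@mdist R M) ->
  (forall n : nat, exists x, n%:R < mdist p x /\
     mdist q p - 1 / n.+1%:R <= mdist q x - mdist p x) ->
  extends_beyond (@mdist R M) q p.
Proof.
move=> gd uc /choice[x hx] s s0; have md := mdist_axioms M.
pose sn n := Num.min s (mdist p (x n)).
have sncvg : sn n @[n --> U] --> s.
  apply/cvgrPdist_le => e e0; apply: Uoo; near=> n.
  have -> : sn n = s.
    apply/min_idPl; have [h _] := hx n; apply: ltW; apply: le_lt_trans h.
    by near: n; exact: nbhs_infty_ger.
  by rewrite subrr normr0 ltW.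
have /choice[u hu] (n : nat) : exists u, mdist p u = sn n /\
    mdist u (x n) = mdist p (x n) - sn n.
  have [|u h1 h2] := @point_at_dist R M (@mdist R M) md gd p (x n) (sn n).
    by rewrite /sn le_min s0 mdist_ge0// ge_min lexx orbT.
  by exists u.
have [y uy] := uc u p s ltac:(by move=> n; have [-> _] := hu n; rewrite ge_min lexx).
have up : mdist (u n) p @[n --> U] --> mdist y p by exact: ultra_dist.
have uq : mdist (u n) q @[n --> U] --> mdist y q by exact: ultra_dist.
have py : mdist p y = s.
  rewrite metric_sym; apply: (ultra_unique UU up).
  by under eq_fun do [rewrite metric_sym (hu _).1].
exists y => //; apply/eqP; rewrite eq_le; apply/andP; split.
  by have := metric_triangle q p y; rewrite py.
have low : mdist q p - 1 / n.+1%:R + sn n @[n --> U] --> mdist q p - 0 + s.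
  by apply: cvgD => //; apply: cvgB; [exact: cvg_cst|exact: ultra_invn].
rewrite subr0 in low; rewrite (metric_sym q y); apply: (ultra_le UU low uq) => n.
have [h1 h2] := hu n; have [_ h3] := hx n.
have := metric_triangle q (u n) (x n); rewrite h2 (metric_sym q (u n)).
by move: (1 / _) h3 => a; lra.
Unshelve. all: end_near. Qed.

(** In the law of cosines the error is linear in [mdist p x]; taking roots removes this factor, so
    the loss stays small as [x] goes to infinity. *)
Lemma wide_angle_excess (p q x : M) (de : R) : p != q -> x != p -> 0 <= de ->
  triangle_cos p x q <= -1 + de -> mdist q p - 2 * mdist q p * de <= mdist q x - mdist p x.
Proof.
rewrite -!mdist_gt0 (metric_sym p q) => qp xp de0; rewrite /triangle_cos.
rewrite (metric_sym q x) (metric_sym p x) (metric_sym p q).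
have := mdist_ge0 x q; move: (mdist x p) (mdist q p) (mdist x q) xp qp => a D b a0 D0 b0.
rewrite ler_pdivrMr ?mulr_gt0// => h.
have h1 : (a + D) ^+ 2 - 2 * a * D * de <= b ^+ 2 by lra.
rewrite lerBrDr; have [neg|pos] := leP (D - 2 * D * de + a) 0; first exact: le_trans b0.
rewrite -(@ler_pXn2r _ 2) ?nnegrE ?(ltW pos)//; apply: le_trans h1.
have Dd : 0 <= D * de by rewrite mulr_ge0// ltW.
have : D * de * (2 * D * de) <= D * de * (D + a).
  by rewrite ler_wpM2l//; lra.
have : 0 <= D * de * (a + D) by rewrite mulr_ge0// addr_ge0// ltW.
have : 0 <= D * de * D by rewrite mulr_ge0// ltW.
by nra.
Qed.

Lemma obtuse_far_points (p q : M) (r th : R) : p <> q ->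
  comparison_obtuse_constant M = (pi / 2)%:E -> th < pi ->
  exists2 x, r < mdist p x & th < Num.max (comparison_angle x p q) (comparison_angle x q p).
Proof.
move=> pq hob thp.
have : ((pi / 2)%:E <= comparison_obtuse_pair p q)%E.
  by rewrite -hob; apply: ereal_inf_lbound; exists (p, q).
rewrite /comparison_obtuse_pair leeBrDr// -EFinD -splitr => h.
have : (pi%:E <= ereal_sup [set (Num.max (comparison_angle x p q)
    (comparison_angle x q p))%:E | x in ~` [set x | (mdist p x <= r)%R]])%E.
  apply: le_trans h _; apply: ereal_inf_lbound; exists (~` [set x | mdist p x <= r]) => //.
  by exists [set x | mdist p x <= r] => //; exists p, r.
have thE : (th%:E < pi%:E)%E by rewrite lte_fin.
move=> /(lt_le_trans thE)/ereal_sup_gt[_ [x /= xr <-]]; rewrite lte_fin => hx.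
by exists x => //; rewrite ltNge; apply/negP.
Qed.

Lemma obtuse_extendable : geodesic (@mdist R M) -> ultracompact U (@mdist R M) ->
  comparison_obtuse_constant M = (pi / 2)%:E -> extendable (@mdist R M).
Proof.
move=> gd uc hob p q pq.
have D0 : 0 < mdist p q by rewrite mdist_gt0; exact/eqP.
pose good p q (n : nat) (x : M) := n%:R < mdist p x /\
  mdist q p - 1 / n.+1%:R <= mdist q x - mdist p x.
have inv_le (m n : nat) : (m <= n)%N -> (1 : R) / n.+1%:R <= 1 / m.+1%:R.
  by move=> mn; rewrite !div1r lef_pV2 ?posrE ?ltr0n// ler_nat.
have good_le p' q' m n x : (m <= n)%N -> good p' q' n x -> good p' q' m x.
  move=> mn [h1 h2]; split; first by apply: le_lt_trans h1; rewrite ler_nat.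
  by apply: le_trans h2; rewrite lerD2l lerN2 inv_le.
have key (n : nat) : exists x, good p q n x \/ good q p n x.
  (* Makes the loss [2 * mdist p q * de] at most [1 / n.+1%:R]; the cap at 1 keeps [-1 + de] in the
     domain of [acos]. *)
  pose de : R := Num.min 1 (1 / (2 * mdist p q * n.+1%:R)).
  have P0 : 0 < 2 * mdist p q * n.+1%:R by rewrite !mulr_gt0.
  have de0 : 0 < de by rewrite lt_min ltr01 divr_gt0.
  have de1 : de <= 1 by rewrite ge_min lexx.
  have den : 2 * mdist p q * de <= 1 / n.+1%:R.
    rewrite ler_pdivlMr ?ltr0n// mulrAC mulrC -ler_pdivlMr//.
    by rewrite ge_min lexx orbT.
  have dI : -1 <= -1 + de <= 1 by rewrite lerDl (ltW de0)/=; lra.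
  have thp : acos (-1 + de) < pi.
    rewrite lt_neqAle acos_lepi// andbT; apply/eqP => e.
    have := acosK (_ : -1 + de \in `[-1, 1]); rewrite in_itv/= e cospi => /(_ dI); lra.
  (* The extra [mdist p q] makes [x] far from [q] as well, whichever of the two angles is wide. *)
  have [x xr hx] := obtuse_far_points (n%:R + mdist p q) pq hob thp.
  have n0 : 0 <= n%:R :> R by exact: ler0n.
  have xp : n%:R < mdist p x by lra.
  have xq : n%:R < mdist q x.
    by have := metric_triangle p q x; move: xr D0; lra.
  have xp' : x != p by rewrite -mdist_gt0 metric_sym; exact: le_lt_trans xp.
  have xq' : x != q by rewrite -mdist_gt0 metric_sym; exact: le_lt_trans xq.
  have pq' : p != q by exact/eqP.
  have acos_cos p' q' : x != p' -> p' != q' -> acos (-1 + de) < comparison_angle x p' q' ->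
      triangle_cos p' x q' <= -1 + de.
    move=> h1 h2; rewrite -[comparison_angle _ _ _]/(acos (triangle_cos p' x q')) => h.
    have b : -1 <= triangle_cos p' x q' <= 1 by rewrite triangle_cos_bound// eq_sym.
    rewrite -[leLHS](@acosK R) ?in_itv// -[leRHS](@acosK R) ?in_itv//.
    by rewrite le_cos ?acos_ge0 ?acos_lepi// ltW.
  exists x; move: hx; rewrite lt_max => /orP[] h; [left|right]; split => //.
    have := wide_angle_excess pq' xp' (ltW de0) (acos_cos _ _ xp' pq' h).
    rewrite (metric_sym q p); apply: le_trans; rewrite lerD2l lerN2; exact: den.
  rewrite eq_sym in pq'.
  have := wide_angle_excess pq' xq' (ltW de0) (acos_cos _ _ xq' pq' h).
  by apply: le_trans; rewrite lerD2l lerN2; exact: den.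
(* The end that is extended may change with [n]; since goodness at [n] implies goodness at smaller
   indices, one end works for all [n]. *)
have [hp|/existsNP[n0 hn0]] := pselect (forall n, exists x, good p q n x).
  by right; apply: extends_beyond_limit.
left; apply: extends_beyond_limit => // n.
have [x [gp|gq]] := key (maxn n n0).
  by exfalso; apply: hn0; exists x; apply: good_le gp; exact: leq_maxr.
by exists x; apply: good_le gq; exact: leq_maxl.
Qed.

Lemma obtuse_alexandrov_ob_space (n : nat) : nonneg_alexandrov_space n M ->
  comparison_obtuse_constant M = (pi / 2)%:E -> ob_space U (@mdist R M).
Proof.
move=> hM hob; have [gd sc uc] := alexandrov_geometry hM.
split=> //; [exact: mdist_axioms|exact: obtuse_extendable].
Qed.

End ObtuseAlexandrov.

(** * Matching the dimension with the flat models *)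

Section Dimension.
Context {R : realType} (M : metricType R) (n : nat).
Hypothesis hM : nonneg_alexandrov_space n M.

Lemma euclidean_distDl (k : nat) (u v w : 'rV[R]_k) :
  euclidean_dist (u + v) (u + w) = euclidean_dist v w.
Proof.
rewrite /euclidean_dist; congr Num.sqrt; apply: eq_bigr => i _.
by rewrite !mxE; congr (_ ^+ 2); ring.
Qed.

Lemma orthants_le_dim (k : nat) (p0 : M) :
  (forall p : M, exists phi : 'rV[R]_k -> M, phi 0 = p /\
    forall v w : 'rV[R]_k, (forall i, 0 <= v 0 i) -> (forall i, 0 <= w 0 i) ->
      mdist (phi v) (phi w) = euclidean_dist v w) -> (k <= n)%N.
Proof.
move=> hphi; rewrite leqNgt; apply/negP => nk; have [cM _ _ hd] := hM.
have [|s [sk Hs]] := @hausdorff_dim_measure0 R M n k%:R hd; first by rewrite ltr_nat.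
exact: (hausdorff_measure_orthants cM p0 sk hphi).
Qed.

Lemma dim_le_euclidean (k : nat) (F : M -> 'rV[R]_k) :
  (forall x y, euclidean_dist (F x) (F y) = mdist x y) -> (n <= k)%N.
Proof.
move=> hF; rewrite leqNgt; apply/negP => kn; have [_ _ _ hd] := hM.
have n1 : k%:R + 1 <= n%:R :> R by rewrite natr1 ler_nat.
have k0 : 0 <= k%:R :> R by exact: ler0n.
have : (hausdorff_dim M <= (k%:R + 1 / 2 : R)%:E)%E.
  apply: ereal_inf_lbound; exists (k%:R + 1 / 2) => //; split; first lra.
  by apply: hausdorff_measure_euclidean hF _ _; lra.
by rewrite hd lee_fin leNgt => /negP; apply; lra.
Qed.

(** Orthants at every point show that the dimension of the model is at most [n], and the embedding
    in Euclidean space shows the converse. *)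
Lemma obtuse_alexandrov_flat : comparison_obtuse_constant M = (pi / 2)%:E -> M ->
  isometric_to_euclidean M n \/
  exists k, n = k.+1 /\ exists f : M -> 'rV[R]_k.+1,
    [/\ forall x y, euclidean_dist (f x) (f y) = mdist x y,
        forall x, 0 <= f x 0 ord0 &
        forall v : 'rV[R]_k.+1, 0 <= v 0 ord0 -> exists x, f x = v].
Proof.
move=> hob x0; have [V [VU Voo]] := ultraFilterLemma (@eventually_filter).
have ob := obtuse_alexandrov_ob_space VU Voo hM hob.
have [|k [[f bf hf]|[f [hf f0 fs]]]] :=
    ob_space_classification VU Voo ob (n := n) _ (inhabits x0).
- move=> k N dN Phi oN [hP sP]; apply: (orthants_le_dim x0) => p.
  have [[v0 y] <-] := sP p; exists (fun v => Phi (v0 + v, y)); rewrite addr0; split=> // v w _ _.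
  apply/eqP; rewrite -(@eqrXn2 _ 2) ?mdist_ge0 ?sqrtr_ge0//; apply/eqP.
  by rewrite hP/= euclidean_distDl (dist_refl (ob_metric oN)) expr0n addr0.
- have kn : (k <= n)%N.
    apply: (orthants_le_dim x0) => p; have [g fK gK] := bf.
    exists (fun v => g (f p + v)); rewrite addr0 fK; split=> // v w _ _.
    by rewrite -hf !gK euclidean_distDl.
  have nk := dim_le_euclidean hf.
  have e : k = n by apply/eqP; rewrite eqn_leq kn.
  by left; move: f bf hf; rewrite e => f bf hf; exists f.
- have kn : (k.+1 <= n)%N.
    apply: (orthants_le_dim x0) => p.
    have /choice[g hg] (v : 'rV[R]_k.+1) : exists x, (forall i, 0 <= v 0 i) -> f x = f p + v.
      have [h|] := pselect (forall i, 0 <= v 0 i); last by exists p.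
      have [|x hx] := fs (f p + v); first by rewrite mxE addr_ge0.
      by exists x.
    have dist0 x y : f x = f y -> x = y.
      move=> e; apply: mdist_positivity; rewrite -hf e /euclidean_dist.
      by rewrite big1 ?sqrtr0// => i _; rewrite subrr expr0n.
    exists g; split=> [|v w hv hw]; last by rewrite -hf !hg// euclidean_distDl.
    by apply: dist0; rewrite hg ?addr0// => i; rewrite mxE.
  have nk := dim_le_euclidean hf.
  by right; exists k; split; [apply/eqP; rewrite eqn_leq nk|exists f].
Qed.

End Dimension.

(** * The boundary of a half space *)

Section DotProduct.
Context {R : realType} (k : nat).
Implicit Types u v w : 'rV[R]_k.

Lemma euclidean_dotC u v : euclidean_dot u v = euclidean_dot v u.
Proof. by apply: eq_bigr => i _; rewrite mulrC. Qed.

Lemma euclidean_dotDl u v w : euclidean_dot (u + v) w = euclidean_dot u w + euclidean_dot v w.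
Proof. by rewrite /euclidean_dot -big_split; apply: eq_bigr => i _; rewrite mxE mulrDl. Qed.

Lemma euclidean_dotZl (a : R) u v : euclidean_dot (a *: u) v = a * euclidean_dot u v.
Proof. by rewrite /euclidean_dot mulr_sumr; apply: eq_bigr => i _; rewrite mxE mulrA. Qed.

Lemma euclidean_dotNl u v : euclidean_dot (- u) v = - euclidean_dot u v.
Proof. by rewrite -scaleN1r euclidean_dotZl mulN1r. Qed.

Lemma euclidean_dotDr u v w : euclidean_dot w (u + v) = euclidean_dot w u + euclidean_dot w v.
Proof. by rewrite euclidean_dotC euclidean_dotDl !(euclidean_dotC w). Qed.

Lemma euclidean_dotZr (a : R) u v : euclidean_dot u (a *: v) = a * euclidean_dot u v.
Proof. by rewrite euclidean_dotC euclidean_dotZl euclidean_dotC. Qed.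

Lemma euclidean_dotNr u v : euclidean_dot u (- v) = - euclidean_dot u v.
Proof. by rewrite euclidean_dotC euclidean_dotNl euclidean_dotC. Qed.

Definition euclidean_dotE := (euclidean_dotDl, euclidean_dotDr, euclidean_dotNl,
  euclidean_dotNr, euclidean_dotZl, euclidean_dotZr).

Lemma euclidean_dot_ge0 u : 0 <= euclidean_dot u u.
Proof. by apply: sumr_ge0 => i _; rewrite -expr2 sqr_ge0. Qed.

Lemma euclidean_dot_eq0 u : euclidean_dot u u = 0 -> u = 0.
Proof.
move/eqP; rewrite psumr_eq0 => [/allP h|i _]; last by rewrite -expr2 sqr_ge0.
apply/rowP => i; rewrite mxE; apply/eqP; rewrite -sqrf_eq0 expr2.
exact: h (mem_index_enum i).
Qed.

Lemma sqr_euclidean_distE u v :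
  euclidean_dist u v ^+ 2 = euclidean_dot u u + euclidean_dot v v - 2 * euclidean_dot u v.
Proof.
rewrite sqr_euclidean_dist.
transitivity (euclidean_dot (u - v) (u - v)).
  by apply: eq_bigr => i _; rewrite !mxE expr2.
by rewrite !euclidean_dotE (euclidean_dotC v u); ring.
Qed.

Lemma euclidean_dot_unit_eq u v : euclidean_dot u u = 1 -> euclidean_dot v v = 1 ->
  euclidean_dot u v = 1 -> u = v.
Proof.
move=> u1 v1 uv; apply/eqP; rewrite -subr_eq0; apply/eqP/euclidean_dot_eq0.
by rewrite !euclidean_dotE (euclidean_dotC v u) u1 v1 uv; ring.
Qed.

Lemma euclidean_dot_unit_bound u v : euclidean_dot u u = 1 -> euclidean_dot v v = 1 ->
  -1 <= euclidean_dot u v <= 1.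
Proof.
move=> u1 v1; have := euclidean_dot_ge0 (u - v); have := euclidean_dot_ge0 (u + v).
by rewrite !euclidean_dotE (euclidean_dotC v u) u1 v1 => *; apply/andP; split; lra.
Qed.

Lemma euclidean_dot_geN u v (a b : R) : 0 <= a -> 0 <= b ->
  euclidean_dot u u = a ^+ 2 -> euclidean_dot v v = b ^+ 2 -> - (a * b) <= euclidean_dot u v.
Proof.
move=> a0 b0 ua vb; have := euclidean_dot_ge0 (b *: u + a *: v).
rewrite !euclidean_dotE (euclidean_dotC v u) ua vb => h.
have z0 w : euclidean_dot 0 w = 0 by rewrite -(scale0r 0) euclidean_dotZl mul0r.
move: a0; rewrite le_eqVlt => /orP[/eqP a0|a0].
  rewrite -a0 expr0n in ua; rewrite (euclidean_dot_eq0 ua) z0 -a0.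
  by rewrite mul0r oppr0.
move: b0; rewrite le_eqVlt => /orP[/eqP b0|b0].
  rewrite -b0 expr0n in vb; rewrite (euclidean_dot_eq0 vb) euclidean_dotC z0 -b0.
  by rewrite mulr0 oppr0.
have ab : 0 < a * b by rewrite mulr_gt0.
by rewrite -(ler_pM2l ab); lra.
Qed.

(** The components of [u] and [w] orthogonal to [v] have the sines of the two angles as lengths;
    Cauchy-Schwarz for them bounds [euclidean_dot u w] below by the cosine of the angle sum. *)
Lemma acos_dot_triangle u v w : euclidean_dot u u = 1 -> euclidean_dot v v = 1 ->
  euclidean_dot w w = 1 ->
  acos (euclidean_dot u w) <= acos (euclidean_dot u v) + acos (euclidean_dot v w).
Proof.
move=> u1 v1 w1.
have uv := euclidean_dot_unit_bound u1 v1; have vw := euclidean_dot_unit_bound v1 w1.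
have uw := euclidean_dot_unit_bound u1 w1.
set al := acos (euclidean_dot u v); set be := acos (euclidean_dot v w).
have [big|small] := leP pi (al + be); first by apply: le_trans big; exact: acos_lepi.
have cal : cos al = euclidean_dot u v by rewrite acosK.
have cbe : cos be = euclidean_dot v w by rewrite acosK.
have al0 : 0 <= al by exact: acos_ge0.
have be0 : 0 <= be by exact: acos_ge0.
have sal : 0 <= sin al by rewrite sin_ge0_pi// al0 acos_lepi.
have sbe : 0 <= sin be by rewrite sin_ge0_pi// be0 acos_lepi.
have h : - (sin al * sin be) <=
    euclidean_dot (u - euclidean_dot u v *: v) (w - euclidean_dot v w *: v).
  apply: euclidean_dot_geN => //.
    by rewrite sin2cos2 cal !euclidean_dotE (euclidean_dotC v u) u1 v1; ring.
  by rewrite sin2cos2 cbe !euclidean_dotE (euclidean_dotC w v) w1 v1; ring.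
have hc : cos (al + be) <= euclidean_dot u w.
  rewrite cosD cal cbe; move: h; rewrite !euclidean_dotE v1 (euclidean_dotC v w); lra.
rewrite -le_cos ?acosK ?in_itv//= ?addr_ge0 ?(ltW small)//.
by rewrite acos_ge0 ?acos_lepi.
Qed.

End DotProduct.

(** * Hemispheres with the angle metric *)

Section Hemisphere.
Context {R : realType} (k : nat).

(** Half of the unit sphere of dimension [k], with height the coordinate [ord0]; [hemisphere R 0] is
    a single point. *)
Definition hemisphere := {v : 'rV[R]_k.+1 | (euclidean_dot v v == 1) && (0 <= v 0 ord0)}.

HB.instance Definition _ := Choice.on hemisphere.

Implicit Types u v w : hemisphere.

Lemma hemisphere_unit u : euclidean_dot (val u) (val u) = 1.
Proof. by case/andP: (valP u) => /eqP. Qed.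

Lemma hemisphere_ge0 u : 0 <= val u 0 ord0.
Proof. by case/andP: (valP u). Qed.

Lemma hemisphere_bound u v : -1 <= euclidean_dot (val u) (val v) <= 1.
Proof. exact: euclidean_dot_unit_bound (hemisphere_unit u) (hemisphere_unit v). Qed.

Definition hemisphere_dist u v : R := acos (euclidean_dot (val u) (val v)).

Lemma cos_hemisphere_dist u v : cos (hemisphere_dist u v) = euclidean_dot (val u) (val v).
Proof. by rewrite acosK ?in_itv//; exact: hemisphere_bound. Qed.

Let dist_refl u : hemisphere_dist u u = 0.
Proof. by rewrite /hemisphere_dist hemisphere_unit acos1. Qed.

Let dist_eq0 u v : hemisphere_dist u v = 0 -> u = v.
Proof.
move=> h; apply: val_inj; apply: euclidean_dot_unit_eq; rewrite ?hemisphere_unit//.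
by rewrite -cos_hemisphere_dist h cos0.
Qed.

Let dist_sym u v : hemisphere_dist u v = hemisphere_dist v u.
Proof. by rewrite /hemisphere_dist euclidean_dotC. Qed.

Let dist_tri v u w : hemisphere_dist u w <= hemisphere_dist u v + hemisphere_dist v w.
Proof. by apply: acos_dot_triangle; exact: hemisphere_unit. Qed.

HB.instance Definition _ := isMetric.Build R hemisphere dist_refl dist_eq0 dist_sym dist_tri.

Lemma cos_mdist_hemisphere u v : cos (mdist u v) = euclidean_dot (val u) (val v).
Proof. exact: cos_hemisphere_dist. Qed.

Lemma mdist_hemisphere_le_pi u v : mdist u v <= pi.
Proof. exact: acos_lepi (hemisphere_bound u v). Qed.

End Hemisphere.
Arguments hemisphere : clear implicits.

Section TrigonometricLimits.
Context {R : realType}.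

Lemma sin_bounds (x : R) : 0 <= x <= pi -> x * cos x <= sin x <= x.
Proof.
move=> /andP[]; rewrite le_eqVlt => /orP[/eqP <- _|x0 xpi].
  by rewrite sin0 mul0r lexx.
have [|c] := @MVT R sin cos 0 x x0 (fun y _ => is_derive_sin y).
  by apply: continuous_subspaceT => y; exact: continuous_sin.
rewrite in_itv/= sin0 !subr0 => /andP[c0 cx] ->.
rewrite mulrC ler_pM2r// le_cos ?(ltW cx)//=.
- by rewrite -[leRHS]mul1r ler_pM2r ?cos_le1.
- by rewrite (ltW x0).
- by rewrite (ltW c0) (le_trans (ltW cx)).
Qed.

Lemma acos_close (a e : R) : -1 <= a <= 1 -> 0 < e ->
  exists2 de : R, 0 < de & forall x, -1 <= x <= 1 -> `|x - a| < de ->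
    `|acos x - acos a| < e.
Proof.
move=> a1 e0; set th := acos a.
have th0 : 0 <= th by exact: acos_ge0.
have thpi : th <= pi by exact: acos_lepi.
have cth : cos th = a by rewrite acosK.
(* When [th + e] or [th - e] leaves [[0, pi]], nothing has to be excluded on that side and 1 is a
   placeholder. *)
pose up : R := if th + e <= pi then a - cos (th + e) else 1.
pose dn : R := if 0 <= th - e then cos (th - e) - a else 1.
have up0 : 0 < up.
  rewrite /up; case: ifP => // h; rewrite subr_gt0 -cth ltr_cos ?in_itv/= ?th0 ?thpi//; first lra.
  by rewrite h andbT; lra.
have dn0 : 0 < dn.
  rewrite /dn; case: ifP => // h; rewrite subr_gt0 -cth ltr_cos ?in_itv/= ?th0 ?thpi//; first lra.
  by rewrite h/=; lra.
exists (Num.min up dn); first by rewrite lt_min up0.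
move=> x x1; rewrite lt_min => /andP[xu xd].
have ax0 := acos_ge0 x1; have axpi := acos_lepi x1.
have cx : cos (acos x) = x by rewrite acosK.
rewrite ltr_norml; apply/andP; split; rewrite ltNge; apply/negP => h.
  have h1 : 0 <= th - e by lra.
  have : cos (th - e) <= x by rewrite -cx le_cos ?ax0 ?h1//; lra.
  by move: xd; rewrite /dn h1 ltr_norml; lra.
have h1 : th + e <= pi by lra.
have : x <= cos (th + e) by rewrite -cx le_cos ?ax0 ?h1 ?andbT//; lra.
by move: xu; rewrite /up h1 ltr_norml; lra.
Qed.

(* With X, Y the half sum and half difference of b and |s - t|, both
   2 sin X sin Y and (1 - la) sin s sin t equal cos |s - t| - cos b. *)
Lemma spherical_comparison_limit (la e : R) : -1 <= la <= 1 -> 0 < e ->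
  exists2 rho : R, 0 < rho & forall s t b : R, 0 < s < rho -> 0 < t < rho ->
    0 <= b <= s + t -> cos b = cos s * cos t + la * (sin s * sin t) ->
    `|(s ^+ 2 + t ^+ 2 - b ^+ 2) / (2 * (s * t)) - la| < e.
Proof.
move=> /andP[la1 la2] e0; pose kap : R := (1 + e / 4)^-1.
have e4 : 0 < 1 + e / 4 by lra.
have kap0 : 0 < kap by rewrite invr_gt0.
have kap1 : kap < 1 by rewrite invf_lt1//; lra.
have kapE : kap * (1 + e / 4) = 1 by rewrite mulVf ?gt_eqF.
have [rho rho0 [rhopi hrho]] : exists2 rho : R, 0 < rho & 2 * rho <= pi / 2 /\
    forall x : R, 0 <= x <= 2 * rho -> kap <= cos x ^+ 2 /\ 0 < cos x.
  have /cvgr_gt/(_ kap) : cos x ^+ 2 @[x --> (0 : R)] --> (cos 0 : R) ^+ 2.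
    by under eq_fun do rewrite expr2; rewrite expr2; apply: cvgM; exact: continuous_cos.
  rewrite cos0 expr1n => /(_ kap1)[de /= de0 hde].
  pose rho : R := Num.min (de / 4) (pi / 8).
  have rho0 : 0 < rho by rewrite lt_min !divr_gt0 ?pi_gt0.
  have r1 : rho <= de / 4 by rewrite ge_min lexx.
  have r2 : rho <= pi / 8 by rewrite ge_min lexx orbT.
  have pi0 := pi_gt0 R.
  exists rho => //; split=> [|x /andP[x0 xr]]; first lra.
  split; last by rewrite cos_gt0_pihalf//; lra.
  by apply/ltW/hde; rewrite /ball_/= sub0r normrN ger0_norm//; lra.
exists rho => // s t b /andP[s0 sr] /andP[t0 tr] /andP[b0 bst] hb.
have pi0 := pi_gt0 R.
have sb (x : R) : 0 <= x <= 2 * rho -> [/\ x * cos x <= sin x, sin x <= x & 0 <= sin x].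
  move=> x2; have xpi : 0 <= x <= pi by lra.
  have /andP[h1 h2] := sin_bounds xpi; split=> //; by rewrite sin_ge0_pi.
pose a := `|s - t|.
have a2 : a ^+ 2 = s ^+ 2 + t ^+ 2 - 2 * (s * t) by rewrite real_normK ?num_real//; ring.
have ca : cos a = cos s * cos t + sin s * sin t by rewrite cos_norm cosB.
have a0 : 0 <= a by exact: normr_ge0.
have ast : a <= s + t by rewrite ler_norml; lra.
have [s1 s2 s3] := sb s ltac:(lra); have [t1 t2 t3] := sb t ltac:(lra).
have sst : 0 <= sin s * sin t by rewrite mulr_ge0.
have ab : a <= b.
  rewrite -le_cos ?ca ?hb; [|lra|lra].
  by rewrite lerD2l -[leRHS]mul1r ler_wpM2r.
pose X := (a + b) / 2; pose Y := (b - a) / 2.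
have X2 : 0 <= X <= 2 * rho by rewrite /X; lra.
have Y2 : 0 <= Y <= 2 * rho by rewrite /Y; lra.
have [X1 X1' X1''] := sb X X2; have [Y1 Y1' Y1''] := sb Y Y2.
have prod : 2 * (sin X * sin Y) = (1 - la) * (sin s * sin t).
  have -> : (1 - la) * (sin s * sin t) = cos a - cos b by rewrite ca hb; ring.
  have -> : a = X - Y by rewrite /X /Y; field.
  have -> : b = X + Y by rewrite /X /Y; field.
  by rewrite cosB cosD; ring.
have XY : b ^+ 2 - a ^+ 2 = 4 * (X * Y) by rewrite /X /Y; field.
have [c2X cX] := hrho X X2; have [c2Y cY] := hrho Y Y2.
have [c2s cs] := hrho s ltac:(lra); have [c2t ct] := hrho t ltac:(lra).
have X0 : 0 <= X by case/andP: X2.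
have Y0 : 0 <= Y by case/andP: Y2.
have kmul (x y u v : R) : 0 <= u -> 0 <= v -> kap <= u ^+ 2 -> kap <= v ^+ 2 ->
    kap <= u * v.
  move=> u0 v0 h1 h2; rewrite -(@ler_pXn2r _ 2) ?nnegrE ?mulr_ge0 ?(ltW kap0)//.
  by rewrite exprMn expr2; apply: ler_pM => //; exact: ltW.
have low (x y : R) : 0 <= x -> 0 <= y -> kap <= cos x ^+ 2 -> kap <= cos y ^+ 2 ->
    0 < cos x -> 0 < cos y -> x * cos x <= sin x -> y * cos y <= sin y ->
    kap * (x * y) <= sin x * sin y.
  move=> x0 y0 kx ky c1 c2 h1 h2.
  have kxy := kmul x y _ _ (ltW c1) (ltW c2) kx ky.
  apply: (@le_trans _ _ ((x * cos x) * (y * cos y))).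
    have -> : x * cos x * (y * cos y) = cos x * cos y * (x * y) by ring.
    by rewrite ler_wpM2r// mulr_ge0.
  by apply: ler_pM => //; rewrite mulr_ge0// ltW.
have lXY := low X Y X0 Y0 c2X c2Y cX cY X1 Y1.
have lst := low s t (ltW s0) (ltW t0) c2s c2t cs ct s1 t1.
have uXY : sin X * sin Y <= X * Y by apply: ler_pM.
have ust : sin s * sin t <= s * t by apply: ler_pM.
have st0 : 0 < s * t by rewrite mulr_gt0.
have la0 : 0 <= 1 - la by lra.
(* By [prod], replacing each sine by its argument shows that [2 * (X * Y)] and [(1 - la) * (s * t)]
   agree up to the factor [kap]. *)
have m1 : kap * (2 * (X * Y)) <= (1 - la) * (s * t).
  have := ler_wpM2l la0 ust; rewrite -prod; lra.
have m2 : kap * ((1 - la) * (s * t)) <= 2 * (X * Y).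
  by have := ler_wpM2l la0 lst; rewrite -prod; lra.
have -> : s ^+ 2 + t ^+ 2 - b ^+ 2 = 2 * (s * t) - 4 * (X * Y).
  by rewrite -XY a2; ring.
set z := X * Y in m1 m2 *; set p := s * t in st0 m1 m2 *.
have -> : (2 * p - 4 * z) / (2 * p) - la = ((1 - la) * p - 2 * z) / p.
  by field; rewrite gt_eqF.
rewrite normrM normfV (gtr0_norm st0) ltr_pdivrMr//.
have lp : (1 - la) * p <= 2 * p by rewrite ler_pM2r//; lra.
have lp0 : 0 <= (1 - la) * p by rewrite mulr_ge0// ltW.
have ep : 0 < e * p by rewrite mulr_gt0.
have m1' : 2 * z <= (1 + e / 4) * ((1 - la) * p).
  have h := ler_wpM2l (ltW e4) m1; apply: le_trans h.
  have -> : (1 + e / 4) * (kap * (2 * z)) = kap * (1 + e / 4) * (2 * z) by ring.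
  by rewrite kapE mul1r.
have m2' : (1 - la) * p <= (1 + e / 4) * (2 * z).
  have h := ler_wpM2l (ltW e4) m2; apply: le_trans h.
  have -> : (1 + e / 4) * (kap * ((1 - la) * p)) = kap * (1 + e / 4) * ((1 - la) * p) by ring.
  by rewrite kapE mul1r.
have k3 : e * ((1 - la) * p) <= e * (2 * p) by rewrite ler_pM2l.
have k4 : kap * (e / 4 * (2 * z)) <= e / 4 * (2 * p).
  have -> : kap * (e / 4 * (2 * z)) = e / 4 * (kap * (2 * z)) by ring.
  by rewrite ler_pM2l ?(le_trans m1)//; lra.
have k5 : (1 - kap) * ((1 - la) * p) <= e / 4 * (2 * p).
  have kk : 1 - kap <= e / 4.
    have : 0 < kap * e by rewrite mulr_gt0.
    have : kap * e <= 1 * e by rewrite ler_pM2r// ltW.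
    by lra.
  by apply: ler_pM => //; lra.
by rewrite ltr_norml; apply/andP; split; lra.
Qed.

End TrigonometricLimits.

Section HemisphereComplete.
Context {R : realType} (k : nat).

(** A coordinate difference is at most the chord, and the chord at most the arc; so Cauchy filters
    are Cauchy in each coordinate. *)
Lemma hemisphere_coord_le (u v : hemisphere R k) i : `|val u 0 i - val v 0 i| <= mdist u v.
Proof.
have uv0 := mdist_ge0 u v.
have h1 : (val u 0 i - val v 0 i) ^+ 2 <= 2 - 2 * cos (mdist u v).
  have -> : 2 - 2 * cos (mdist u v) = euclidean_dist (val u) (val v) ^+ 2.
    by rewrite sqr_euclidean_distE !hemisphere_unit cos_mdist_hemisphere; ring.
  by rewrite sqr_euclidean_dist (bigD1 i)//= lerDl sumr_ge0// => j _; exact: sqr_ge0.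
rewrite -(@ler_pXn2r _ 2) ?nnegrE// real_normK ?num_real//; apply: le_trans h1 _.
have pi0 := pi_gt0 R; have dpi := mdist_hemisphere_le_pi u v.
set x := mdist u v in uv0 dpi *.
have /andP[_ sx] := @sin_bounds R (x / 2) ltac:(lra).
have sx0 : 0 <= sin (x / 2) by rewrite sin_ge0_pi//; lra.
have -> : cos x = 1 - 2 * sin (x / 2) ^+ 2.
  have e2 : cos x = cos (x / 2 + x / 2) by congr cos; field.
  by rewrite e2 cosD; have := cos2Dsin2 (x / 2 : R); lra.
have : sin (x / 2) ^+ 2 <= (x / 2) ^+ 2 by rewrite ler_pXn2r ?nnegrE//; lra.
by lra.
Qed.

Lemma cvg_sum_ord (T : Type) (F : set_system T) (FF : Filter F) (n : nat)
    (f : 'I_n -> T -> R) (l : 'I_n -> R) :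
  (forall i, f i @ F --> l i) -> \sum_(i < n) f i u @[u --> F] --> \sum_(i < n) l i.
Proof.
elim: n f l => [|n ih] f l h.
  by under eq_fun do rewrite big_ord0; rewrite big_ord0; exact: cvg_cst.
under eq_fun do rewrite big_ord_recl; rewrite big_ord_recl; apply: cvgD; first exact: h.
by apply: ih => i; exact: h.
Qed.

Lemma hemisphere_complete : metric_complete (hemisphere R k).
Proof.
move=> F FF cF.
pose co i (u : hemisphere R k) : R := val u 0 i.
have /choice[l hl] (i : 'I_k.+1) : exists l : R, co i @ F --> l.
  suff /cauchy_cvg/cvg_ex[l hl] : cauchy (co i @ F) by exists l.
  apply/cauchy_ballP => e e0.
  have /cauchy_ballP/(_ e e0)[[A B] [/= FA FB] AB] := cF.
  exists ([set co i u | u in A], [set co i u | u in B]).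
    by split; [apply: filterS FA => u Au; exists u|apply: filterS FB => u Bu; exists u].
  move=> [_ _] [/= [u Au <-] [v Bv <-]]; rewrite -ball_normE /ball_/=.
  apply: (le_lt_trans (hemisphere_coord_le u v i)).
  by have := AB (u, v) (conj Au Bv); rewrite ballEmdist.
pose L : 'rV[R]_k.+1 := \row_i l i.
have uL : (fun u : hemisphere R k => euclidean_dot L (val u)) @ F --> euclidean_dot L L.
  apply: cvg_sum_ord => i; rewrite mxE; apply: cvgM; first exact: cvg_cst.
  exact: hl.
have L1 : euclidean_dot L L = 1.
  have : (fun u : hemisphere R k => euclidean_dot (val u) (val u)) @ F --> euclidean_dot L L.
    by apply: cvg_sum_ord => i; rewrite mxE; apply: cvgM; exact: hl.
  under eq_fun do rewrite hemisphere_unit.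
  by move=> h; apply: (cvg_unique (@Rhausdorff R) h); exact: cvg_cst.
have L0 : 0 <= L 0 ord0.
  rewrite mxE -(cvg_lim (@Rhausdorff R) (hl ord0)).
  by apply: limr_ge; [exact: cvgP (hl ord0)|apply: nearW => u; exact: hemisphere_ge0].
have PL : (euclidean_dot L L == 1) && (0 <= L 0 ord0) by rewrite L1 eqxx.
pose Lh : hemisphere R k := exist _ L PL; exists Lh.
apply/metricType_numDomainType.fcvgrPdist_lt => e e0.
have [de de0 hde] := @acos_close R 1 e ltac:(lra) e0.
rewrite L1 in uL; near=> u.
have : `|euclidean_dot L (val u) - 1| < de by near: u; exact: cvgr_distC_lt.
move=> /(hde _ (hemisphere_bound Lh u)); rewrite acos1 subr0.
by rewrite ger0_norm//; exact: acos_ge0 (hemisphere_bound Lh u).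
Unshelve. all: end_near. Qed.

End HemisphereComplete.

(** * Spaces of directions and boundary points *)

Section SpaceOfDirections.
Context {R : realType} (M : metricType R).

Lemma shortest_path_dist0 (p : M) (c : shortest_path p) (t : R) :
  0 <= t <= shortest_path_length c -> mdist p (c t) = t.
Proof.
move=> tL; have /andP[t0 _] := tL; have L0 := shortest_path_length_gt0 c.
have := @shortest_path_dist _ _ _ c 0 t; rewrite lexx (ltW L0) => /(_ isT tL).
by rewrite shortest_path_start sub0r normrN ger0_norm.
Qed.

Lemma is_angle_near (p : M) (c1 c2 : shortest_path p) (la : R) : -1 <= la <= 1 ->
  (forall e : R, 0 < e -> exists2 rho : R, 0 < rho & forall s t : R,
     0 < s < rho -> 0 < t < rho -> s <= shortest_path_length c1 ->
     t <= shortest_path_length c2 ->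
     `|(s ^+ 2 + t ^+ 2 - mdist (c1 s) (c2 t) ^+ 2) / (2 * (s * t)) - la| < e) ->
  is_angle c1 c2 (acos la).
Proof.
move=> la1 h; apply/cvgrPdist_lt => e e0.
have [de de0 hde] := acos_close la1 e0; have [rho rho0 hrho] := h de de0.
have L1 := shortest_path_length_gt0 c1; have L2 := shortest_path_length_gt0 c2.
pose r := Num.min rho (Num.min (shortest_path_length c1) (shortest_path_length c2)).
have r0 : 0 < r by rewrite !lt_min rho0 L1 L2.
have near_r : \forall s \near (0 : R)^'+, 0 < s < r.
  by near=> s; apply/andP; split; near: s; [exact: nbhs_right_gt|exact: nbhs_right_lt].
exists ([set s | 0 < s < r], [set s | 0 < s < r]) => //= -[s t] /= [/andP[s0 sr] /andP[t0 tr]].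
move: sr tr; rewrite !lt_min => /andP[s1 /andP[s2 s3]] /andP[t1 /andP[t2 t3]].
have ps : mdist (c1 s) p = s by rewrite metric_sym shortest_path_dist0// !ltW.
have pt : mdist p (c2 t) = t by rewrite shortest_path_dist0// !ltW.
have b : -1 <= triangle_cos p (c1 s) (c2 t) <= 1.
  by apply: triangle_cos_bound; rewrite -mdist_gt0 ?pt// metric_sym ps.
rewrite distrC; apply: hde => //; rewrite ps pt; apply: hrho => //; rewrite ?s0 ?t0//; exact: ltW.
Unshelve. all: end_near. Qed.

Lemma dense_surjective (A : Type) (S : metricType R) (f : A -> S) :
  (forall x, exists a, f a = x) -> dense (range f).
Proof. by move=> sf O [x Ox] _; have [a fa] := sf x; exists x; split => //; exists a. Qed.

End SpaceOfDirections.

Section IntervalBoundary.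
Context {R : realType} (S : metricType R).

Lemma interval_boundary_point (h : S -> R) (p : S) :
  (forall x y, mdist x y = `|h x - h y|) -> (forall x, 0 <= h x) ->
  (forall t, 0 <= t < 1 -> exists x, h x = t) -> h p = 0 -> manifold_boundary_point1 p.
Proof.
move=> hd h0 sh hp.
have h_inj x y : h x = h y -> x = y.
  by move=> e; apply: mdist_positivity; rewrite hd e subrr normr0.
have /choice[g hg] (t : R) : exists x, 0 <= t < 1 -> h x = t.
  have [/sh[x hx]|] := pselect (0 <= t < 1); first by exists x.
  by exists p.
have hgI t : `[0, 1[%classic t -> h (g t) = t by rewrite /= in_itv/=; exact: hg.
exists [set x | h x < 1], h, g; split; split.
- rewrite -metricType_numDomainType.filter_from_mdist_nbhs; exists 1 => //= x.
  by rewrite hd hp sub0r normrN ger0_norm.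
- apply: continuous_subspaceT => x; apply/cvgrPdist_lt => e e0; near=> y.
  rewrite -hd; near: y; apply/metricType_numDomainType.nbhs_mdistP.
  by exists e.
- apply/subspace_continuousP => x x01; apply/metricType_numDomainType.cvgrPdist_lt => e e0.
  rewrite near_withinE; near=> y => y01.
  by rewrite hd !hgI//; near: y; exists e.
- by move=> _ [x /= x1 <-]; rewrite in_itv/= h0.
- by move=> _ [t t01 <-] /=; rewrite hgI//; move: t01; rewrite /= in_itv/= => /andP[].
- by move=> x; rewrite inE/= => x1; apply: h_inj; rewrite hg// h0.
- by move=> t; rewrite inE; exact: hgI.
- exact: hp.
Unshelve. all: end_near. Qed.

End IntervalBoundary.

Section HemispherePole.
Context {R : realType} (k : nat).

(** The point at angle [s] from the last basis vector, in direction [w]. That vector, the later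
    [pole], has coordinate [ord0] equal to 0, so it lies on the rim of the hemisphere. *)
Definition meridian_row (s : R) (w : 'rV[R]_k.+1) : 'rV[R]_k.+2 :=
  insert_coord ord_max (cos s) (sin s *: w).

Lemma lift_max_ord0 : lift (ord_max : 'I_k.+2) ord0 = ord0.
Proof. by apply: ord_inj; rewrite lift_max. Qed.

Lemma meridian_row_ge0 (s : R) (u : hemisphere R k) : 0 <= s <= pi ->
  0 <= meridian_row s (val u) 0 ord0.
Proof.
move=> s0; rewrite -lift_max_ord0 insert_coord_lift mxE mulr_ge0 ?hemisphere_ge0//.
exact: sin_ge0_pi.
Qed.

Lemma meridian_row_dot (s t : R) (v w : 'rV[R]_k.+1) :
  euclidean_dot (meridian_row s v) (meridian_row t w)
    = cos s * cos t + sin s * sin t * euclidean_dot v w.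
Proof.
rewrite (euclidean_dot_pivot ord_max) !insert_coord_pivot !insert_coordK.
by rewrite !euclidean_dotE; ring.
Qed.

Lemma meridian_row_unit (s : R) (u : hemisphere R k) :
  euclidean_dot (meridian_row s (val u)) (meridian_row s (val u)) = 1.
Proof. by rewrite meridian_row_dot hemisphere_unit mulr1 -!expr2 cos2Dsin2. Qed.

Lemma pole_subproof : (euclidean_dot (insert_coord (ord_max : 'I_k.+2) 1 0 : 'rV[R]__)
    (insert_coord ord_max 1 0) == 1) && (0 <= insert_coord (ord_max : 'I_k.+2) (1 : R) 0 0 ord0).
Proof.
rewrite (euclidean_dot_pivot ord_max) !insert_coord_pivot !insert_coordK.
rewrite -lift_max_ord0 insert_coord_lift mxE lexx andbT.
by rewrite -(scale0r (0 : 'rV[R]_k.+1)) euclidean_dotZl mul0r addr0 mulr1.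
Qed.

Definition pole : hemisphere R k.+1 := exist _ (insert_coord ord_max 1 0) pole_subproof.

Lemma pole_meridian w : val pole = meridian_row 0 w.
Proof. by rewrite /meridian_row cos0 sin0 scale0r. Qed.

Lemma meridian_exists (s : R) (u : hemisphere R k) : 0 <= s <= pi ->
  exists x : hemisphere R k.+1, val x = meridian_row s (val u).
Proof.
move=> s0.
have P : (euclidean_dot (meridian_row s (val u)) (meridian_row s (val u)) == 1) &&
    (0 <= meridian_row s (val u) 0 ord0) by rewrite meridian_row_unit eqxx meridian_row_ge0.
by exists (exist _ (meridian_row s (val u)) P).
Qed.

(** The components orthogonal to the pole have scalar products [sin s * sin t], so all are multiples
    of one unit vector. *)
Lemma shortest_path_pole (c : shortest_path pole) : exists u : hemisphere R k,
  forall s, 0 <= s <= shortest_path_length c -> val (c s) = meridian_row s (val u).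
Proof.
set L := shortest_path_length c; have L0 : 0 < L := shortest_path_length_gt0 c.
have LL : 0 <= L <= L by rewrite lexx ltW.
have Lpi : L <= pi by rewrite -(shortest_path_dist0 LL) mdist_hemisphere_le_pi.
pose w s := remove_coord ord_max (val (c s)).
have cs_max s : 0 <= s <= L -> val (c s) 0 ord_max = cos s.
  move=> sL; have := cos_mdist_hemisphere pole (c s); rewrite shortest_path_dist0// => ->.
  rewrite (euclidean_dot_pivot ord_max) insert_coord_pivot insert_coordK mul1r.
  by rewrite -(scale0r (0 : 'rV[R]_k.+1)) euclidean_dotZl mul0r addr0.
have ww s t : 0 <= s <= L -> 0 <= t <= L -> euclidean_dot (w s) (w t) = sin s * sin t.
  move=> sL tL; have := cos_mdist_hemisphere (c s) (c t).
  rewrite shortest_path_dist// cos_norm cosB (euclidean_dot_pivot ord_max) !cs_max//.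
  by move=> /addrI.
(* Normalising at the midpoint avoids [sin L], which is 0 for a path of length [pi]. *)
have hL : 0 <= L / 2 <= L by lra.
have sh : 0 < sin (L / 2) by rewrite sin_gt0_pi//; lra.
have P : (euclidean_dot ((sin (L / 2))^-1 *: w (L / 2)) ((sin (L / 2))^-1 *: w (L / 2)) == 1) &&
    (0 <= ((sin (L / 2))^-1 *: w (L / 2)) 0 ord0).
  rewrite !euclidean_dotE ww//; apply/andP; split.
    by apply/eqP; field; rewrite gt_eqF.
  rewrite !mxE lift_max_ord0 mulr_ge0 ?hemisphere_ge0//.
  by rewrite invr_ge0 ltW.
exists (exist _ ((sin (L / 2))^-1 *: w (L / 2)) P) => s sL /=.
rewrite -(remove_coordK ord_max (val (c s))) cs_max//; congr insert_coord.
apply/eqP; rewrite -subr_eq0; apply/eqP/euclidean_dot_eq0; rewrite -/(w s).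
rewrite !euclidean_dotE !ww//; field.
by rewrite gt_eqF.
Qed.

Lemma hemisphere_space_of_directions : is_space_of_directions pole (hemisphere R k).
Proof.
split; first exact: hemisphere_complete.
have /choice[dir hdir] := shortest_path_pole; exists dir; split; last first.
  move=> c1 c2; apply: is_angle_near; first exact: hemisphere_bound.
  move=> e e0; have [rho rho0 h] := spherical_comparison_limit
    (hemisphere_bound (dir c1) (dir c2)) e0.
  exists rho => // s t sr tr sL tL; apply: h => //.
    have s0 : 0 <= s <= shortest_path_length c1 by case/andP: sr => /ltW ->.
    have t0 : 0 <= t <= shortest_path_length c2 by case/andP: tr => /ltW ->.
    have := metric_triangle (c1 s) pole (c2 t); rewrite mdist_ge0 (metric_sym (c1 s) pole).
    by rewrite !shortest_path_dist0.
  rewrite cos_mdist_hemisphere !hdir ?sL ?tL ?andbT; [|lra|lra].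
  by rewrite meridian_row_dot; ring.
(* Each direction is attained by a meridian of length 1, so completing adds nothing. *)
apply: dense_surjective => u.
have pi2 := pi_ge2 R.
have /choice[m hm] (s : R) : exists x : hemisphere R k.+1,
    0 <= s <= 1 -> val x = meridian_row s (val u).
  have [s1|] := pselect (0 <= s <= 1); last by exists pole.
  by have [|x hx] := @meridian_exists s u; [lra|exists x].
have m0 : m 0 = pole by apply: val_inj; rewrite hm ?lexx ?ler01//= -pole_meridian.
have md s t : 0 <= s <= 1 -> 0 <= t <= 1 -> mdist (m s) (m t) = `|s - t|.
  move=> s1 t1; rewrite -[LHS]/(acos (euclidean_dot (val (m s)) (val (m t)))).
  rewrite !hm// meridian_row_dot hemisphere_unit mulr1 -cosB -cos_norm cosK//.
  by rewrite in_itv/= normr_ge0/= ler_norml; lra.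
pose c : shortest_path pole := Build_shortest_path ltr01 m0 md.
exists c; have L1 : 0 <= (1 : R) <= shortest_path_length c by rewrite ler01 lexx.
have := hdir c 1 L1; rewrite [val _]hm ?ler01 ?lexx//.
move=> /(congr1 (remove_coord ord_max)); rewrite !insert_coordK => e.
have s1 : sin (1 : R) != 0 by rewrite gt_eqF// sin_gt0_pi// ltr01/=; lra.
by apply: val_inj; rewrite -[LHS](scalerK s1) -e scalerK.
Qed.

End HemispherePole.

Section Boundaries.
Context {R : realType}.

(** The distance from the pole is an isometric coordinate on the half circle. This is the base of
    the recursion, where boundary is that of a 1-dimensional manifold. *)
Lemma half_circle_boundary : manifold_boundary_point1 (pole (R := R) 0).
Proof.
have pi2 := pi_ge2 R.
pose h (x : hemisphere R 1) : R := mdist (pole 0) x.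
have h0 x : 0 <= h x by exact: mdist_ge0.
have hpi x : h x <= pi by exact: mdist_hemisphere_le_pi.
have one_ge0 (x : hemisphere R 0) : val x 0 ord0 = 1.
  have := hemisphere_unit x; have := hemisphere_ge0 x.
  rewrite /euclidean_dot big_ord_recl big_ord0 addr0; move: (val x 0 ord0) => a a0 a1.
  have : (a - 1) * (a + 1) = 0 by lra.
  by move=> /eqP; rewrite mulf_eq0 => /orP[/eqP|/eqP]; lra.
have rem x : remove_coord ord_max (val x) 0 ord0 = sin (h x).
  have := hemisphere_unit x; have := cos_mdist_hemisphere (pole 0) x.
  rewrite !(euclidean_dot_pivot (ord_max : 'I_2)) insert_coord_pivot insert_coordK mul1r.
  rewrite -/(h x) -(scale0r (0 : 'rV[R]_1)) euclidean_dotZl mul0r addr0 => <-.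
  rewrite /euclidean_dot big_ord_recl big_ord0 addr0.
  have : 0 <= remove_coord ord_max (val x) 0 ord0.
    by rewrite mxE lift_max_ord0 hemisphere_ge0.
  move: (remove_coord _ _ _ _) => a a0 h1.
  have s0 : 0 <= sin (h x) by rewrite sin_ge0_pi// h0 hpi.
  apply/eqP; rewrite -(@eqrXn2 _ 2)// sin2cos2; apply/eqP; lra.
have mer x : exists2 w : hemisphere R 0, val x = meridian_row (h x) (val w) & True.
  have P : (euclidean_dot (const_mx 1 : 'rV[R]_1) (const_mx 1) == 1) &&
     (0 <= (const_mx 1 : 'rV[R]_1) 0 ord0).
    by rewrite /euclidean_dot big_ord_recl big_ord0 !mxE addr0 mulr1 eqxx ler01.
  exists (exist _ (const_mx 1) P) => //=.
  rewrite -(remove_coordK (ord_max : 'I_2) (val x)); congr insert_coord; last first.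
    by apply/rowP => i; rewrite ord1 rem !mxE mulr1.
  have := cos_mdist_hemisphere (pole 0) x; rewrite -/(h x) => ->.
  rewrite (euclidean_dot_pivot (ord_max : 'I_2)) insert_coord_pivot insert_coordK mul1r.
  by rewrite -(scale0r (0 : 'rV[R]_1)) euclidean_dotZl mul0r addr0.
apply: (interval_boundary_point (h := h)) => //.
- move=> x y; rewrite -[LHS]/(acos (euclidean_dot (val x) (val y))).
  have [u -> _] := mer x; have [v -> _] := mer y; rewrite meridian_row_dot.
  have -> : euclidean_dot (val u) (val v) = 1.
    by rewrite /euclidean_dot big_ord_recl big_ord0 addr0 !one_ge0 mulr1.
  rewrite mulr1 -cosB -cos_norm cosK// in_itv/= normr_ge0/= ler_norml.
  by have := h0 x; have := h0 y; have := hpi x; have := hpi y; lra.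
- move=> t /andP[t0 t1]; have [w _ _] := mer (pole 0).
  have [|x hx] := @meridian_exists R 0 t w; first by rewrite t0; lra.
  exists x; rewrite /h -[LHS]/(acos (euclidean_dot (val (pole 0)) (val x))).
  rewrite (pole_meridian (val w)) hx meridian_row_dot cos0 sin0 !mul0r mul1r addr0 cosK//.
  by rewrite in_itv/= t0; lra.
- exact: mdistxx.
Qed.

Lemma hemisphere_boundary_point (k : nat) : exists x : hemisphere R k.+1, boundary_point k.+1 x.
Proof.
elim: k => [|k [x bx]]; first by exists (pole 0); exact: half_circle_boundary.
exists (pole k.+1); exists (hemisphere R k.+1); first exact: hemisphere_space_of_directions.
by exists x.
Qed.

Variables (M : metricType R) (k : nat) (f : M -> 'rV[R]_k.+1).
Hypothesis fd : forall x y, euclidean_dist (f x) (f y) = mdist x y.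
Hypothesis f0 : forall x, 0 <= f x 0 ord0.
Hypothesis fs : forall v : 'rV[R]_k.+1, 0 <= v 0 ord0 -> exists x, f x = v.

Let f_inj x y : f x = f y -> x = y.
Proof.
move=> e; apply: mdist_positivity; rewrite -fd e /euclidean_dist big1 ?sqrtr0// => i _.
by rewrite subrr expr0n.
Qed.

(** Scalar products [s * t] force a shortest path from the origin to be straight, and its unit
    direction has nonnegative height; conversely every point of the hemisphere is such a
    direction. *)
Lemma half_space_directions (p : M) : f p = 0 -> is_space_of_directions p (hemisphere R k).
Proof.
move=> fp; split; first exact: hemisphere_complete.
have f_dot x y : 2 * euclidean_dot (f x) (f y) = mdist p x ^+ 2 + mdist p y ^+ 2 - mdist x y ^+ 2.
  have z (w : 'rV[R]_k.+1) : euclidean_dot 0 w = 0 by rewrite -(scale0r (0 : 'rV[R]_k.+1)) euclidean_dotZl mul0r.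
  by rewrite -!fd !sqr_euclidean_distE fp !z; ring.
have paths (c : shortest_path p) : exists u : hemisphere R k,
    forall s, 0 <= s <= shortest_path_length c -> f (c s) = s *: val u.
  set L := shortest_path_length c; have L0 : 0 < L := shortest_path_length_gt0 c.
  have LL : 0 <= L <= L by rewrite lexx ltW.
  have cc s t : 0 <= s <= L -> 0 <= t <= L -> euclidean_dot (f (c s)) (f (c t)) = s * t.
    move=> sL tL; have := f_dot (c s) (c t).
    rewrite !shortest_path_dist0// shortest_path_dist// real_normK ?num_real//; lra.
  have P : (euclidean_dot (L^-1 *: f (c L)) (L^-1 *: f (c L)) == 1) &&
      (0 <= (L^-1 *: f (c L)) 0 ord0).
    rewrite !euclidean_dotE cc// mxE mulr_ge0 ?invr_ge0 ?(ltW L0)// andbT.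
    by apply/eqP; field; rewrite gt_eqF.
  exists (exist _ (L^-1 *: f (c L)) P) => s sL /=; apply/eqP; rewrite -subr_eq0; apply/eqP/euclidean_dot_eq0.
  by rewrite !euclidean_dotE !cc//; field; rewrite gt_eqF.
have /choice[dir hdir] := paths; exists dir; split; last first.
  move=> c1 c2; apply: is_angle_near; first exact: hemisphere_bound.
  move=> e e0; exists 1 => // s t /andP[s0 _] /andP[t0 _] sL tL.
  have -> : mdist (c1 s) (c2 t) ^+ 2 = s ^+ 2 + t ^+ 2
      - 2 * (s * t) * euclidean_dot (val (dir c1)) (val (dir c2)).
    rewrite -fd sqr_euclidean_distE !hdir ?sL ?tL ?(ltW s0) ?(ltW t0)//.
    by rewrite !euclidean_dotE !hemisphere_unit; ring.
  have -> : (s ^+ 2 + t ^+ 2 - (s ^+ 2 + t ^+ 2 - 2 * (s * t) *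
      euclidean_dot (val (dir c1)) (val (dir c2)))) / (2 * (s * t))
      - euclidean_dot (val (dir c1)) (val (dir c2)) = 0.
    by field; rewrite !gt_eqF.
  by rewrite normr0.
apply: dense_surjective => u.
have /choice[m hm] (s : R) : exists x : M, 0 <= s <= 1 -> f x = s *: val u.
  have [/andP[s0 s1]|] := pselect (0 <= s <= 1); last by exists p.
  have [|x hx] := @fs (s *: val u); last by exists x.
  by rewrite mxE mulr_ge0 ?hemisphere_ge0.
have m0 : m 0 = p by apply: f_inj; rewrite hm ?lexx ?ler01// scale0r.
have md s t : 0 <= s <= 1 -> 0 <= t <= 1 -> mdist (m s) (m t) = `|s - t|.
  move=> s1 t1; apply/eqP; rewrite -(@eqrXn2 _ 2) ?mdist_ge0//; apply/eqP.
  rewrite -fd sqr_euclidean_distE !hm// !euclidean_dotE hemisphere_unit.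
  by rewrite real_normK ?num_real//; ring.
pose c : shortest_path p := Build_shortest_path ltr01 m0 md.
exists c; have L1 : 0 <= (1 : R) <= shortest_path_length c by rewrite ler01 lexx.
have := hdir c 1 L1; rewrite [f _]hm ?ler01 ?lexx// !scale1r => e.
exact: val_inj.
Qed.

Lemma half_space_boundary_point : exists p : M, boundary_point k.+1 p.
Proof.
have [|p fp] := @fs 0; first by rewrite mxE.
(* For [k = 0] the space is a half-line, and [boundary_point 1] asks for a chart instead of
   directions. *)
exists p; move: f fd f0 fs fp half_space_directions; case: k => [|k'] g gd g0 gs gp gdir.
  apply: (interval_boundary_point (h := fun x => g x 0 ord0)) => //.
  - move=> x y; rewrite -gd /euclidean_dist big_ord_recl big_ord0 addr0.
    by rewrite sqrtr_sqr.
  - move=> t /andP[t0 _]; have [|x hx] := @gs (const_mx t); first by rewrite mxE.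
    by exists x; rewrite hx mxE.
  - by rewrite gp mxE.
exists (hemisphere R k'.+1); first exact: gdir.
exact: hemisphere_boundary_point.
Qed.

End Boundaries.

Theorem theorem8p1 (R : realType) (n : nat) (M : metricType R)
  (hM : nonneg_alexandrov_space n M)
  (hnc : ~ compact [set: M])
  (hob : comparison_obtuse_constant M = (pi / 2)%:E)
  (hbd : without_boundary n M) :
  isometric_to_euclidean M n.
Proof.
(* The empty space is compact, so noncompactness provides a point. *)
have [x0] : inhabited M.
  apply: contrapT => no; apply: hnc => F FF _.
  by have [x _] := @filter_ex _ F FF setT filterT; case: no.
have [//|[k [nk [f [fd f0 fs]]]]] := obtuse_alexandrov_flat hM hob x0.
have [p bp] := half_space_boundary_point fd f0 fs.
suff : [set p : M | boundary_point n p] p by rewrite hbd.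
by rewrite /= nk.
Qed.
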